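(* Let $G$ be a group. (a) Suppose $G$ satisfies $(M_{\{1\}\subseteq\mathcal{FIN}})$, and let $\mathcal{M}$ be a complete system of representatives of the conjugacy classes of maximal finite subgroups $F\subseteq G$. Consider a cellular $G$-pushout $$\begin{array}{ccc} \coprod_{F\in\mathcal{M}} G\times_{N_GF}EN_GF & \xrightarrow{\ i\ } & EG\\ \big\downarrow{\scriptstyle\coprod_{F\in\mathcal{M}}\mathrm{id}_G\times f_F} & & \big\downarrow\\ \coprod_{F\in\mathcal{M}} G\times_{N_GF}EW_GF & \longrightarrow & X \end{array}$$ where each $f_F\colon EN_GF\to EW_GF$ is an $N_GF$-map, and where the maps starting from the left upper corner are cellular and one of them is an inclusion of $G$-CW-complexes. Then $X$ is a model for $\underline{E}G$. (b) Suppose $G$ satisfies $(M_{\mathcal{FIN}\subseteq\mathcal{VCY}})$, and let $\mathcal{M}$ be a complete system of representatives of the conjugacy classes of maximal infinite virtually cyclic subgroups $V\subseteq G$. Consider a cellular $G$-pushout $$\begin{array}{ccc} \coprod_{V\in\mathcal{M}} G\times_{N_GV}\underline{E}N_GV & \xrightarrow{\ i\ } & \underline{E}G\\ \big\downarrow{\scriptstyle\coprod_{V\in\mathcal{M}}\mathrm{id}_G\times f_V} & & \big\downarrow\\ \coprod_{V\in\mathcal{M}} G\times_{N_GV}EW_GV & \longrightarrow & Y \end{array}$$ where each $f_V\colon \underline{E}N_GV\to EW_GV$ is an $N_GV$-map, and where the maps starting from the left upper corner are cellular and one of them is an inclusion of $G$-CW-complexes. Then $Y$ is a model for $\underline{\underline{E}}G$.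 In both parts, for $H\subseteq G$, $EW_GH$ is viewed as an $N_GH$-CW-complex by restriction along the projection $N_GH\to W_GH$.
   Context: Groups are discrete. A family of subgroups of $G$ is a set of subgroups closed under conjugation and taking subgroups. A model for $E_{\mathcal{F}}(G)$ is a $G$-CW-complex $X$ with $X^H$ contractible for $H\in\mathcal{F}$ and empty for $H\notin\mathcal{F}$. $\{1\}$, $\mathcal{FIN}$, $\mathcal{VCY}$ denote the families consisting of the trivial subgroup, of the finite subgroups, and of the virtually cyclic subgroups (including finite ones), respectively. $EG=E_{\{1\}}(G)$, $\underline{E}G=E_{\mathcal{FIN}}(G)$, $\underline{\underline{E}}G=E_{\mathcal{VCY}}(G)$. $N_GH$ is the normalizer of $H$ in $G$ and $W_GH=N_GH/H$. For families $\mathcal{F}\subseteq\mathcal{G}$ of subgroups of $G$, the group $G$ satisfies $(M_{\mathcal{F}\subseteq\mathcal{G}})$ if every $H\in\mathcal{G}\setminus\mathcal{F}$ is contained in a unique $H_{\max}\in\mathcal{G}\setminus\mathcal{F}$ which is maximal in $\mathcal{G}\setminus\mathcal{F}$ (i.e. $H_{\max}\subseteq K$ with $K\in\mathcal{G}\setminus\mathcal{F}$ implies $H_{\max}=K$). *)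

(* Defs.v *)
From HB Require Import structures.
From mathcomp Require Import all_boot all_order all_algebra.
From mathcomp Require Import all_classical all_reals topology normedtype.

Set Implicit Arguments.
Unset Strict Implicit.
Unset Printing Implicit Defensive.

Import GRing.Theory Num.Theory.
Import numFieldNormedType.Exports.

Local Open Scope classical_set_scope.
Local Open Scope quotient_scope.
Local Open Scope group_scope.

Record subgroup (G : groupType) := Subgroup {
  sg_set :> set G;
  sg_closed : group_closed (mem sg_set) }.

HB.instance Definition _ (G : groupType) := gen_eqMixin (subgroup G).
HB.instance Definition _ (G : groupType) := gen_choiceMixin (subgroup G).

Lemma group_closedP (G : groupType) (A : set G) :
  A 1 -> (forall x y, A x -> A y -> A (x * y)) -> (forall x, A x -> A x^-1) ->
  group_closed (mem A).
Proof.
move=> A1 AM AV; split; first exact: mem_set.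
by move=> x y /set_mem Ax /set_mem Ay; apply/mem_set/AM => //; exact: AV.
Qed.

Section Subgroups.
Variable G : groupType.
Implicit Types (H K C : subgroup G) (g x y : G).

Lemma sg1 H : sg_set H 1.
Proof. by have [H1 _] := sg_closed H; exact: set_mem. Qed.

Lemma sgF H x y : sg_set H x -> sg_set H y -> sg_set H (x / y).
Proof.
by have [_ HF] := sg_closed H => Hx Hy; apply/set_mem/HF; exact: mem_set.
Qed.

Lemma sgV H x : sg_set H x -> sg_set H x^-1.
Proof. by move=> Hx; rewrite -div1g; apply: sgF => //; exact: sg1. Qed.

Lemma sgM H x y : sg_set H x -> sg_set H y -> sg_set H (x * y).
Proof. by move=> Hx Hy; rewrite -(invgK y); apply/sgF/sgV. Qed.

Lemma sgX H x n : sg_set H x -> sg_set H (x ^+ n).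
Proof.
by move=> Hx; elim: n => [|n IH]; [exact: sg1 | rewrite expgS; exact: sgM].
Qed.

Lemma subgroup_ext H K : sg_set H = sg_set K -> H = K.
Proof.
case: H K => [A cA] [B cB] /= AB; subst B; congr Subgroup; exact: Prop_irrelevance.
Qed.

Definition sg_type H : Type := {x : G | x \in sg_set H}.
HB.instance Definition _ H := [isSub of sg_type H for @sval G _].
HB.instance Definition _ H := [Choice of sg_type H by <:].
HB.instance Definition _ H :=
  SubChoice_isSubGroup.Build G _ (sg_type H) (sg_closed H).

Definition conj_set (A : set G) g : set G := [set x ^ g | x in A].

Lemma conj_set_closed H g : group_closed (mem (conj_set H g)).
Proof.
apply: group_closedP.
- by exists 1; [exact: sg1 | exact: conj1g].
- by move=> _ _ [x Hx <-] [y Hy <-]; exists (x * y); rewrite ?conjMg//; exact: sgM.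
- by move=> _ [x Hx <-]; exists x^-1; rewrite ?conjVg//; exact: sgV.
Qed.

Definition conj_subgroup H g : subgroup G := Subgroup (conj_set_closed H g).

Lemma conj_setM (A : set G) g h : conj_set A (g * h) = conj_set (conj_set A g) h.
Proof. by rewrite /conj_set image_comp; apply: eq_imagel => x _; exact: conjgM. Qed.

Lemma conj_set1 (A : set G) : conj_set A 1 = A.
Proof.
by rewrite -[RHS]image_id; apply: eq_imagel => x _; exact: conjg1.
Qed.

Definition normalizer_set H : set G := [set g | conj_set H g = H].

Lemma normalizer_closed H : group_closed (mem (normalizer_set H)).
Proof.
apply: group_closedP => /=.
- exact: conj_set1.
- by move=> x y Nx Ny; rewrite /normalizer_set/= conj_setM Nx Ny.
- by move=> x Nx; rewrite /normalizer_set/= -[in LHS]Nx -conj_setM mulgV conj_set1.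
Qed.

Definition normalizer H : subgroup G := Subgroup (normalizer_closed H).

Lemma sub_in_closed H K : group_closed (mem [set x : sg_type K | sg_set H (\val x)]).
Proof.
apply: group_closedP => /=.
- exact: sg1.
- by move=> x y; exact: sgM.
- by move=> x; exact: sgV.
Qed.

Definition sub_in H K : subgroup (sg_type K) := Subgroup (sub_in_closed H K).

Definition coset_rel H : rel G := fun x y => `[< sg_set H (x^-1 * y) >].

Lemma coset_rel_equiv H : equiv_class_of (coset_rel H).
Proof.
split.
- by move=> x; apply/asboolP; rewrite mulVg; exact: sg1.
- by apply: symmetric_from_pre => x y /asboolP/sgV h; apply/asboolP;
     rewrite invgM invgK in h.
- move=> y x z /asboolP h1 /asboolP h2; apply/asboolP.
  by have := sgM h1 h2; rewrite -mulgA mulVKg.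
Qed.

Canonical coset_rel_equiv_rel H := EquivRelPack (coset_rel_equiv H).

(* G/H : the set of left cosets gH *)
Definition coset H := {eq_quot (coset_rel H)}.
HB.instance Definition _ H := Choice.on (coset H).
HB.instance Definition _ H := EqQuotient.on (coset H).

End Subgroups.


Section WeylGroup.
Variables (G : groupType) (H : subgroup G).
Let N := sg_type (normalizer H).

Definition weyl : Type := coset (sub_in H (normalizer H)).
HB.instance Definition _ := Choice.on weyl.
HB.instance Definition _ := EqQuotient.on weyl.

Definition weyl_proj (n : N) : weyl := \pi_weyl n.
Definition weyl_one : weyl := weyl_proj 1.
Definition weyl_inv (x : weyl) : weyl := weyl_proj (repr x)^-1.
Definition weyl_mul (x y : weyl) : weyl := weyl_proj (repr x * repr y).

Lemma weyl_projP (n m : N) :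
  weyl_proj n = weyl_proj m <-> sg_set H (\val n^-1 * \val m).
Proof.
by split=> [/eqmodP/asboolP|h]; last by apply/eqmodP/asboolP.
Qed.

Lemma weyl_projK (x : weyl) : weyl_proj (repr x) = x.
Proof. exact: reprK. Qed.

Lemma normalizerJ (n : N) x : sg_set H x -> sg_set H (x ^ \val n).
Proof.
by move=> Hx; have /set_mem Nn := valP n; rewrite -[sg_set H]Nn; exists x.
Qed.

Lemma weyl_projM n m : weyl_proj (n * m) = weyl_mul (weyl_proj n) (weyl_proj m).
Proof.
rewrite /weyl_mul; apply/weyl_projP.
have /esym/weyl_projP Hn := weyl_projK (weyl_proj n).
have /esym/weyl_projP Hm := weyl_projK (weyl_proj m).
have := sgM (normalizerJ m Hn) Hm.
by rewrite /= conjgE invgM !mulgA mulgK.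
Qed.

Lemma weyl_projV n : weyl_proj n^-1 = weyl_inv (weyl_proj n).
Proof.
have /weyl_projP Hn := weyl_projK (weyl_proj n).
apply/weyl_projP.
have := normalizerJ n^-1 Hn.
by rewrite /= conjgE invgK !mulgA mulgK.
Qed.

Lemma weyl_mulA : associative weyl_mul.
Proof.
move=> x y z; rewrite -[x]weyl_projK -[y]weyl_projK -[z]weyl_projK.
by rewrite -!weyl_projM mulgA.
Qed.

Lemma weyl_mul1g : left_id weyl_one weyl_mul.
Proof. by move=> x; rewrite -[x]weyl_projK -!weyl_projM mul1g. Qed.

Lemma weyl_mulg1 : right_id weyl_one weyl_mul.
Proof. by move=> x; rewrite -[x]weyl_projK -!weyl_projM mulg1. Qed.

Lemma weyl_mulVg : left_inverse weyl_one weyl_inv weyl_mul.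
Proof.
by move=> x; rewrite -[x]weyl_projK -weyl_projV -!weyl_projM mulVg.
Qed.

Lemma weyl_mulgV : right_inverse weyl_one weyl_inv weyl_mul.
Proof.
by move=> x; rewrite -[x]weyl_projK -weyl_projV -!weyl_projM mulgV.
Qed.

HB.instance Definition _ := isGroup.Build weyl
  weyl_mulA weyl_mul1g weyl_mulg1 weyl_mulVg weyl_mulgV.

Lemma weyl_projF : {morph weyl_proj : x y / x / y}.
Proof. by move=> x y; rewrite weyl_projM weyl_projV. Qed.

HB.instance Definition _ := isGroupMorphism.Build N weyl weyl_proj weyl_projF.
End WeylGroup.

Record family (G : groupType) := Family {
  fam_set :> set (subgroup G);
  fam_conj : forall (H : subgroup G) g, fam_set H -> fam_set (conj_subgroup H g);
  fam_sub : forall H K : subgroup G, K `<=` H -> fam_set H -> fam_set K }.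

Definition lcoset (G : groupType) (A : set G) (g : G) : set G :=
  [set g * a | a in A].

Definition cyclic_subgroup (G : groupType) (C : subgroup G) : Prop :=
  exists c, sg_set C = [set x | exists n : nat, x = c ^+ n \/ x = c ^- n].

(* Finite groups are virtually cyclic: take C trivial. *)
Definition virtually_cyclic (G : groupType) (H : subgroup G) : Prop :=
  exists C : subgroup G, [/\ cyclic_subgroup C, C `<=` H &
    finite_set [set lcoset C h | h in H]].

Section Families.
Variable G : groupType.
Implicit Types (H K C : subgroup G) (g c : G).

Lemma cyclic_conj C g : cyclic_subgroup C -> cyclic_subgroup (conj_subgroup C g).
Proof.
move=> [c Cc]; exists (c ^ g); rewrite /= /conj_set Cc.
apply/seteqP; split=> [_ [_ [n [->|->]] <-]|x /= [n [->|->]]].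
- by exists n; left; rewrite conjXg.
- by exists n; right; rewrite conjVg conjXg.
- by exists (c ^+ n); rewrite ?conjXg//; exists n; left.
- by exists (c ^- n); rewrite ?conjVg ?conjXg//; exists n; right.
Qed.

Lemma cyclic_sub C K : K `<=` C -> cyclic_subgroup C -> cyclic_subgroup K.
Proof.
move=> KC [c Cc].
have [[m0 /asboolP K0]|K1] :=
    pselect (exists n, `[< (0 < n)%N /\ sg_set K (c ^+ n) >]); last first.
  exists 1; apply/seteqP; split=> x /=.
    move=> Kx; exists 0%N; left; have := KC _ Kx; rewrite Cc/= => -[[|n]].
      by move=> [->|->]; rewrite ?invg1.
    move=> xE; absurd_not => _; apply: K1; exists n.+1; apply/asboolP; split=> //.
    by case: xE Kx => [-> //|-> /sgV]; rewrite invgK.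
  by move=> [n [->|->]]; rewrite expg1n ?invg1; exact: sg1.
have exm : exists n, `[< (0 < n)%N /\ sg_set K (c ^+ n) >].
  by exists m0; exact/asboolP.
case: (ex_minnP exm) => m /asboolP[m_gt0 Km] m_min.
have dvd n : sg_set K (c ^+ n) -> exists q, c ^+ n = (c ^+ m) ^+ q.
  move=> Kn; exists (n %/ m)%N; rewrite -expgnA mulnC.
  rewrite [X in c ^+ X = _](divn_eq n m) expgnDr.
  have [->|r0] := posnP (n %% m)%N; first by rewrite mulg1.
  suff /m_min : `[< (0 < n %% m)%N /\ sg_set K (c ^+ (n %% m)) >].
    by rewrite leqNgt ltn_pmod.
  apply/asboolP; split=> //.
  have -> : c ^+ (n %% m) = ((c ^+ m) ^+ (n %/ m))^-1 * c ^+ n.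
    by rewrite -expgnA mulnC [X in _ = _ * c ^+ X](divn_eq n m) expgnDr mulKg.
  by apply: sgM => //; apply/sgV/sgX.
exists (c ^+ m); apply/seteqP; split=> x /=.
  move=> Kx; have := KC _ Kx; rewrite Cc/= => -[n [xE|xE]].
    by move: Kx; rewrite xE => /dvd[q ->]; exists q; left.
  have : sg_set K (c ^+ n) by rewrite -[c ^+ n]invgK -xE; exact: sgV.
  by rewrite xE => /dvd[q ->]; exists q; right.
by move=> [q [->|->]]; [exact: sgX | apply/sgV/sgX].
Qed.

Lemma virtually_cyclic_conj H g :
  virtually_cyclic H -> virtually_cyclic (conj_subgroup H g).
Proof.
move=> [C [cC CH fin]]; exists (conj_subgroup C g); split.
- exact: cyclic_conj.
- exact: image_subset.
- apply: (sub_finite_set _ (finite_image (fun A => conj_set A g) fin)).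
  move=> _ [_ [h Hh <-] <-]; exists (lcoset C h); first by exists h.
  rewrite /conj_set /lcoset/= /conj_set !image_comp; apply: eq_imagel => x _ /=.
  exact: conjMg.
Qed.

Lemma virtually_cyclic_sub H K :
  K `<=` H -> virtually_cyclic H -> virtually_cyclic K.
Proof.
move=> KH [C [cC CH fin]].
have cCK : group_closed (mem (C `&` K)).
  apply: group_closedP.
  - by split; exact: sg1.
  - by move=> x y [? ?] [? ?]; split; exact: sgM.
  - by move=> x [? ?]; split; exact: sgV.
exists (Subgroup cCK); split.
- by apply: cyclic_sub cC => x [].
- by move=> x [].
- apply: (sub_finite_set _ (finite_image (fun A : set G => A `&` K) fin)).
  move=> _ [k Kk <-]; exists (lcoset C k); first by exists k => //; exact: KH.
  apply/seteqP; split=> [_ [[x Cx <-] Kx]|_ [x [Cx Kx] <-]].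
    by exists x => //; split=> //; rewrite -(mulKg k x); apply: sgM => //; exact: sgV.
  by split; [exists x | exact: sgM].
Qed.

Lemma trivial_conj H g : sg_set H = [set 1] -> conj_set H g = [set 1].
Proof. by move=> ->; rewrite /conj_set image_set1 conj1g. Qed.

Lemma trivial_sub H K : K `<=` H -> sg_set H = [set 1] -> sg_set K = [set 1].
Proof.
by move=> KH H1; apply/seteqP; split=> [x /KH|_ ->]; [rewrite H1 | exact: sg1].
Qed.

Definition triv_fam : family G :=
  @Family G [set H | sg_set H = [set 1]] trivial_conj trivial_sub.

Definition FIN : family G :=
  @Family G [set H | finite_set H]
    (fun H g => @finite_image _ _ H (conjg^~ g))
    (fun H K => @sub_finite_set _ K H).

Definition VCY : family G :=
  @Family G [set H | virtually_cyclic H] virtually_cyclic_conj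
    virtually_cyclic_sub.

Definition maximal_in (S : set (subgroup G)) (K : subgroup G) : Prop :=
  S K /\ forall L, S L -> K `<=` L -> K = L.

Definition satisfies_M (F1 F2 : family G) : Prop :=
  F1 `<=` F2 /\
  forall H, (F2 `\` F1) H ->
    exists! Hmax : subgroup G, H `<=` Hmax /\ maximal_in (F2 `\` F1) Hmax.

Definition conjugate H K : Prop := exists g, K = conj_subgroup H g.

Definition conj_representatives (S M : set (subgroup G)) : Prop :=
  M `<=` S /\ forall H, S H -> exists! K, M K /\ conjugate H K.

End Families.
Arguments triv_fam G : clear implicits.
Arguments FIN G : clear implicits.
Arguments VCY G : clear implicits.

(* G is discrete, so an action G x X -> X is continuous iff every g acts
   continuously. *)
Record gspace (G : groupType) := GSpace {
  gsp :> topologicalType;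
  act : G -> gsp -> gsp;
  act_continuous : forall g, continuous (act g);
  act1 : forall x, act 1 x = x;
  actM : forall g h x, act (g * h) x = act g (act h x) }.

Definition is_gmap (G : groupType) (X Y : gspace G) (f : X -> Y) : Prop :=
  continuous f /\ forall g x, f (act g x) = act g (f x).

Definition is_gpushout (G : groupType) (A B C D : gspace G)
    (f : A -> B) (u : A -> C) (v : B -> D) (w : C -> D) : Prop :=
  [/\ is_gmap f, is_gmap u, is_gmap v, is_gmap w & v \o f = w \o u] /\
  forall (Z : gspace G) (b : B -> Z) (c : C -> Z),
    is_gmap b -> is_gmap c -> b \o f = c \o u ->
    exists! d : D -> Z, [/\ is_gmap d, d \o v = b & d \o w = c].

Definition fixed_points (G : groupType) (X : gspace G) (H : subgroup G) :
  set X := [set x | forall h, sg_set H h -> act h x = x].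
Arguments fixed_points {G} X H _.

Definition inclusion (T : Type) (A B : set T) (AB : A `<=` B) (x : A) : B :=
  SigSub (mem_set (AB _ (set_mem (valP x)))).

Lemma pair_map_continuous (S S' T T' : topologicalType) (f : S -> S')
  (g : T -> T') : continuous f -> continuous g ->
  continuous (fun x : S * T => (f x.1, g x.2)).
Proof.
move=> cf cg [x y] U [[P Q] /= [nP nQ] PQU].
exists (f @^-1` P, g @^-1` Q) => /=; first by split; [exact: cf | exact: cg].
by move=> [a b] [/= Pa Qb]; apply: PQU; split.
Qed.

Lemma discrete_continuous (S : discreteTopologicalType) (T : topologicalType)
  (f : S -> T) : continuous f.
Proof. by apply/continuousP => U _; exact: discrete_open. Qed.

Section Constructions.
Variable G : groupType.

Section Subspace.
Variables (X : gspace G) (A : set X).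
Hypothesis actA : forall g x, A x -> A (act g x).

Definition subspace_act g (x : A) : A :=
  SigSub (mem_set (actA g (set_mem (valP x)))).

Lemma subspace_act_continuous g : continuous (subspace_act g).
Proof.
apply/continuousP => _ [U oU <-]; exists (act g @^-1` U) => //.
by move/continuousP: (@act_continuous G X g); apply.
Qed.

Lemma subspace_act1 x : subspace_act 1 x = x.
Proof. by apply: val_inj; exact: act1. Qed.

Lemma subspace_actM g h x :
  subspace_act (g * h) x = subspace_act g (subspace_act h x).
Proof. by apply: val_inj; exact: actM. Qed.

Definition gsubspace : gspace G :=
  @GSpace G (set_type A) subspace_act subspace_act_continuous
    subspace_act1 subspace_actM.
End Subspace.

Section Coproduct.
Variables (I : choiceType) (X : I -> gspace G).

Definition coprod_act g (x : {i & X i}) : {i & X i} :=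
  existT (fun i => gsp (X i)) (projT1 x) (act g (projT2 x)).

Lemma coprod_act_continuous g : continuous (coprod_act g).
Proof.
apply: (@sigT_continuous I (fun i => X i) _
  (fun i x => existT (fun i => gsp (X i)) i (act g x))) => i x.
apply: continuous_comp; first exact: act_continuous.
exact: existT_continuous.
Qed.

Lemma coprod_act1 x : coprod_act 1 x = x.
Proof. by case: x => i x; rewrite /coprod_act/= act1. Qed.

Lemma coprod_actM g h x : coprod_act (g * h) x = coprod_act g (coprod_act h x).
Proof. by case: x => i x; rewrite /coprod_act/= actM. Qed.

Definition gcoprod : gspace G :=
  @GSpace G {i & X i} coprod_act coprod_act_continuous coprod_act1 coprod_actM.
End Coproduct.

Definition gcoprod_map (I : choiceType) (X Y : I -> gspace G)
  (f : forall i, X i -> Y i) (x : gcoprod X) : gcoprod Y :=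
  existT (fun i => gsp (Y i)) (projT1 x) (f (projT1 x) (projT2 x)).

(* G/H x A, with G/H discrete and G acting on the left factor *)
Section CosetTimes.
Variables (H : subgroup G) (A : topologicalType).
Let T : topologicalType := (discrete_topology (coset H) * A)%type.

Definition coset_act (g : G) (c : coset H) : coset H := \pi_(coset H) (g * repr c).

Lemma coset_act_pi g x : coset_act g (\pi_(coset H) x) = \pi_(coset H) (g * x).
Proof.
have /eqmodP/asboolP := reprK (\pi_(coset H) x).
move=> h; apply/eqmodP/asboolP; by rewrite invgM mulgA mulgVK.
Qed.

Definition coset_times_act g (x : T) : T := (coset_act g x.1, x.2).

Lemma coset_times_act_continuous g : continuous (coset_times_act g).
Proof.
exact: (@pair_map_continuous (discrete_topology (coset H))
  (discrete_topology (coset H)) A A (coset_act g) id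
  (@discrete_continuous (discrete_topology (coset H))
    (discrete_topology (coset H)) (coset_act g)) (fun=> cvg_id)).
Qed.

Lemma coset_times_act1 x : coset_times_act 1 x = x.
Proof.
rewrite /coset_times_act; case: x => c a /=; elim/quotW: c => x.
by rewrite coset_act_pi mul1g.
Qed.

Lemma coset_times_actM g h x :
  coset_times_act (g * h) x = coset_times_act g (coset_times_act h x).
Proof.
rewrite /coset_times_act; case: x => c a /=; elim/quotW: c => x.
by rewrite (coset_act_pi h) (coset_act_pi g) (coset_act_pi (g * h)) mulgA.
Qed.

Definition coset_times : gspace G :=
  @GSpace G T coset_times_act coset_times_act_continuous
    coset_times_act1 coset_times_actM.
End CosetTimes.

Definition coset_times_map (H : subgroup G) (A B : topologicalType)
  (f : A -> B) (x : coset_times H A) : coset_times H B := (x.1, f x.2).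

End Constructions.

(* G x_N X : the quotient of G x X, with G discrete, by (g * n, x) ~ (g, n x) *)
Section Induction.
Variables (G : groupType) (N : subgroup G) (X : gspace (sg_type N)).
Let T : topologicalType := (discrete_topology G * X)%type.

Definition ind_rel : rel T :=
  fun p q => `[< exists n : sg_type N, p.1 = q.1 * \val n /\ q.2 = act n p.2 >].

Lemma ind_rel_equiv : equiv_class_of ind_rel.
Proof.
split.
- by move=> p; apply/asboolP; exists 1; rewrite mulg1 act1.
- apply: symmetric_from_pre => p q /asboolP[n [e1 e2]]; apply/asboolP.
  exists n^-1; rewrite e1 e2 /= mulgK; split=> //.
  by rewrite -actM mulVg act1.
- move=> q p r /asboolP[n [e1 e2]] /asboolP[m [e3 e4]]; apply/asboolP.
  by exists (m * n); rewrite e1 e3 e4 e2 /= mulgA actM.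
Qed.

Canonical ind_rel_equiv_rel := EquivRelPack ind_rel_equiv.

Definition ind_type := quotient_topology {eq_quot ind_rel}.
HB.instance Definition _ := Topological.on ind_type.
HB.instance Definition _ := Quotient.on ind_type.

Definition ind_pi (g : G) (x : X) : ind_type := \pi_ind_type (g : discrete_topology G, x).

Lemma ind_piP g x h y : ind_pi g x = ind_pi h y <->
  exists n : sg_type N, g = h * \val n /\ y = act n x.
Proof. by split=> [/eqmodP/asboolP|?]; last by apply/eqmodP/asboolP. Qed.

Definition ind_act (g : G) (z : ind_type) : ind_type :=
  ind_pi (g * (repr z).1) (repr z).2.

Lemma ind_act_pi g h x : ind_act g (ind_pi h x) = ind_pi (g * h) x.
Proof.
rewrite /ind_act; have : ind_pi (repr (ind_pi h x)).1 (repr (ind_pi h x)).2 = ind_pi h x.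
  by rewrite /ind_pi -surjective_pairing reprK.
move=> /ind_piP[n [e1 e2]]; apply/ind_piP; exists n; split=> //.
by rewrite e1 mulgA.
Qed.

Lemma ind_piW (P : ind_type -> Prop) : (forall g x, P (ind_pi g x)) -> forall z, P z.
Proof. by move=> h; elim/quotW => -[g x]; exact: h. Qed.

Lemma ind_act_continuous g : continuous (ind_act g).
Proof.
apply/quotient_continuous.
have -> : ind_act g \o \pi_ind_type =
    \pi_ind_type \o (fun p : T => ((g * p.1 : discrete_topology G), p.2)).
  by apply/funext => -[h x]; exact: ind_act_pi.
move=> p; apply: continuous_comp; last exact: pi_continuous.
pose gmul (h : G) := g * h.
exact: (@pair_map_continuous (discrete_topology G) (discrete_topology G) X X
  gmul id (@discrete_continuous (discrete_topology G) (discrete_topology G) gmul)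
  (fun=> cvg_id)).
Qed.

Lemma ind_act1 z : ind_act 1 z = z.
Proof. by elim/ind_piW: z => g x; rewrite ind_act_pi mul1g. Qed.

Lemma ind_actM g h z : ind_act (g * h) z = ind_act g (ind_act h z).
Proof. by elim/ind_piW: z => k x; rewrite !ind_act_pi mulgA. Qed.

Definition ginduce : gspace G :=
  @GSpace G ind_type ind_act ind_act_continuous ind_act1 ind_actM.
End Induction.

Definition ginduce_map (G : groupType) (N : subgroup G)
    (X Y : gspace (sg_type N)) (f : X -> Y) (z : ginduce X) : ginduce Y :=
  ind_pi (repr (z : ind_type X)).1 (f (repr (z : ind_type X)).2).

Section Restriction.
Variables (N W : groupType) (phi : UMagmaMorphism.type N W) (X : gspace W).

Definition res_act (n : N) (x : X) : X := act (phi n) x.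
Lemma res_act1 x : res_act 1 x = x. 
Proof. by rewrite /res_act gmulf1 act1. Qed.
Lemma res_actM n m x : res_act (n * m) x = res_act n (res_act m x).
Proof. by rewrite /res_act gmulfM actM. Qed.

Definition grestrict : gspace N :=
  @GSpace N X res_act (fun n => @act_continuous W X (phi n)) res_act1 res_actM.
End Restriction.

Record fgspace (G : groupType) := FGSpace {
  fgsp :> gspace G;
  skel : nat -> set fgsp;
  skel_act : forall n g x, skel n x -> skel n (act g x);
  skelS : forall n, skel n `<=` skel n.+1 }.
Arguments skel {G} _ _ _.

Section Skeleta.
Variables (G : groupType) (X : fgspace G).

(* X_(n-1), with X_(-1) empty *)
Definition skel_pred (n : nat) : set X :=
  if n is m.+1 then skel X m else set0.

Lemma skel_pred_act n g x : skel_pred n x -> skel_pred n (act g x).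
Proof. by case: n => //= n; exact: skel_act. Qed.

Lemma skel_pred_sub n : skel_pred n `<=` skel X n.
Proof. by case: n => //= n; exact: skelS. Qed.

Definition skel_space n : gspace G := gsubspace (@skel_act G X n).
Definition skel_pred_space n : gspace G := gsubspace (@skel_pred_act n).
Definition skel_incl n : skel_pred_space n -> skel_space n :=
  inclusion (@skel_pred_sub n).
End Skeleta.
Arguments skel_pred {G} X n _.

Section Cells.
Variables (R : realType) (n : nat).
Local Open Scope ring_scope.

(* R^n is 'rV[R]_n, whose topology is the product topology; the ball and the
   sphere are those of the Euclidean norm *)
Definition disk : set 'rV[R]_n := [set x : 'rV[R]_n | \sum_i x 0 i ^+ 2 <= 1].
Definition sphere : set 'rV[R]_n := [set x : 'rV[R]_n | \sum_i x 0 i ^+ 2 = 1].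

Lemma sphere_sub_disk : sphere `<=` disk.
Proof. by move=> x; rewrite /sphere/disk/= => ->. Qed.
End Cells.
Arguments disk R n : clear implicits.
Arguments sphere R n : clear implicits.

Section GCW.
Variables (R : realType) (G : groupType).

Definition gcells (I : choiceType) (H : I -> subgroup G)
    (A : topologicalType) : gspace G :=
  gcoprod (fun i => coset_times (H i) A).

Definition gcells_map (I : choiceType) (H : I -> subgroup G)
    (A B : topologicalType) (f : A -> B) : gcells H A -> gcells H B :=
  gcoprod_map (fun i => @coset_times_map G (H i) A B f).

Definition attaches_cells (X : fgspace G) (n : nat) : Prop :=
  exists (I : choiceType) (H : I -> subgroup G)
    (q : gcells H (sphere R n) -> skel_pred_space X n)
    (Q : gcells H (disk R n) -> skel_space X n),
  is_gpushout q (gcells_map (inclusion (@sphere_sub_disk R n)))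
    (@skel_incl G X n) Q.

(* The filtration by skeleta belongs to the G-CW-structure, whereas the attaching
   maps are only required to exist. *)
Definition is_gcw (X : fgspace G) : Prop :=
  [/\ \bigcup_n skel X n = setT,
    forall U : set X,
      open U <-> forall n, open ((\val : set_type (skel X n) -> X) @^-1` U) &
    forall n, attaches_cells X n].

Definition cellular (X Y : fgspace G) (f : X -> Y) : Prop :=
  forall n, f @` skel X n `<=` skel Y n.

(* A closed G-subspace that is a union of open equivariant cells. The open
   equivariant n-cells are the G-orbits of the connected components of
   X_n - X_(n-1); no choice of attaching maps is involved. *)
Definition is_subcomplex (X : fgspace G) (A : set X) : Prop :=
  [/\ closed A, forall g x, A x -> A (act g x) &
    forall n x, A x -> (skel X n `\` skel_pred X n) x ->
      connected_component (skel X n `\` skel_pred X n) x `<=` A].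

Definition gcw_inclusion (X Y : fgspace G) (f : X -> Y) : Prop :=
  [/\ is_gmap f, injective f,
    forall U, open U -> exists2 V, open V & f @^-1` V = U,
    is_subcomplex (range f) & forall n, skel X n = f @^-1` skel Y n].

(* The G-CW-structure of D is the one given by the pushout: its n-skeleton is
   the union of the images of the n-skeleta of B and C. *)
Definition cellular_gpushout (A B C D : fgspace G)
    (f : A -> B) (u : A -> C) (v : B -> D) (w : C -> D) : Prop :=
  [/\ is_gpushout f u v w, cellular f, cellular u,
    gcw_inclusion f \/ gcw_inclusion u &
    forall n, skel D n = (v @` skel B n) `|` (w @` skel C n)].

Definition contractible (T : topologicalType) : Prop :=
  exists (t0 : T) (h : R * T -> T),
    [/\ {within `[0%R, 1%R] `*` setT, continuous h},
      forall t, h (0%R, t) = t & forall t, h (1%R, t) = t0].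

Definition is_model (F : family G) (X : fgspace G) : Prop :=
  is_gcw X /\ forall H : subgroup G,
    (fam_set F H -> contractible (fixed_points X H)) /\
    (~ fam_set F H -> fixed_points X H = set0).

End GCW.

Section FilteredConstructions.

Section Coproduct.
Variables (G : groupType) (I : choiceType) (X : I -> fgspace G).

Definition coprod_skel n : set (gcoprod X) :=
  [set x | skel (X (projT1 x)) n (projT2 x)].

Lemma coprod_skel_act n g x : coprod_skel n x -> coprod_skel n (act g x).
Proof. exact: skel_act. Qed.

Lemma coprod_skelS n : coprod_skel n `<=` coprod_skel n.+1.
Proof. by move=> x; exact: skelS. Qed.

Definition fcoprod : fgspace G := FGSpace coprod_skel_act coprod_skelS.
End Coproduct.

Section Induction.
Variables (G : groupType) (N : subgroup G) (X : fgspace (sg_type N)).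

Definition ind_skel n : set (ginduce X) :=
  [set z | exists g x, skel X n x /\ z = ind_pi g x].

Lemma ind_skel_act n g z : ind_skel n z -> ind_skel n (act g z).
Proof.
by move=> [h [x [nx ->]]]; exists (g * h), x; split=> //; exact: ind_act_pi.
Qed.

Lemma ind_skelS n : ind_skel n `<=` ind_skel n.+1.
Proof.
by move=> _ [h [x [nx ->]]]; exists h, x; split=> //; exact: skelS.
Qed.

Definition finduce : fgspace G := FGSpace ind_skel_act ind_skelS.
End Induction.

Section Restriction.
Variables (N W : groupType) (phi : UMagmaMorphism.type N W) (X : fgspace W).

Lemma res_skel_act n g (x : grestrict phi X) : skel X n x -> skel X n (act g x).
Proof. exact: skel_act. Qed.

Definition frestrict : fgspace N :=
  @FGSpace N (grestrict phi X) (skel X) res_skel_act (@skelS W X).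
End Restriction.

End FilteredConstructions.

Definition weyl_restrict (G : groupType) (H : subgroup G)
    (X : fgspace (weyl H)) : fgspace (sg_type (normalizer H)) :=
  frestrict (@weyl_proj G H) X.

Section NormalizerCoproduct.
Variables (G : groupType) (M : set (subgroup G)).
Let fam : Type := forall F : M, fgspace (sg_type (normalizer (sval F))).

(* the coproduct over F in M of the G x_(N_G F) X_F *)
Definition norm_coprod (X : fam) : fgspace G :=
  fcoprod (fun F : M => finduce (X F)).

Definition norm_coprod_map (X Y : fam) (f : forall F : M, X F -> Y F) :
    norm_coprod X -> norm_coprod Y :=
  gcoprod_map (fun F : M => ginduce_map (f F)).
End NormalizerCoproduct.

(* Main.v *)
Require Import Defs.
From HB Require Import structures.
From mathcomp Require Import all_boot all_order all_algebra.
From mathcomp Require Import all_classical all_reals topology normedtype realfun.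
From mathcomp Require Import ring.

Set Implicit Arguments.
Unset Strict Implicit.
Unset Printing Implicit Defensive.

Import Order.TTheory GRing.Theory Num.Theory.
Import numFieldNormedType.Exports.

Local Open Scope classical_set_scope.
Local Open Scope ring_scope.

(** Both parts are instances of one statement about families [F1] and [F2] such
    that each subgroup in [F2] but not in [F1] lies in a unique maximal one
    ([pushout_model]). Write the pushout as [D], glued from [B] (the classifying
    space for [F1]) and from [C] (the coproduct of the induced free models of
    the Weyl groups) along [A]. Two things are to be shown: [D] is a
    [G]-CW-complex, and its fixed point sets are contractible or empty as
    required.

    Fixed points. Let [H] be a subgroup. The [H]-fixed points of [D] are glued
    from those of [B] and [C] along those of [A] ([fixed_pushout]).
    The space [C] is a coproduct of copies of the models [EW F], one for each
    coset [g N] of the normalizer of each [F] in [M]. As Weyl groups act freely,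
    the copy at [g] is fixed by [H] if the conjugate of [H] by [g] lies in [F],
    and otherwise has no fixed point.
    - If [H] is in [F2] but not in [F1], then [A] and [B] have no fixed points,
      and exactly one copy in [C] is fixed, as the conjugates of the [F] in [M]
      are pairwise different maximal subgroups ([unique_conjugate]). Hence the
      fixed points of [D] form a contractible space.
    - If [H] is not in [F2], there are no fixed points at all.
    - If [H] is in [F1], then the copies in [A] and [C] with fixed points are the
      same: a fixed point in [A] exists as soon as the conjugate of [H] is in the
      normalizer, and the map to [C] turns it into one in [C], so that the
      conjugate is even in [F]. All pieces being contractible, [A] and [C] have
      homotopy equivalent fixed points, those of [B] are contractible, and a
      gluing lemma ([contractible_gluing]) applies.

    The gluing lemma. A null homotopy of the map from the double mapping
    cylinder of [B], [A] and [C] to [D] can be written down explicitly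
    ([null_cylinder]), whichever leg is an inclusion. If one leg has the
    homotopy extension property, then maps and homotopies defined on the
    cylinder can be transferred to [D] ([contractible_cylinder]).

    CW-structures. To avoid choices, a CW-structure is described by a set of
    characteristic maps, and its topology by closed sets ([cw]). A filtered
    [G]-space is a [G]-CW-complex if and only if it has such a structure that is
    stable under [G] ([gcw_cells], [cells_gcw]). Such structures are easily
    carried over to fixed points, coproducts and glued spaces, and they give
    the homotopy extension property ([cw_cofibration]). Continuity of homotopies
    is checked cell by cell, through the adjunction between products with the
    locally compact space [R] and spaces of paths with the compact-open
    topology. *)

(** * Continuous maps *)

Section Continuity.
Implicit Types S T U V : topologicalType.

Lemma cts_id T : continuous (fun x : T => x).
Proof. by move=> x. Qed.

Lemma cts_cst S T (y : T) : continuous (fun _ : S => y).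
Proof. exact: cst_continuous. Qed.

Lemma cts_comp S T U (g : T -> U) (f : S -> T) :
  continuous g -> continuous f -> continuous (fun x => g (f x)).
Proof. by move=> cg cf x; apply: continuous_comp; [exact: cf|exact: cg]. Qed.

Lemma cts_pair S T U (f : S -> T) (g : S -> U) :
  continuous f -> continuous g -> continuous (fun x => (f x, g x)).
Proof. by move=> cf cg x; apply: cvg_pair; [exact: cf|exact: cg]. Qed.

Lemma cts_fst S T U (f : S -> T * U) :
  continuous f -> continuous (fun x => (f x).1).
Proof. by move=> cf x; apply: (cvg_comp _ _ (cf x)); exact: cvg_fst. Qed.

Lemma cts_snd S T U (f : S -> T * U) :
  continuous f -> continuous (fun x => (f x).2).
Proof. by move=> cf x; apply: (cvg_comp _ _ (cf x)); exact: cvg_snd. Qed.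

Lemma cts_closed S T (f : S -> T) (K : set T) :
  continuous f -> closed K -> closed (f @^-1` K).
Proof. by move=> /continuous_closedP; apply. Qed.

Lemma cts_open S T (f : S -> T) (K : set T) :
  continuous f -> open K -> open (f @^-1` K).
Proof. by move=> /continuousP; apply. Qed.

Lemma cts_val T (A : set T) : continuous (\val : A -> T).
Proof. exact: initial_continuous. Qed.

Lemma cts_into S T (A : set T) (f : S -> A) :
  continuous (fun x => \val (f x)) -> continuous f.
Proof.
move=> /continuousP cf; apply/continuousP => _ [U oU <-].
exact: cf.
Qed.

Lemma closed_setP T (A : set T) (K : set A) :
  closed K <-> exists2 L : set T, closed L & \val @^-1` L = K.
Proof.
split=> [/closed_openC[U oU UK]|[L cL <-]]; last exact: cts_closed (@cts_val _ _) _.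
exists (~` U); first by rewrite closedC.
by rewrite preimage_setC; exact: (etrans (congr1 setC UK) (setCK _)).
Qed.

Lemma closed_image_val T (A : set T) (K : set A) :
  closed A -> closed K -> closed (\val @` K).
Proof.
move=> cA /closed_setP[L cL <-].
suff -> : \val @` (\val @^-1` L : set A) = L `&` A by exact: closedI.
apply/seteqP; split=> [_ [x Lx <-]|x [Lx Ax]].
  by split=> //; exact: (set_mem (valP x)).
by exists (SigSub (mem_set Ax)).
Qed.

Lemma cts_restrict S T (f : S -> T) (A : set S) (B : set T) (g : A -> B) :
  continuous f -> (forall x, \val (g x) = f (\val x)) -> continuous g.
Proof.
move=> cf fg; apply: cts_into; rewrite (funext fg).
by apply: cts_comp cf _; exact: cts_val.
Qed.

(** The hypotheses only speak of closed sets, so that they can also be met by a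
    map given on [P] by an expression which makes no sense outside [P]. *)
Lemma cts_cover S T (f : S -> T) (P Q : set S) :
  (forall x, P x \/ Q x) ->
  (forall K, closed K -> closed (P `&` f @^-1` K)) ->
  (forall K, closed K -> closed (Q `&` f @^-1` K)) -> continuous f.
Proof.
move=> PQ cP cQ; apply/continuous_closedP => K cK.
have -> : f @^-1` K = (P `&` f @^-1` K) `|` (Q `&` f @^-1` K).
  rewrite -setIUl; apply/seteqP; split=> [x Kx|x []//].
  by split=> //; exact: PQ.
by apply: closedU; [exact: cP|exact: cQ].
Qed.

Lemma closed_agree S T (f g : S -> T) (P : set S) :
  closed P -> continuous g -> (forall x, P x -> f x = g x) ->
  forall K, closed K -> closed (P `&` f @^-1` K).
Proof.
move=> cP cg fg K cK.
have -> : P `&` f @^-1` K = P `&` g @^-1` K.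
  by apply/seteqP; split=> x [Px /= Kx]; split=> //=; rewrite ?fg// -fg.
by apply: closedI => //; exact: cts_closed.
Qed.

Lemma cts_glue S T (f g h : S -> T) (P Q : set S) :
  (forall x, P x \/ Q x) -> closed P -> closed Q ->
  continuous g -> continuous h ->
  (forall x, P x -> f x = g x) -> (forall x, Q x -> f x = h x) -> continuous f.
Proof.
move=> PQ cP cQ cg ch fg fh.
by apply: (cts_cover PQ); [exact: closed_agree fg|exact: closed_agree fh].
Qed.

End Continuity.

Section RealContinuity.
Variables (R : realType) (S : topologicalType).
Implicit Types f g : S -> R.

Lemma cts_add f g : continuous f -> continuous g ->
  continuous (fun x => f x + g x).
Proof. by move=> cf cg x; apply: cvgD; [exact: cf|exact: cg]. Qed.

Lemma cts_subr f g : continuous f -> continuous g ->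
  continuous (fun x => f x - g x).
Proof. by move=> cf cg x; apply: cvgB; [exact: cf|exact: cg]. Qed.

Lemma cts_mul f g : continuous f -> continuous g ->
  continuous (fun x => f x * g x).
Proof. by move=> cf cg x; apply: cvgM; [exact: cf|exact: cg]. Qed.

Lemma cts_max f g : continuous f -> continuous g ->
  continuous (fun x => Num.max (f x) (g x)).
Proof. by move=> cf cg x; apply: (@continuous_max R); [exact: cf|exact: cg]. Qed.

Lemma cts_normr f : continuous f -> continuous (fun x => `|f x|).
Proof. by move=> cf; apply: cts_comp cf; exact: norm_continuous. Qed.

Lemma closed_le_fun f g : continuous f -> continuous g ->
  closed [set x | f x <= g x].
Proof.
move=> cf cg.
have -> : [set x | f x <= g x] = (fun x => f x - g x) @^-1` [set r | r <= 0].
  by apply/seteqP; split=> x /=; rewrite subr_le0.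
by apply: cts_closed; [exact: cts_subr|exact: closed_le].
Qed.

Lemma closed_eq_fun f g : continuous f -> continuous g ->
  closed [set x | f x = g x].
Proof.
move=> cf cg.
have -> : [set x | f x = g x] = [set x | f x <= g x] `&` [set x | g x <= f x].
  apply/seteqP; split=> x /= => [->//|[h1 h2]].
  by apply/eqP; rewrite eq_le h1.
by apply: closedI; exact: closed_le_fun.
Qed.

End RealContinuity.

(** Continuity of expressions built from projections, pairs and arithmetic. *)
Ltac ctsp := solve [repeat first [ assumption | apply: cts_pair
  | exact: cts_id | apply: cts_mul
  | match goal with |- context [- _] => apply: cts_subr end
  | apply: cts_fst | apply: cts_snd | exact: cts_cst ]].

Section Clamp.
Variable R : realType.

Definition clamp (t : R) : R := Num.min 1 (Num.max 0 t).

Lemma cts_clamp : continuous clamp.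
Proof.
move=> x; apply: (@continuous_min R); first exact: cst_continuous.
by apply: cts_max; [exact: cts_cst|exact: cts_id].
Qed.

Lemma clamp_itv t : 0 <= clamp t <= 1.
Proof. by rewrite /clamp le_min ge_min lexx le_max lexx ler01. Qed.

Lemma clamp_id t : 0 <= t <= 1 -> clamp t = t.
Proof. by move=> /andP[t0 t1]; rewrite /clamp (max_idPr t0) (min_idPr t1). Qed.

Lemma clamp0 : clamp 0 = 0.
Proof. by rewrite clamp_id// lexx ler01. Qed.

Lemma clamp1 : clamp 1 = 1.
Proof. by rewrite clamp_id// lexx ler01. Qed.

End Clamp.

Section Exponential.
Variables (R : realType) (X Z : topologicalType).

Definition adjoint (F : R * X -> Z) (x : X) : {compact-open, R -> Z} :=
  fun t => F (t, x).

Lemma cts_adjoint (F : R * X -> Z) : continuous F -> continuous (adjoint F).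
Proof.
move=> cF; have cG : continuous (fun p : X * R => F (p.2, p.1)).
  apply: cts_comp cF _; apply: cts_pair; [apply: cts_snd|apply: cts_fst];
  exact: cts_id.
exact: continuous_curry_fun cG.
Qed.

Lemma adjoint_cts (F : R * X -> Z) :
  (forall x, continuous (fun t => F (t, x))) -> continuous (adjoint F) ->
  continuous F.
Proof.
move=> cx cF.
have cG : continuous (uncurry (fun x t => F (t, x))).
  apply: continuous_uncurry_regular => //; first exact: locally_compactR.
  exact: uniform_regular.
have -> : F = fun p => uncurry (fun x t => F (t, x)) (p.2, p.1).
  by apply/funext => -[].
apply: (cts_comp cG).
by apply: cts_pair; [apply: cts_snd|apply: cts_fst]; exact: cts_id.
Qed.

End Exponential.

Definition final (I : Type) (X : I -> topologicalType) (Y : topologicalType)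
    (e : forall i, X i -> Y) :=
  [/\ forall i, continuous (e i), forall y, exists i x, e i x = y &
  forall K, (forall i, closed (e i @^-1` K)) -> closed K].

Section Final.
Variables (R : realType) (I : Type) (X : I -> topologicalType).
Variables (Y : topologicalType) (e : forall i, X i -> Y).
Arguments e : clear implicits.
Hypothesis fe : final e.

Lemma final_cts (Z : topologicalType) (f : Y -> Z) :
  (forall i, continuous (fun x => f (e i x))) -> continuous f.
Proof.
have [ce se te] := fe => cf; apply/continuous_closedP => K cK; apply: te => i.
exact: (cts_closed (cf i)).
Qed.

(** As [R] is locally compact, the product with [R] preserves final families:
    the adjoint map to the space of paths is continuous on each source. *)
Lemma final_homotopy (Z : topologicalType) (F : R * Y -> Z) :
  (forall i, continuous (fun p : R * X i => F (p.1, e i p.2))) -> continuous F.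
Proof.
move=> cF; apply: adjoint_cts.
  have [ce se _] := fe => y; have [i [x <-]] := se y.
  apply: (cts_comp (cF i) (f := fun t => (t, x))).
  by apply: cts_pair; [exact: cts_id|exact: cts_cst].
apply: final_cts => i; exact: (cts_adjoint (cF i)).
Qed.

End Final.

(** * Disks *)

Section Disk.
Variables (R : realType) (n : nat).
Local Notation D := (disk R n).
Local Notation S := (sphere R n).

Definition enorm (y : 'rV[R]_n) : R := Num.sqrt (\sum_i y 0 i ^+ 2).

Lemma sumsq_ge0 (y : 'rV[R]_n) : 0 <= \sum_i y 0 i ^+ 2.
Proof. by apply: sumr_ge0 => i _; exact: sqr_ge0. Qed.

Lemma enorm_ge0 y : 0 <= enorm y.
Proof. exact: sqrtr_ge0. Qed.

Lemma cts_sumsq : continuous (fun y : 'rV[R]_n => \sum_i y 0 i ^+ 2).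
Proof.
apply: continuous_big => [|i _]; first exact: add_continuous.
by apply: (cts_comp (@exprn_continuous R 2)); exact: coord_continuous.
Qed.

Lemma cts_enorm : continuous enorm.
Proof. by apply: cts_comp cts_sumsq; exact: sqrt_continuous. Qed.

Lemma enormZ (c : R) y : enorm (c *: y) = `|c| * enorm y.
Proof.
rewrite /enorm; under eq_bigr do rewrite mxE exprMn.
by rewrite -mulr_sumr sqrtrM ?sqr_ge0// sqrtr_sqr.
Qed.

Lemma diskP y : D y <-> enorm y <= 1.
Proof. by rewrite /disk/= /enorm -{2}sqrtr1 ler_psqrt// nnegrE ?sumsq_ge0. Qed.

Lemma sphereP y : S y <-> enorm y = 1.
Proof.
rewrite /sphere/= /enorm -{2}(@sqrtr1 R); split=> [->//|/eqP].
by rewrite eqr_sqrt ?sumsq_ge0// => /eqP.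
Qed.

Lemma closed_sphere : closed [set y : D | S (\val y)].
Proof.
have -> : [set y : D | S (\val y)] =
    [set y : D | \sum_i (\val y : 'rV[R]_n) 0 i ^+ 2 = 1] by [].
apply: closed_eq_fun; last exact: cts_cst.
exact: cts_comp cts_sumsq (@cts_val _ _).
Qed.

Lemma cts_scale (T : topologicalType) (c : T -> R) (f : T -> 'rV[R]_n) :
  continuous c -> continuous f -> continuous (fun x => c x *: f x).
Proof. by move=> cc cf x; apply: cvgZ; [exact: cc|exact: cf]. Qed.

Definition shrink_proof (s : R) (y : D) : clamp s *: \val y \in D.
Proof.
have /andP[s0 s1] := clamp_itv s.
apply/mem_set/diskP; rewrite enormZ ger0_norm//.
have /diskP y1 := set_mem (valP y).
by rewrite mulr_ile1// enorm_ge0.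
Qed.

Definition shrink (s : R) (y : D) : D := SigSub (shrink_proof s y).

Lemma disk0_proof : 0 \in D.
Proof. by apply/mem_set/diskP; rewrite -(scale0r 0) enormZ normr0 mul0r. Qed.

Definition disk0 : D := SigSub disk0_proof.

(** The interior of a disk is a union of segments starting at the centre. *)
Lemma connected_interior (X : topologicalType) (f : D -> X) :
  continuous f -> connected (f @` [set y | ~ S (\val y)]).
Proof.
move=> cf; have S0 : ~ S (\val disk0).
  by move/sphereP; rewrite /= -(scale0r 0) enormZ normr0 mul0r => /eqP;
     rewrite eq_sym oner_eq0.
pose seg (y : D) := (fun s => f (shrink s y)) @` `[0, 1].
have -> : f @` [set y | ~ S (\val y)] =
    \bigcup_(y in [set y | ~ S (\val y)]) seg y.
  apply/seteqP; split=> [_ [y Sy <-]|_ [y Sy [s _ <-]]].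
    exists y => //; exists 1; first by rewrite /= in_itv/= ler01 lexx.
    by congr f; apply: val_inj; rewrite /= clamp1 scale1r.
  exists (shrink s y) => // /sphereP; rewrite /= enormZ => e1; apply: Sy.
  apply/sphereP; have /andP[c0 c1] := clamp_itv s.
  have /diskP y1 := set_mem (valP y).
  apply/eqP; rewrite eq_le y1/= -{1}e1 ger0_norm//.
  by rewrite ler_piMl ?enorm_ge0.
apply: bigcup_connected.
  exists (f disk0) => y _; exists 0; first by rewrite /= in_itv/= ler01 lexx.
  by congr f; apply: val_inj; rewrite /= clamp0 scale0r.
move=> y _; apply: connected_continuous_connected; first exact: segment_connected.
apply: continuous_subspaceT; apply: (cts_comp cf); apply: cts_into => /=.
by apply: cts_scale; [exact: cts_clamp|exact: cts_cst].
Qed.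

Definition dscale (t : R) (y : 'rV[R]_n) : R := Num.max (enorm y) (1 + `|t|)^-1.

Lemma onet_gt0 (t : R) : 0 < 1 + `|t|.
Proof. by rewrite ltr_pwDl. Qed.

Lemma dscale_gt0 t y : 0 < dscale t y.
Proof. by rewrite lt_max invr_gt0 onet_gt0 orbT. Qed.

Lemma dproj_proof (t : R) (y : D) : (dscale t (\val y))^-1 *: \val y \in D.
Proof.
have d0 := dscale_gt0 t (\val y).
have i0 : 0 <= (dscale t (\val y))^-1 by rewrite invr_ge0 ltW.
by apply/mem_set/diskP; rewrite enormZ (ger0_norm i0) ler_pdivrMl// mulr1 le_max lexx.
Qed.

(** A retraction of the infinite solid cylinder onto its side and bottom. The
    points of norm at most the inverse of [1 + `|t|] are sent to the bottom by
    dilation with factor [1 + `|t|], the others to the side. Since [dscale] is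
    the larger of the norm and that inverse, one formula covers both cases. *)
Definition dproj (p : R * D) : R * D :=
  (1 + `|p.1| - (dscale p.1 (\val p.2))^-1, SigSub (dproj_proof p.1 p.2)).

Lemma dproj_side p : (dproj p).1 = 0 \/ S (\val (dproj p).2).
Proof.
case: p => t y /=; have [le_y|lt_y] := leP (enorm (\val y)) (1 + `|t|)^-1.
  by left; rewrite /dscale (max_idPr le_y) invrK subrr.
right; apply/sphereP; rewrite /= enormZ /dscale (max_idPl (ltW lt_y)).
have y0 : 0 < enorm (\val y) by apply: lt_trans lt_y; rewrite invr_gt0 onet_gt0.
by rewrite ger0_norm ?invr_ge0 ?enorm_ge0// mulVf// gt_eqF.
Qed.

Lemma pair_val_eq (p q : R * D) : p.1 = q.1 -> \val p.2 = \val q.2 -> p = q.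
Proof. by case: p q => [t y] [t1 z] /= -> yz; congr (_, _); exact: val_inj. Qed.

Lemma dproj0 y : dproj (0, y) = (0, y).
Proof.
have /diskP y1 := set_mem (valP y).
have e1 : dscale 0 (\val y) = 1.
  by rewrite /dscale normr0 addr0 invr1; exact: (max_idPr y1).
apply: pair_val_eq; rewrite /= e1 invr1; last by rewrite scale1r.
by rewrite normr0 addr0 subrr.
Qed.

Lemma dproj_sphere t y : S (\val y) -> dproj (t, y) = (`|t|, y).
Proof.
move=> /sphereP y1; have e1 : dscale t (\val y) = 1.
  rewrite /dscale y1; apply/max_idPl.
  by rewrite invf_le1 ?onet_gt0// lerDl.
apply: pair_val_eq; rewrite /= e1 invr1; last by rewrite scale1r.
by rewrite addrAC subrr add0r.
Qed.

Lemma dproj_norm t y : dproj (`|t|, y) = dproj (t, y).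
Proof.
have e : dscale `|t| (\val y) = dscale t (\val y) by rewrite /dscale normr_id.
by apply: pair_val_eq; rewrite /= e ?normr_id.
Qed.

Lemma cts_dproj : continuous dproj.
Proof.
have ct : continuous (fun p : R * D => 1 + `|p.1|).
  by apply: cts_add; [exact: cts_cst|apply: cts_normr; apply: cts_fst; exact: cts_id].
have cy : continuous (fun p : R * D => \val p.2 : 'rV[R]_n).
  by apply: cts_comp (@cts_val _ _) _; apply: cts_snd; exact: cts_id.
have cinv (T : topologicalType) (f : T -> R) :
    continuous f -> (forall x, 0 < f x) -> continuous (fun x => (f x)^-1).
  by move=> cf f0 x; apply: cvgV; [rewrite gt_eqF|exact: cf].
have cs : continuous (fun p : R * D => (dscale p.1 (\val p.2))^-1).
  apply: (cinv _ _) => [|p]; last exact: dscale_gt0.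
  apply: cts_max; first exact: cts_comp cts_enorm cy.
  by apply: cinv => // q; exact: onet_gt0.
apply: cts_pair; first exact: cts_subr.
by apply: cts_into; exact: cts_scale.
Qed.

End Disk.

(** * CW-structures and homotopy extension *)

Definition closed_embedding (A X : topologicalType) (f : A -> X) :=
  [/\ continuous f, injective f,
    forall U, open U -> exists2 V, open V & f @^-1` V = U & closed (range f)].

Section ClosedEmbedding.
Variables (A X : topologicalType) (f : A -> X).
Hypothesis ef : closed_embedding f.

Lemma closed_embedding_prod (P : topologicalType) (K : set (P * A)) :
  closed K -> closed ((fun p => (p.1, f p.2)) @` K).
Proof.
have [cf jf of_ rf] := ef => cK; rewrite -openC openE => -[p x] nKx /=.
have [[a _ ax]|nax] := pselect (range f x); last first.
  exists (setT, ~` range f) => /=.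
    split; first exact: filterT.
    by apply: open_nbhs_nbhs; split=> //; exact: closed_openC.
  by move=> [q y] [/= _ nfy] [[r b] _ [_ by_]]; apply: nfy; exists b.
have : nbhs (p, a) (~` K).
  apply: open_nbhs_nbhs; split; first exact: closed_openC.
  by move=> Kpa; apply: nKx; exists (p, a) => //=; rewrite ax.
move=> [[O U] /= [nO]]; rewrite nbhsE => -[U' [oU' U'a] U'U] OU.
have [V oV VU] := of_ _ oU'; exists (O, V) => /=.
  split=> //; apply: open_nbhs_nbhs; split=> //.
  by rewrite -ax; have : (f @^-1` V) a by rewrite VU.
move=> [q y] [/= Oq Vy] [[r b] Krb [rq fby]].
apply: (OU (q, b)); last by rewrite -rq.
by split=> //=; apply: U'U; rewrite -VU /= fby.
Qed.

Lemma closed_embedding_image (K : set A) : closed K -> closed (f @` K).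
Proof.
have [cf jf of_ rf] := ef => /closed_openC/of_[V oV VK].
have -> : f @` K = range f `&` ~` V; last by apply: closedI; rewrite ?closedC.
apply/seteqP; split=> [_ [a Ka <-]|_ [[a _ <-] nVa]].
  split; first by exists a.
  by move=> Va; have : (f @^-1` V) a by []; rewrite VK; apply.
exists a => //; apply: contrapT => nKa; apply: nVa.
by have : (~` K) a by []; rewrite -VK.
Qed.
End ClosedEmbedding.

Lemma closed_embedding_val (X : topologicalType) (A : set X) :
  closed A -> closed_embedding (\val : A -> X).
Proof.
move=> cA; split.
- exact: cts_val.
- exact: val_inj.
- by move=> _ [V oV <-]; exists V.
- suff -> : range (\val : A -> X) = A by [].
  apply/seteqP; split=> [_ [x _ <-]|x Ax]; first exact: (set_mem (valP x)).
  by exists (SigSub (mem_set Ax)).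
Qed.

Definition pred_skel (X : Type) (sk : nat -> set X) (n : nat) : set X :=
  if n is m.+1 then sk m else set0.

(** A CW-structure without choices: the cells of dimension [n] are a set of
    maps from the disk, so that two characteristic maps which agree at some
    interior point are the same. Everything about the topology is phrased with
    closed sets: a subset of the [n]-skeleton is closed if it meets the
    previous skeleton in a closed set and its inverse images under the
    [n]-cells are closed. *)
Record cw (R : realType) (X : topologicalType) (sk : nat -> set X)
    (cell : forall n, set (disk R n -> X)) : Prop := CW {
  cw_skelS : forall n, sk n `<=` sk n.+1;
  cw_skelT : forall x, exists n, sk n x;
  cw_cts : forall n f, cell n f -> continuous f;
  cw_sphere : forall n f y, cell n f -> sphere R n (\val y) ->
    pred_skel sk n (f y);
  cw_int : forall n f y, cell n f -> ~ sphere R n (\val y) ->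
    sk n (f y) /\ ~ pred_skel sk n (f y);
  cw_inj : forall n f g y z, cell n f -> cell n g ->
    ~ sphere R n (\val y) -> ~ sphere R n (\val z) -> f y = g z ->
    f = g /\ y = z;
  cw_surj : forall n x, sk n x -> ~ pred_skel sk n x ->
    exists f y, [/\ cell n f, ~ sphere R n (\val y) & f y = x];
  cw_attach : forall n K, K `<=` sk n -> closed (K `&` pred_skel sk n) ->
    (forall f, cell n f -> closed (f @^-1` K)) -> closed K;
  cw_weak : forall K, (forall n, closed (K `&` sk n)) -> closed K }.

Section CWTheory.
Variables (R : realType) (X : topologicalType) (sk : nat -> set X).
Variable cell : forall n, set (disk R n -> X).
Arguments cell : clear implicits.
Hypothesis cwX : cw sk cell.

Lemma skel_mono m n : (m <= n)%N -> sk m `<=` sk n.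
Proof.
move=> /subnK <-; elim: (n - m)%N => // k IH x skx.
by rewrite addSn; apply: (cw_skelS cwX); exact: IH.
Qed.

Lemma pred_skel_sub n : pred_skel sk n `<=` sk n.
Proof. by case: n => [//|n]; exact: (cw_skelS cwX). Qed.

Lemma pred_skel_closed n : closed (pred_skel sk n).
Proof.
elim: n => [|n IH] /=; first exact: closed0.
apply: (cw_attach cwX (n := n)) => //.
  suff -> : sk n `&` pred_skel sk n = pred_skel sk n by [].
  by apply/setIidPr; exact: pred_skel_sub.
move=> f cf; suff -> : f @^-1` sk n = setT by exact: closedT.
apply/seteqP; split=> // y _ /=; have [Sy|nSy] := pselect (sphere R n (\val y)).
  exact/pred_skel_sub/(cw_sphere cwX cf).
by have [] := cw_int cwX cf nSy.
Qed.

Lemma skel_closed n : closed (sk n).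
Proof. exact: (@pred_skel_closed n.+1). Qed.

Lemma cell_skel n f y : cell n f -> sk n (f y).
Proof.
move=> cf; have [Sy|nSy] := pselect (sphere R n (\val y)).
  exact/pred_skel_sub/(cw_sphere cwX cf).
by have [] := cw_int cwX cf nSy.
Qed.

Lemma closed_by_skeleta (K : set X) :
  (forall n, closed (K `&` pred_skel sk n) ->
    forall f, cell n f -> closed (f @^-1` K)) -> closed K.
Proof.
move=> h; apply: (cw_weak cwX) => n.
suff : closed (K `&` pred_skel sk n.+1) by [].
elim: n.+1 => {n} [|n IH]; first by rewrite /= setI0; exact: closed0.
apply: (cw_attach cwX (n := n)) => [x []//| |f cf].
  by have /setIidPr e := @pred_skel_sub n; rewrite -setIA e.
have -> : f @^-1` (K `&` sk n) = f @^-1` K; last exact: h IH f cf.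
by apply/seteqP; split=> [y []//|y Ky]; split=> //; exact: cell_skel.
Qed.

(** By induction on the dimension, the adjoint map to the space of paths is
    continuous on each skeleton. Local compactness of [R] is used both to test
    continuity on the adjoint and to return to a map on the product. *)
Lemma homotopy_by_skeleta (Z : topologicalType) (F : R * X -> Z) :
  (forall n,
    (forall (T : topologicalType) (g : T -> X), continuous g ->
      (forall t, pred_skel sk n (g t)) ->
      continuous (fun p : R * T => F (p.1, g p.2))) ->
    forall f, cell n f -> continuous (fun p : R * disk R n => F (p.1, f p.2))) ->
  continuous F.
Proof.
move=> h.
suff hn n : (forall K, closed K -> closed (adjoint F @^-1` K `&` pred_skel sk n))
    /\ (forall x, pred_skel sk n x -> continuous (fun t => F (t, x))).
  apply: adjoint_cts => [x|].
    by have [n skx] := cw_skelT cwX x; have [_] := hn n.+1; apply.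
  apply/continuous_closedP => K cK; apply: (cw_weak cwX) => n.
  by have [+ _] := hn n.+1; apply.
elim: n => [|n [IHc IHp]].
  by split=> [K _|x []]; rewrite /= setI0; exact: closed0.
have cF f : cell n f -> continuous (fun p : R * disk R n => F (p.1, f p.2)).
  apply: h => T g cg skg; apply: adjoint_cts => [t|]; first exact: (IHp (g t) (skg t)).
  apply/continuous_closedP => K cK.
  have -> : adjoint (fun p : R * T => F (p.1, g p.2)) @^-1` K =
      g @^-1` (adjoint F @^-1` K `&` pred_skel sk n).
    by apply/seteqP; split=> [t Kt|t []//]; split.
  by apply: cts_closed cg _; exact: IHc.
split=> [K cK|x /= skx].
  apply: (cw_attach cwX (n := n)) => [x []//| |f cf].
    by have /setIidPr e := @pred_skel_sub n; rewrite -setIA e; exact: IHc.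
  have -> : f @^-1` (adjoint F @^-1` K `&` sk n) =
      adjoint (fun p : R * disk R n => F (p.1, f p.2)) @^-1` K.
    by apply/seteqP; split=> [y []//|y Ky]; split=> //; exact: cell_skel.
  by apply: cts_closed cK; apply: cts_adjoint; exact: cF.
have [|nskx] := pselect (pred_skel sk n x); first exact: IHp.
have [f [y [cf _ <-]]] := cw_surj cwX skx nskx.
have ct : continuous ((fun t => (t, y)) : R -> R * disk R n).
  by apply: cts_pair; [exact: cts_id|exact: cts_cst].
exact: (cts_comp (cF f cf) ct).
Qed.

(** [A] is a union of open cells. *)
Definition cellwise (A : set X) := forall n f y z, cell n f ->
  ~ sphere R n (\val y) -> ~ sphere R n (\val z) -> A (f y) -> A (f z).

Section Retraction.
Variable A : set X.
Hypotheses (cA : closed A) (wA : cellwise A).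

Let cell_at n (x : X) : (disk R n -> X) * disk R n :=
  if pselect (exists c : (disk R n -> X) * disk R n,
      [/\ cell n c.1, ~ sphere R n (\val c.2) & c.1 c.2 = x])
  is left e then sval (cid e) else (fun=> x, disk0 R n).

Lemma cell_atE n f y : cell n f -> ~ sphere R n (\val y) ->
  cell_at n (f y) = (f, y).
Proof.
move=> cf nSy; rewrite /cell_at; case: pselect => [e|[]]; last by exists (f, y).
case: (cid e) => -[g z] /= [cg nSz gz].
by have [-> ->] := cw_inj cwX cg cf nSz nSy gz.
Qed.

(** One more skeleton: on a cell outside [A], project the cylinder over the disk
    to its side and bottom, stay there if on the bottom, and go on with the
    retraction [r] of the lower skeleton if on the side. *)
Let step n (r : R -> X -> R * X) (t : R) (x : X) : R * X :=
  if `[< A x \/ pred_skel sk n x \/ ~ sk n x >] then r t x else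
  let q := dproj (t, (cell_at n x).2) in
  let x' := (cell_at n x).1 q.2 in
  if `[< sphere R n (\val q.2) >] then r q.1 x' else (0, x').

Fixpoint ret n : R -> X -> R * X :=
  if n is m.+1 then step m (ret m) else fun t x => (`|t|, x).

Lemma ret_sub n t a : A a -> ret n t a = (`|t|, a).
Proof.
by move=> Aa; elim: n => //= n IH; rewrite /step asboolT//; left.
Qed.

Lemma ret_norm n t x : ret n `|t| x = ret n t x.
Proof.
elim: n => [|n IH] /=; first by rewrite normr_id.
by rewrite /step dproj_norm IH.
Qed.

Lemma ret_stable m n t x : (m <= n)%N -> pred_skel sk m x ->
  ret n t x = ret m t x.
Proof.
move=> mn skx; rewrite -(subnK mn); elim: (n - m)%N => // k IH.
rewrite addSn /= /step asboolT//; right; left.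
case: m skx {mn IH} => [//|m] /= skx; rewrite addnS /=.
by apply: skel_mono skx; exact: leq_addl.
Qed.

Definition retraction (p : R * X) : R * X :=
  ret (sval (cid (cw_skelT cwX p.2))).+1 p.1 p.2.

Lemma retractionE n t x : pred_skel sk n x -> retraction (t, x) = ret n t x.
Proof.
rewrite /retraction -[(t, x).1]/t -[(t, x).2]/x; case: cid => m skm skn.
rewrite -[sval _]/m.
have [mn|nm] := leqP m.+1 n; first by rewrite (ret_stable _ mn).
by rewrite (ret_stable t (ltnW nm) skn).
Qed.

Lemma retraction_sub t a : A a -> retraction (t, a) = (`|t|, a).
Proof. exact: ret_sub. Qed.

(** Only the absolute value of the time matters, so that no lower bound on it
    has to be carried along. *)
Lemma retraction_norm t x : retraction (`|t|, x) = retraction (t, x).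
Proof. exact: ret_norm. Qed.

(** On the boundary of the cell both sides agree, since [dproj] fixes the side
    of the cylinder; so the formula holds on the whole closed disk, which is
    what continuity requires. *)
Lemma retraction_cell n f t y : cell n f ->
  (forall z, ~ sphere R n (\val z) -> ~ A (f z)) ->
  let q := dproj (t, y) in
  retraction (t, f y) =
  if `[< sphere R n (\val q.2) >] then retraction (q.1, f q.2) else (0, f q.2).
Proof.
move=> cf nA q; have [Sy|nSy] := pselect (sphere R n (\val y)).
  by rewrite /q dproj_sphere// asboolT//= retraction_norm.
have [skf nskf] := cw_int cwX cf nSy.
rewrite (@retractionE n.+1)//= /step asboolF; last by move=> [/nA|[]].
rewrite cell_atE//=; case: ifPn => // /asboolP Sq.
by rewrite (@retractionE n)//; exact: (cw_sphere cwX cf).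
Qed.

Lemma retraction0 x : retraction (0, x) = (0, x).
Proof.
suff h n : pred_skel sk n x -> retraction (0, x) = (0, x).
  by have [n skx] := cw_skelT cwX x; exact: (h n.+1).
elim: n => [[]|n IH] skx.
have [/IH//|nskx] := pselect (pred_skel sk n x).
have [f [y [cf nSy yx]]] := cw_surj cwX skx nskx.
have [Ax|nAx] := pselect (A x); first by rewrite retraction_sub// normr0.
rewrite -yx retraction_cell//; last first.
  by move=> z nSz Az; apply: nAx; rewrite -yx; exact: wA cf nSz nSy Az.
by rewrite dproj0 asboolF.
Qed.

Lemma retraction_range p : (retraction p).1 = 0 \/ A (retraction p).2.
Proof.
case: p => t x.
suff h n : pred_skel sk n x ->
    (retraction (t, x)).1 = 0 \/ A (retraction (t, x)).2.
  by have [n skx] := cw_skelT cwX x; exact: (h n.+1).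
elim: n t x => [? ? []|n IH] t x skx.
have [/IH//|nskx] := pselect (pred_skel sk n x).
have [f [y [cf nSy yx]]] := cw_surj cwX skx nskx.
have [Ax|nAx] := pselect (A x); first by right; rewrite retraction_sub.
rewrite -yx retraction_cell//; last first.
  by move=> z nSz Az; apply: nAx; rewrite -yx; exact: wA cf nSz nSy Az.
case: ifPn => [/asboolP Sq|_]; last by left.
by apply: IH; exact: (cw_sphere cwX cf).
Qed.

(** On a cell of [A] both the boundary, where the induction hypothesis applies,
    and the part in [A] are closed. On another cell the same is true of the
    part projected to the side and of the part projected to the bottom. *)
Lemma cts_retraction : continuous retraction.
Proof.
apply: homotopy_by_skeleta => n IH f cf.
pose F (p : R * disk R n) := retraction (p.1, f p.2).
change (continuous F).
have cfc := cw_cts cwX cf.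
pose i (y : [set y : disk R n | sphere R n (\val y)]) : disk R n := \val y.
have ci : continuous i by exact: cts_val.
have ei : closed_embedding i by apply: closed_embedding_val; exact: closed_sphere.
have Si y : sphere R n (\val (i y)) by exact: (set_mem (valP y)).
pose G (p : R * [set y : disk R n | sphere R n (\val y)]) :=
  retraction (p.1, f (i p.2)).
have cG : continuous G.
  apply: (IH _ (f \o i)) => [|y]; first exact: cts_comp.
  exact: (cw_sphere cwX cf).
have closedG K : closed K ->
    closed [set q : R * disk R n | sphere R n (\val q.2) /\ K (F q)].
  move=> cK; have -> : [set q : R * disk R n | sphere R n (\val q.2) /\ K (F q)]
      = (fun p => (p.1, i p.2)) @` (G @^-1` K).
    apply/seteqP; split=> [[t y] [/= Sy Ky]|_ [[t y] /= Ky <-]].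
      by exists (t, SigSub (mem_set Sy : y \in mkset _)).
    by split=> //=; exact: Si.
  by apply: closed_embedding_prod => //; exact: cts_closed.
have [[y0 nSy0 Ay0]|nA] := pselect
    (exists2 y, ~ sphere R n (\val y) & A (f y)).
  have c2 : continuous (fun p : R * disk R n => f p.2).
    by apply: cts_comp cfc _; apply: cts_snd; exact: cts_id.
  apply: (@cts_cover _ _ F [set p | sphere R n (\val p.2)] [set p | A (f p.2)]).
  - move=> [t y] /=; have [Sy|nSy] := pselect (sphere R n (\val y)); first by left.
    by right; exact: wA cf nSy0 nSy Ay0.
  - exact: closedG.
  - apply: (@closed_agree _ _ F (fun p => (`|p.1|, f p.2))).
    + exact: cts_closed c2 cA.
    + apply: cts_pair; last exact: c2.
      by apply: cts_normr; apply: cts_fst; exact: cts_id.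
    + by move=> [t y] /= Ay; rewrite /F retraction_sub.
have FE p : F p = if `[< sphere R n (\val (dproj p).2) >] then F (dproj p)
    else (0, f (dproj p).2).
  case: p => t y; rewrite {1}/F retraction_cell//.
  by move=> z nSz Az; apply: nA; exists z.
apply: (@cts_cover _ _ F [set p | sphere R n (\val (dproj p).2)]
  [set p | (dproj p).1 = 0]).
- by move=> p; case: (dproj_side p); [right|left].
- move=> K cK.
  have -> : [set p | sphere R n (\val (dproj p).2)] `&` F @^-1` K =
      @dproj R n @^-1` [set q | sphere R n (\val q.2) /\ K (F q)].
    have e p : sphere R n (\val (dproj p).2) -> F p = F (dproj p).
      by move=> Sp; rewrite FE asboolT.
    apply/seteqP; split=> p [Sp Kp]; split=> //.
      by move: Kp; rewrite /preimage /= (e p Sp).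
    by rewrite /preimage /= (e p Sp).
  by apply: cts_closed (closedG _ cK); exact: cts_dproj.
- have c2 : continuous (fun p : R * disk R n => (0 : R, f (dproj p).2)).
    apply: cts_pair; first exact: cts_cst.
    by apply: cts_comp cfc _; apply: cts_snd; exact: cts_dproj.
  apply: closed_agree c2 _.
    apply: closed_eq_fun; last exact: cts_cst.
    by apply: cts_fst; exact: cts_dproj.
  move=> p p0; rewrite FE; case: ifPn => // _.
  have {}p0 : (dproj p).1 = 0 by exact: p0.
  by rewrite /F p0 retraction0.
Qed.

End Retraction.

End CWTheory.

(** * Contractibility of glued spaces *)

Section Contractible.
Variable R : realType.

Lemma within_comp (S T Z : topologicalType) (A : set T) (h : T -> Z)
    (g : S -> T) : {within A, continuous h} -> continuous g ->
  (forall x, A (g x)) -> continuous (fun x => h (g x)).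
Proof.
move=> /subspace_sigL_continuousP ch cg Ag.
pose g' (x : S) : A := SigSub (mem_set (Ag x)).
have cg' : continuous g' by apply: cts_into.
exact: (cts_comp ch cg').
Qed.

(** Homotopies run over all of [R]; clamping the time makes this equivalent. *)
Lemma contractibleP (T : topologicalType) : contractible R T <->
  exists t0 (h : R * T -> T),
    [/\ continuous h, forall t, h (0, t) = t & forall t, h (1, t) = t0].
Proof.
split=> -[t0 [h [ch h0 h1]]]; last first.
  by exists t0, h; split=> //; exact: continuous_subspaceT.
exists t0, (fun p => h (clamp p.1, p.2)); split=> [|t|t].
- apply: (within_comp ch).
    apply: cts_pair; last by apply: cts_snd; exact: cts_id.
    by apply: cts_comp (@cts_clamp R) _; apply: cts_fst; exact: cts_id.
  by move=> [t x]; split=> //=; rewrite in_itv/=; exact: clamp_itv.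
- by rewrite /= clamp0.
- by rewrite /= clamp1.
Qed.

Definition concat (X Z : Type) (F G : R * X -> Z) (p : R * X) : Z :=
  if p.1 *+ 2 <= 1 then F (p.1 *+ 2, p.2) else G (p.1 *+ 2 - 1, p.2).

Section Concat.
Variables (X Z : topologicalType) (F G : R * X -> Z).
Hypotheses (cF : continuous F) (cG : continuous G).
Hypothesis FG : forall x, F (1, x) = G (0, x).

Lemma cts_concat : continuous (concat F G).
Proof.
have c2 : continuous (fun p : R * X => p.1 *+ 2).
  by apply: cts_add; apply: cts_fst; exact: cts_id.
have cx : continuous (fun p : R * X => p.2) by apply: cts_snd; exact: cts_id.
have cc (c : R) : continuous (fun _ : R * X => c) by exact: cts_cst.
apply: (@cts_glue _ _ _ (fun p => F (p.1 *+ 2, p.2))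
  (fun p => G (p.1 *+ 2 - 1, p.2)) [set p | p.1 *+ 2 <= 1] [set p | 1 <= p.1 *+ 2]).
- by move=> p /=; exact/orP/le_total.
- exact: closed_le_fun.
- exact: closed_le_fun.
- by apply: cts_comp cF _; exact: cts_pair.
- by apply: cts_comp cG _; apply: cts_pair => //; exact: cts_subr.
- by move=> p /= le1; rewrite /concat le1.
- move=> p /= ge1; rewrite /concat; case: ifP => // le1.
  have -> : p.1 *+ 2 = 1 by apply/eqP; rewrite eq_le le1.
  by rewrite FG subrr.
Qed.

Lemma concat0 x : concat F G (0, x) = F (0, x).
Proof. by rewrite /concat /= mul0rn ler01. Qed.

Lemma concat1 x : concat F G (1, x) = G (1, x).
Proof.
rewrite /concat /= ifF; last by apply/negbTE; rewrite -ltNge ltrDl.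
by congr (G (_, x)); ring.
Qed.

End Concat.

Lemma contractible_to (T : topologicalType) (x : T) : contractible R T ->
  exists h : R * T -> T,
    [/\ continuous h, forall t, h (0, t) = t & forall t, h (1, t) = x].
Proof.
move=> /contractibleP[t0 [h [ch h0 h1]]].
pose g (p : R * T) := h (1 - p.1, x).
have cg : continuous g.
  apply: cts_comp ch _; apply: cts_pair; last exact: cts_cst.
  by apply: cts_subr; [exact: cts_cst|apply: cts_fst; exact: cts_id].
exists (concat h g); split=> [|t|t].
- by apply: cts_concat => // t; rewrite h1 /g /= subr0 h1.
- by rewrite concat0.
- by rewrite concat1 /g /= subrr h0.
Qed.

Lemma contractible_homeo (S T : topologicalType) (f : S -> T) (g : T -> S) :
  continuous f -> continuous g -> cancel f g -> cancel g f ->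
  contractible R S -> contractible R T.
Proof.
move=> cf cg fK gK /contractibleP[s0 [h [ch h0 h1]]]; apply/contractibleP.
exists (f s0), (fun p => f (h (p.1, g p.2))); split=> [|t|t].
- apply: cts_comp cf _; apply: cts_comp ch _.
  apply: cts_pair; first by apply: cts_fst; exact: cts_id.
  by apply: cts_comp cg _; apply: cts_snd; exact: cts_id.
- by rewrite h0 gK.
- by rewrite h1.
Qed.

End Contractible.

(** [D] is obtained from [C] by gluing [B] along a closed subspace [A] of [B].
    Unlike the universal property of a pushout, this concrete description
    passes to fixed points and to skeleta. *)
Record adjunction (A B C D : topologicalType)
    (f : A -> B) (u : A -> C) (v : B -> D) (w : C -> D) : Prop := Adjunction {
  adj_emb : closed_embedding f;
  adj_u : continuous u;
  adj_v : continuous v;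
  adj_w : continuous w;
  adj_comm : forall a, v (f a) = w (u a);
  adj_injw : injective w;
  adj_vw : forall b c, v b = w c -> exists2 a, f a = b & u a = c;
  adj_injv : forall b b', v b = v b' ->
    b = b' \/ exists a a', [/\ f a = b, f a' = b' & u a = u a'];
  adj_surj : forall d, (exists b, v b = d) \/ (exists c, w c = d);
  adj_closed : forall K, closed (v @^-1` K) -> closed (w @^-1` K) -> closed K }.

Section Adjunction.
Variables (R : realType) (A B C D : topologicalType).
Variables (f : A -> B) (u : A -> C) (v : B -> D) (w : C -> D).
Hypothesis adj : adjunction f u v w.

Lemma adj_homotopy (Z : topologicalType) (p : R * B -> Z) (q : R * C -> Z) :
  continuous p -> continuous q -> (forall t a, p (t, f a) = q (t, u a)) ->
  exists F : R * D -> Z, [/\ continuous F,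
    forall t b, F (t, v b) = p (t, b) & forall t c, F (t, w c) = q (t, c)].
Proof.
move=> cp cq pq.
have val (t : R) (d : D) : exists z, (forall b, v b = d -> z = p (t, b)) /\
    (forall c, w c = d -> z = q (t, c)).
  have [[c cd]|nC] := pselect (exists c, w c = d).
    exists (q (t, c)); split=> [b bd|c' c'd].
      by have [|a <- <-] := adj_vw adj (b := b) (c := c); rewrite ?bd.
    by congr (q (t, _)); apply: (adj_injw adj); rewrite cd.
  have [[b bd]|//] := adj_surj adj d.
  exists (p (t, b)); split=> [b' b'd|c cd]; last by case: nC; exists c.
  have [-> //|[a [a' [fa _ _]]]] := adj_injv adj (etrans bd (esym b'd)).
  by case: nC; exists (u a); rewrite -(adj_comm adj) fa.
pose F (x : R * D) := sval (cid (val x.1 x.2)).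
have FE t d : (forall b, v b = d -> F (t, d) = p (t, b)) /\
    (forall c, w c = d -> F (t, d) = q (t, c)).
  by rewrite /F; case: (cid _).
have Fv t b : F (t, v b) = p (t, b) by have [+ _] := FE t (v b); apply.
have Fw t c : F (t, w c) = q (t, c) by have [_] := FE t (w c); apply.
exists F; split=> //.
pose X (i : bool) : topologicalType := if i then B else C.
pose e (i : bool) : X i -> D := if i return X i -> D then v else w.
apply: (@final_homotopy R bool X D e).
  split=> [[]|d|K cK]; [exact: adj_v adj|exact: adj_w adj| |].
    by have [[b bd]|[c cd]] := adj_surj adj d; [exists true, b|exists false, c].
  by apply: (adj_closed adj); [exact: cK true|exact: cK false].
case=> /=.
  by have -> : (fun p => F (p.1, v p.2)) = p by apply/funext => -[t b]; exact: Fv.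
by have -> : (fun p => F (p.1, w p.2)) = q by apply/funext => -[t c]; exact: Fw.
Qed.

End Adjunction.

(** For nonnegative times [r] is a retraction of the cylinder over [B] into the
    union of its bottom and the cylinder over [A]. It is the universal case
    of the homotopy extension property, and lets extensions depend
    continuously on parameters. *)
Definition cofibration (R : realType) (A B : topologicalType) (f : A -> B) :=
  exists r : R * B -> R * B, [/\ continuous r, forall b, r (0, b) = (0, b),
    forall t a, r (t, f a) = (`|t|, f a) &
    forall p, (r p).1 = 0 \/ range f (r p).2].

Section Extension.
Variables (R : realType) (A B P Z : topologicalType) (f : A -> B).
Hypotheses (ef : closed_embedding f) (rf : cofibration R f).

(** The extension is the composite of the retraction with the map given by [g]
    on the bottom and by [h] on the cylinder over [A]. It takes no other values,
    which the last property records for the end of a null homotopy. *)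
Lemma extend_homotopy (g : P * B -> Z) (h : P * (R * A) -> Z) :
  continuous g -> continuous h -> (forall s a, h (s, (0, a)) = g (s, f a)) ->
  exists E : P * (R * B) -> Z, [/\ continuous E,
    forall s b, E (s, (0, b)) = g (s, b),
    forall s t a, E (s, (t, f a)) = h (s, (`|t|, a)) &
    forall s z, (forall b, g (s, b) = z) -> (forall x, h (s, x) = z) ->
      forall x, E (s, x) = z].
Proof.
have [r [cr r0 ra rr]] := rf; have [_ jf _ closedf] := ef => cg ch gh.
pose E (x : P * (R * B)) : Z := let q := r x.2 in
  if pselect (exists a, f a = q.2) is left e then h (x.1, (q.1, sval (cid e)))
  else g (x.1, q.2).
have Ea x a : f a = (r x.2).2 -> E x = h (x.1, ((r x.2).1, a)).
  move=> fa; rewrite /E; case: pselect => [e|[]]; last by exists a.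
  by congr h; congr (_, (_, _)); apply: jf; rewrite fa; case: (cid e).
have E0 x : (r x.2).1 = 0 -> E x = g (x.1, (r x.2).2).
  move=> r0x; have [[a fa]|na] := pselect (exists a, f a = (r x.2).2).
    by rewrite (Ea x a fa) r0x gh fa.
  by rewrite /E; case: pselect.
have cr' : continuous (fun x : P * (R * B) => r x.2).
  by apply: cts_comp cr _; apply: cts_snd; exact: cts_id.
have c1 : continuous (fun x : P * (R * B) => x.1) by apply: cts_fst; exact: cts_id.
have cr1 := cts_fst cr'; have cr2 := cts_snd cr'.
exists E; split=> [|s b|s t a|s z gz hz x]; last 3 first.
- by rewrite E0 /= r0.
- by rewrite (Ea _ a) /= ra.
- by rewrite /E; case: pselect => [e|_]; rewrite ?gz ?hz.
apply: (@cts_cover _ _ E [set x | range f (r x.2).2] [set x | (r x.2).1 = 0]).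
- by move=> x; case: (rr x.2); [right|left].
- move=> K cK.
  have -> : [set x | range f (r x.2).2] `&` E @^-1` K =
    (fun x : P * (R * B) => ((x.1, (r x.2).1), (r x.2).2)) @^-1`
      ((fun y : (P * R) * A => (y.1, f y.2)) @`
        ((fun y : (P * R) * A => h (y.1.1, (y.1.2, y.2))) @^-1` K)).
    apply/seteqP; split=> [x [[a _ fa] Kx]|x [[[s t] a] /= Kh [sx tx ax]]].
      exists ((x.1, (r x.2).1), a); last by rewrite /= fa.
      by move: Kx; rewrite /preimage /= (Ea x a fa).
    split; first by exists a.
    by rewrite /preimage /= (Ea x a ax) -sx -tx.
  apply: cts_closed; first by apply: cts_pair => //; exact: cts_pair.
  apply: closed_embedding_prod => //; apply: cts_closed cK.
  apply: cts_comp ch _; apply: cts_pair.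
    by apply: cts_fst; apply: cts_fst; exact: cts_id.
  apply: cts_pair; last by apply: cts_snd; exact: cts_id.
  by apply: cts_snd; apply: cts_fst; exact: cts_id.
- have c0 : continuous (fun x : P * (R * B) => g (x.1, (r x.2).2)).
    by apply: cts_comp cg _; exact: cts_pair.
  apply: closed_agree c0 _; last exact: E0.
  by apply: closed_eq_fun => //; exact: cts_cst.
Qed.

End Extension.

Section Gluing.
Variables (R : realType) (A B C D : topologicalType).
Variables (f : A -> B) (u : A -> C) (v : B -> D) (w : C -> D).

(** If [f] is a cofibration, then maps out of the double mapping cylinder of
    [f] and [u] give maps out of [D], and homotopies give homotopies. Here
    [gB], [gC] and [h] make up a null homotopy of the map from the double
    mapping cylinder to [D]. *)
Lemma contractible_cylinder (d0 : D) (gB : R * B -> D) (gC : R * C -> D)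
    (h : R * (R * A) -> D) :
  adjunction f u v w -> cofibration R f ->
  continuous gB -> continuous gC -> continuous h ->
  (forall s a, h (s, (0, a)) = gB (s, f a)) ->
  (forall s a, h (s, (1, a)) = gC (s, u a)) ->
  (forall b, gB (0, b) = v b) -> (forall c, gC (0, c) = w c) ->
  (forall t a, h (0, (t, a)) = v (f a)) ->
  (forall b, gB (1, b) = d0) -> (forall c, gC (1, c) = d0) ->
  (forall t a, h (1, (t, a)) = d0) ->
  contractible R D.
Proof.
move=> adj rf cB cC ch hB hC B0 C0 h0 B1 C1 h1.
have [E [cE E0 Ef Ez]] := extend_homotopy (adj_emb adj) rf cB ch hB.
have cst (S T : topologicalType) (y : T) : continuous (fun _ : S => y).
  exact: cts_cst.
have id1 (S T : topologicalType) : continuous (fun x : S * T => x.1).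
  by apply: cts_fst; exact: cts_id.
have id2 (S T : topologicalType) : continuous (fun x : S * T => x.2).
  by apply: cts_snd; exact: cts_id.
have [|||F [cF Fv Fw]] := adj_homotopy adj (p := fun x => E (0, x))
    (q := fun x : R * C => w x.2).
- by apply: cts_comp cE _; apply: cts_pair; [exact: cst|exact: cts_id].
- exact: cts_comp (adj_w adj) (id2 _ _).
- by move=> t a; rewrite Ef h0 (adj_comm adj).
have [|||G [cG Gv Gw]] := adj_homotopy adj (p := fun x => E (x.1, (1, x.2)))
    (q := gC).
- apply: cts_comp cE _; apply: cts_pair; first exact: id1.
  by apply: cts_pair; [exact: cst|exact: id2].
- by [].
- by move=> s a; rewrite Ef normr1 hC.
apply/contractibleP; exists d0, (concat F G); split.
- apply: cts_concat => // d.
  by case: (adj_surj adj d) => -[x <-]; rewrite ?Fv ?Gv// ?Fw ?Gw.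
- by move=> d; rewrite concat0; case: (adj_surj adj d) => -[x <-];
     rewrite ?Fv ?E0 ?B0 ?Fw.
- move=> d; rewrite concat1; case: (adj_surj adj d) => -[x <-].
    by rewrite Gv (Ez _ d0)// => -[t a]; exact: h1.
  by rewrite Gw C1.
Qed.
End Gluing.

Section NullCylinder.
Variables (R : realType) (A B C D : topologicalType).
Variables (f : A -> B) (u : A -> C) (v : B -> D) (w : C -> D).

(** A homotopy of maps out of a double mapping cylinder made of two cylinders
    over [A]: the cylinder [cylL] is attached to [B], the cylinder [cylR] is
    attached to [C], and both are attached to each other. *)
Record cyl := Cyl {
  cylB : R * B -> D;
  cylC : R * C -> D;
  cylL : R * (R * A) -> D;
  cylR : R * (R * A) -> D }.

Definition cyl_cts (x : cyl) := [/\ continuous (cylB x), continuous (cylC x),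
  continuous (cylL x) & continuous (cylR x)].

Definition cyl_glued (x : cyl) :=
  [/\ forall s a, cylL x (s, (0, a)) = cylB x (s, f a),
      forall s a, cylL x (s, (1, a)) = cylR x (s, (0, a)) &
      forall s a, cylR x (s, (1, a)) = cylC x (s, u a)].

Definition cyl_match (x y : cyl) :=
  [/\ forall b, cylB x (1, b) = cylB y (0, b),
      forall c, cylC x (1, c) = cylC y (0, c),
      forall p, cylL x (1, p) = cylL y (0, p) &
      forall p, cylR x (1, p) = cylR y (0, p)].

Definition cyl_concat (x y : cyl) := Cyl (concat (cylB x) (cylB y))
  (concat (cylC x) (cylC y)) (concat (cylL x) (cylL y))
  (concat (cylR x) (cylR y)).

Lemma cyl_concat_cts x y : cyl_cts x -> cyl_cts y -> cyl_match x y ->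
  cyl_cts (cyl_concat x y).
Proof.
by move=> [? ? ? ?] [? ? ? ?] [? ? ? ?]; split; exact: cts_concat.
Qed.

Lemma cyl_concat_glued x y : cyl_glued x -> cyl_glued y ->
  cyl_glued (cyl_concat x y).
Proof.
move=> [x1 x2 x3] [y1 y2 y3].
by split=> s a /=; rewrite /concat /=; case: ifP => _.
Qed.

Lemma cyl_match_concatl x y z : cyl_match y z -> cyl_match (cyl_concat x y) z.
Proof. by move=> [? ? ? ?]; split=> p /=; rewrite concat1. Qed.

Hypotheses (cf : continuous f) (cu : continuous u).
Hypotheses (cv : continuous v) (cw_ : continuous w).
Hypothesis vf : forall a, v (f a) = w (u a).

Variables (s : C -> A) (al : R * A -> A) (ga : R * C -> C) (be : R * B -> B).
Variable b0 : B.
Hypotheses (cs : continuous s) (cal : continuous al) (cga : continuous ga).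
Hypothesis cbe : continuous be.
Hypotheses (al0 : forall a, al (0, a) = a) (al1 : forall a, al (1, a) = s (u a)).
Hypotheses (ga0 : forall c, ga (0, c) = c) (ga1 : forall c, ga (1, c) = u (s c)).
Hypotheses (be0 : forall b, be (0, b) = b) (be1 : forall b, be (1, b) = b0).
Hypothesis sal : forall t a, s (u (al (t, a))) = s (u a).
Hypothesis sus : forall c, s (u (s c)) = s c.

(** The maps [v] and [w] with constant homotopies between them are
    deformed in four stages. The contraction [ga] shrinks [C] to the image of
    [s], leaving on the right cylinder the traces of this contraction. Moving
    the middle of the cylinder by [al] turns these traces into loops which only
    depend on the component, and [C] is moved back along these loops. Then
    everything is the composite of [v] with maps to [B], and [be] finishes. *)
Lemma null_cylinder : exists (gB : R * B -> D) (gC : R * C -> D)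
    (h : R * (R * A) -> D),
  [/\ [/\ continuous gB, continuous gC & continuous h],
    [/\ forall s a, h (s, (0, a)) = gB (s, f a) &
        forall s a, h (s, (1, a)) = gC (s, u a)],
    [/\ forall b, gB (0, b) = v b, forall c, gC (0, c) = w c &
        forall t a, h (0, (t, a)) = v (f a)] &
    [/\ forall b, gB (1, b) = v b0, forall c, gC (1, c) = v b0 &
        forall t a, h (1, (t, a)) = v b0]].
Proof.
pose G1 := Cyl (fun x => v x.2) (fun x => w (ga x)) (fun x => v (f x.2.2))
  (fun x => w (ga (x.1 * x.2.1, u x.2.2))).
pose G2 := Cyl (fun x => v x.2) (fun x => w (u (s x.2)))
  (fun x => v (f (al (x.1 * x.2.1, x.2.2))))
  (fun x => w (ga (x.2.1, u (al (x.1, x.2.2))))).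
pose G3 := Cyl (fun x => v x.2) (fun x => w (ga (1 - x.1, u (s x.2))))
  (fun x => v (f (al x.2)))
  (fun x => w (ga ((1 - x.1) * x.2.1, u (s (u x.2.2))))).
pose G4 := Cyl (fun x => v (be x)) (fun x => v (be (x.1, f (s x.2))))
  (fun x => v (be (x.1, f (al x.2)))) (fun x => v (be (x.1, f (s (u x.2.2))))).
have G1c : cyl_cts G1.
  split=> /=; [apply: cts_comp cv _|apply: cts_comp cw_ _| |]; try ctsp.
    by apply: cts_comp cv _; apply: cts_comp cf _; ctsp.
  apply: cts_comp cw_ _; apply: cts_comp cga _; apply: cts_pair; first by ctsp.
  by apply: cts_comp cu _; ctsp.
have G2c : cyl_cts G2.
  split=> /=; first by apply: cts_comp cv _; ctsp.
  - by apply: cts_comp cw_ _; apply: cts_comp cu _; apply: cts_comp cs _; ctsp.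
  - apply: cts_comp cv _; apply: cts_comp cf _; apply: cts_comp cal _; ctsp.
  - apply: cts_comp cw_ _; apply: cts_comp cga _; apply: cts_pair; first by ctsp.
    by apply: cts_comp cu _; apply: cts_comp cal _; ctsp.
have G3c : cyl_cts G3.
  split=> /=; first by apply: cts_comp cv _; ctsp.
  - apply: cts_comp cw_ _; apply: cts_comp cga _; apply: cts_pair; first by ctsp.
    by apply: cts_comp cu _; apply: cts_comp cs _; ctsp.
  - by apply: cts_comp cv _; apply: cts_comp cf _; apply: cts_comp cal _; ctsp.
  - apply: cts_comp cw_ _; apply: cts_comp cga _; apply: cts_pair; first by ctsp.
    apply: cts_comp cu _; apply: cts_comp cs _; apply: cts_comp cu _; ctsp.
have G4c : cyl_cts G4.
  split=> /=; first exact: cts_comp cv cbe;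
    apply: cts_comp cv _; apply: cts_comp cbe _; apply: cts_pair; try ctsp.
  - by apply: cts_comp cf _; apply: cts_comp cs _; ctsp.
  - by apply: cts_comp cf _; apply: cts_comp cal _; ctsp.
  - apply: cts_comp cf _; apply: cts_comp cs _; apply: cts_comp cu _; ctsp.
have G1g : cyl_glued G1.
  by split=> t a /=; rewrite ?mulr0 ?mulr1 ?ga0 ?vf.
have G2g : cyl_glued G2.
  by split=> t a /=; rewrite ?mulr0 ?mulr1 ?ga0 ?ga1 ?al0 ?vf ?sal.
have G3g : cyl_glued G3.
  by split=> t a /=; rewrite ?mulr0 ?mulr1 ?ga0 ?al0 ?al1 ?vf.
have G4g : cyl_glued G4 by split=> t a /=; rewrite ?al0 ?al1.
have m12 : cyl_match G1 G2.
  by split=> [b|c|[t a]|[t a]] /=; rewrite ?ga1 ?mul0r ?mul1r ?al0.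
have m23 : cyl_match G2 G3.
  split=> [b|c|[t a]|[t a]] /=; rewrite ?subr0 ?mul1r//; last by rewrite al1.
  by rewrite ga1 sus.
have m34 : cyl_match G3 G4.
  split=> [b|c|[t a]|[t a]] /=; rewrite ?subrr ?mul0r ?be0//.
    by rewrite ga0 vf.
  by rewrite ga0 vf.
pose H := cyl_concat (cyl_concat (cyl_concat G1 G2) G3) G4.
have [HBc HCc HLc HRc] : cyl_cts H.
  apply: cyl_concat_cts => //; last exact: cyl_match_concatl.
  apply: cyl_concat_cts => //; last exact: cyl_match_concatl.
  exact: cyl_concat_cts.
have [HL0 HL1 HR1] : cyl_glued H.
  by do 3!apply: cyl_concat_glued => //.
exists (cylB H), (cylC H).
exists (fun x => concat (fun y : R * (R * A) => cylL H (y.2.1, (y.1, y.2.2)))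
  (fun y : R * (R * A) => cylR H (y.2.1, (y.1, y.2.2))) (x.2.1, (x.1, x.2.2))).
split; split.
- exact: HBc.
- exact: HCc.
- have cc : continuous (fun x : R * (R * A) => (x.2.1, (x.1, x.2.2))).
    by ctsp.
  apply: (cts_comp _ cc); apply: cts_concat => [||[t a]]; last exact: HL1.
    exact: cts_comp HLc cc.
  exact: cts_comp HRc cc.
- by move=> t a; rewrite concat0 /=; exact: HL0.
- by move=> t a; rewrite concat1 /=; exact: HR1.
- by move=> b; rewrite /H /= !concat0.
- by move=> c; rewrite /H /= !concat0 /= ga0.
- move=> t a; rewrite {1}/concat; case: ifP => _; rewrite /H /= !concat0 //=.
  by rewrite mul0r ga0 vf.
- by move=> b; rewrite /H /= concat1 be1.
- by move=> c; rewrite /H /= concat1 be1.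
- by move=> t a; rewrite {1}/concat; case: ifP => _; rewrite /H /= concat1 /= be1.
Qed.

End NullCylinder.

Section GluingTheorem.
Variables (R : realType) (A B C D : topologicalType).
Variables (f : A -> B) (u : A -> C) (v : B -> D) (w : C -> D).
Variables (s : C -> A) (al : R * A -> A) (ga : R * C -> C).
Hypotheses (cs : continuous s) (cal : continuous al) (cga : continuous ga).
Hypotheses (al0 : forall a, al (0, a) = a) (al1 : forall a, al (1, a) = s (u a)).
Hypotheses (ga0 : forall c, ga (0, c) = c) (ga1 : forall c, ga (1, c) = u (s c)).
Hypothesis sal : forall t a, s (u (al (t, a))) = s (u a).
Hypothesis sus : forall c, s (u (s c)) = s c.

(** The null homotopy of the double mapping cylinder is the same in both cases.
    The cofibration only serves to pass from the cylinder to [D]; if it is [u],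
    the cylinder is run through backwards. *)
Lemma contractible_gluing :
  (adjunction f u v w /\ cofibration R f) \/
  (adjunction u f w v /\ cofibration R u) ->
  contractible R B -> contractible R D.
Proof.
move=> adj /contractibleP[b0 [be [cbe be0 be1]]].
have [cf cu cv cw_ vf] : [/\ continuous f, continuous u, continuous v,
    continuous w & forall a, v (f a) = w (u a)].
  case: adj => -[[[cf _ _ _] cu cv cw_ vf _ _ _ _ _] _]; first by [].
  by split=> // a; rewrite vf.
have [gB [gC [h [[cB cC ch] [hB hC] [B0 C0 h0] [B1 C1 h1]]]]] :=
  null_cylinder cf cu cv cw_ vf cs cal cga cbe al0 al1 ga0 ga1 be0 be1 sal sus.
case: adj => [[adj rf]|[adj ru]].
  exact: (contractible_cylinder (d0 := v b0) adj rf cB cC ch).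
pose h' (x : R * (R * A)) := h (x.1, (1 - x.2.1, x.2.2)).
have ch' : continuous h'.
  apply: cts_comp ch _; apply: cts_pair; first by apply: cts_fst; exact: cts_id.
  apply: cts_pair; last by apply: cts_snd; apply: cts_snd; exact: cts_id.
  apply: cts_subr; first exact: cts_cst.
  by apply: cts_fst; apply: cts_snd; exact: cts_id.
apply: (contractible_cylinder (d0 := v b0) adj ru cC cB ch') => //.
- by move=> t a; rewrite /h' /= subr0.
- by move=> t a; rewrite /h' /= subrr.
- by move=> t a; rewrite /h' h0 vf.
- by move=> t a; rewrite /h' h1.
Qed.

End GluingTheorem.

(** * Cellular subspaces *)

Section Subcomplex.
Variables (R : realType) (X : topologicalType) (sk : nat -> set X).
Variable cell : forall n, set (disk R n -> X).
Arguments cell : clear implicits.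
Hypothesis cwX : cw sk cell.

Lemma cw_cofibration (A : topologicalType) (f : A -> X) :
  closed_embedding f -> cellwise cell (range f) -> cofibration R f.
Proof.
move=> [cf _ _ rf] wf; exists (retraction cwX (range f)); split.
- exact: cts_retraction.
- exact: retraction0.
- by move=> t a; apply: retraction_sub; exists a.
- exact: retraction_range.
Qed.

Variable A : set X.
Hypothesis wA : forall n f y z, cell n f -> ~ sphere R n (\val y) ->
  A (f y) -> A (f z).

(** If a cell does not lie in [A], then only its boundary meets [A], and the
    boundary is dealt with by induction on the dimension. *)
Lemma closed_cellwise : closed A.
Proof.
apply: (closed_by_skeleta cwX) => n cA f cf.
have [[y nSy Afy]|nA] := pselect (exists2 y, ~ sphere R n (\val y) & A (f y)).
  suff -> : f @^-1` A = setT by exact: closedT.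
  by apply/seteqP; split=> // z _; exact: wA cf nSy Afy.
have -> : f @^-1` A = f @^-1` (A `&` pred_skel sk n).
  apply/seteqP; split=> [y Afy|y []//]; split=> //.
  apply: (cw_sphere cwX cf); apply: contrapT => nSy; apply: nA.
  by exists y.
exact: cts_closed (cw_cts cwX cf) cA.
Qed.

Definition sub_cell n : set (disk R n -> A) :=
  [set f | cell n (fun y => \val (f y))].

Lemma cw_sub : cw (fun n => (\val : A -> X) @^-1` sk n) sub_cell.
Proof.
have cA := closed_cellwise.
have predE n x : pred_skel (fun n => (\val : A -> X) @^-1` sk n) n x <->
    pred_skel sk n (\val x) by case: n.
have closedE (K : set A) : closed K <-> closed (\val @` K).
  split; first exact: closed_image_val.
  move=> cK; have -> : K = \val @^-1` (\val @` K).
    apply/seteqP; split=> [x Kx|x [y Ky /val_inj <-]//]; by exists x.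
  exact: cts_closed (@cts_val _ _) cK.
have imI (K : set A) (B : set X) :
    \val @` (K `&` (\val : A -> X) @^-1` B) = \val @` K `&` B.
  apply/seteqP; split=> [_ [x [Kx Bx] <-]|_ [[x Kx <-] Bx]].
    by split=> //; exists x.
  by exists x.
split.
- by move=> n x; exact: (cw_skelS cwX).
- by move=> x; have [n skx] := cw_skelT cwX (\val x); exists n.
- by move=> n f cf; apply: cts_into; exact: (cw_cts cwX cf).
- by move=> n f y cf Sy; apply/predE; exact: (cw_sphere cwX cf Sy).
- move=> n f y cf nSy; have [? npf] := cw_int cwX cf nSy.
  by split=> // /predE.
- move=> n f g y z cf cg nSy nSz /(congr1 \val) fg.
  have [e ->] := cw_inj cwX cf cg nSy nSz fg.
  split=> //; apply/funext => t; apply: val_inj; exact: (congr1 (@^~ t) e).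
- move=> n x skx npx; have [|f [y [cf nSy fx]]] := cw_surj cwX skx.
    by move=> /predE.
  have Af z : f z \in A.
    apply/mem_set; apply: (wA (y := y)) cf nSy _; rewrite fx.
    exact: (set_mem (valP x)).
  by exists (fun z => SigSub (Af z)), y; split=> //; apply: val_inj.
- move=> n K Ksk cKp cK; apply/closedE; apply: (cw_attach cwX (n := n)).
  + by move=> _ [x Kx <-]; exact: Ksk.
  + rewrite -imI; apply/closedE; have -> // : K `&` (\val : A -> X) @^-1`
        pred_skel sk n = K `&` pred_skel (fun n => (\val : A -> X) @^-1` sk n) n.
    by congr (_ `&` _); apply/seteqP; split=> x /predE.
  + move=> f cf.
    have [[y nSy Afy]|nA] := pselect (exists2 y, ~ sphere R n (\val y) & A (f y)).
      have Af z : f z \in A by apply/mem_set; exact: wA cf nSy Afy.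
      pose g z : A := SigSub (Af z).
      have -> : f @^-1` (\val @` K) = g @^-1` K.
        apply/seteqP; split=> [z [x Kx xf]|z Kz]; last by exists (g z).
        have gx : x = g z by apply: val_inj.
        by rewrite /preimage /mkset -gx.
      by apply: cK.
    have -> : f @^-1` (\val @` K) = f @^-1` (\val @` K `&` pred_skel sk n).
      apply/seteqP; split=> [y Kfy|y []//]; split=> //.
      apply: (cw_sphere cwX cf); apply: contrapT => nSy; apply: nA.
      by exists y => //; case: Kfy => x _ <-; exact: (set_mem (valP x)).
    apply: cts_closed (cw_cts cwX cf) _.
    rewrite -imI; apply/closedE; have -> // : K `&` (\val : A -> X) @^-1`
        pred_skel sk n = K `&` pred_skel (fun n => (\val : A -> X) @^-1` sk n) n.
    by congr (_ `&` _); apply/seteqP; split=> x /predE.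
- move=> K cK; apply/closedE; apply: (cw_weak cwX) => n.
  by rewrite -imI; apply/closedE; exact: cK.
Qed.

End Subcomplex.

(** * CW-structures on glued spaces and coproducts *)

Lemma pred_skelU (X Y Z : Type) (v : X -> Z) (w : Y -> Z) (skX : nat -> set X)
    (skY : nat -> set Y) (skZ : nat -> set Z) n :
  (forall n, skZ n = v @` skX n `|` w @` skY n) ->
  pred_skel skZ n = v @` pred_skel skX n `|` w @` pred_skel skY n.
Proof. by move=> skE; case: n => [|n] /=; rewrite ?skE// !image_set0 setU0. Qed.

Section CWAdjunction.
Variables (R : realType) (A B C D : topologicalType).
Variables (f : A -> B) (u : A -> C) (v : B -> D) (w : C -> D).
Variables (skA : nat -> set A) (skB : nat -> set B) (skC : nat -> set C).
Variable skD : nat -> set D.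
Variables (cB : forall n, set (disk R n -> B)) (cC : forall n, set (disk R n -> C)).
Arguments cB : clear implicits.
Arguments cC : clear implicits.
Hypotheses (adj : adjunction f u v w) (cwB : cw skB cB) (cwC : cw skC cC).
Hypothesis fcell : cellwise cB (range f).
Hypothesis fsk : forall n, skA n = f @^-1` skB n.
Hypothesis usk : forall n a, skA n a -> skC n (u a).
Hypothesis skDE : forall n, skD n = v @` skB n `|` w @` skC n.

Definition adj_cell n : set (disk R n -> D) :=
  [set w \o g | g in cC n] `|`
  [set v \o g | g in [set g | cB n g /\
    forall y, ~ sphere R n (\val y) -> ~ range f (g y)]].

Let pskDE n : pred_skel skD n = v @` pred_skel skB n `|` w @` pred_skel skC n.
Proof. exact: pred_skelU. Qed.

Let pskA n a : pred_skel skB n (f a) -> pred_skel skC n (u a).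
Proof.
by case: n => [//|n] /= skfa; apply: usk; rewrite fsk.
Qed.

Let skA' n a : skB n (f a) -> skC n (u a).
Proof. by move=> skfa; apply: usk; rewrite fsk. Qed.

Lemma adj_memv (S : set B) (T : set C) b : ~ range f b ->
  (v @` S `|` w @` T) (v b) -> S b.
Proof.
move=> nfb [[b' Sb' e]|[c _ /esym e]].
  have [<- //|[a [a' [_ fa' _]]]] := adj_injv adj e.
  by case: nfb; exists a'.
by have [a fa _] := adj_vw adj e; case: nfb; exists a.
Qed.

Lemma adj_memw (S : set B) (T : set C) c :
  (forall a, S (f a) -> T (u a)) ->
  (v @` S `|` w @` T) (w c) -> T c.
Proof.
move=> fST [[b Sb e]|[c' Tc' /(adj_injw adj) <-//]].
by have [a fa <-] := adj_vw adj e; apply: fST; rewrite fa.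
Qed.

(** The cells of [B] in [A] disappear: through [u] they are mapped to the
    skeleton of the same dimension of [C]. For the topology, a closed subset
    [K] of the [n]-skeleton is first pulled back to [C]. This settles the part
    in [A] of its inverse image in [B], because [f] is a closed embedding, and
    the rest only concerns cells outside [A]. *)
Lemma cw_adj : cw skD adj_cell.
Proof.
split.
- move=> n; rewrite !skDE => d [[b skb <-]|[c skc <-]]; [left|right].
    by exists b => //; exact: (cw_skelS cwB).
  by exists c => //; exact: (cw_skelS cwC).
- move=> d; have [[b <-]|[c <-]] := adj_surj adj d.
    have [n skb] := cw_skelT cwB b; exists n; rewrite skDE; left.
    by exists b.
  have [n skc] := cw_skelT cwC c; exists n; rewrite skDE; right.
  by exists c.
- move=> n _ [[g cg <-]|[g [cg _] <-]].
    exact: cts_comp (adj_w adj) (cw_cts cwC cg).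
  exact: cts_comp (adj_v adj) (cw_cts cwB cg).
- move=> n _ y [[g cg <-]|[g [cg _] <-]] Sy; rewrite pskDE.
    by right; exists (g y) => //; exact: (cw_sphere cwC cg).
  by left; exists (g y) => //; exact: (cw_sphere cwB cg).
- move=> n _ y [[g cg <-]|[g [cg ng] <-]] nSy; rewrite pskDE skDE.
    have [skg nskg] := cw_int cwC cg nSy; split; first by right; exists (g y).
    by move=> /(adj_memw (@pskA n)).
  have [skg nskg] := cw_int cwB cg nSy; split; first by left; exists (g y).
  by move=> /(adj_memv (ng _ nSy)).
- move=> n _ _ y z [[g cg <-]|[g [cg ng] <-]] [[h ch <-]|[h [ch nh] <-]] nSy nSz e.
  + by have [-> ->] := cw_inj cwC cg ch nSy nSz (adj_injw adj e).
  + by have [a fa _] := adj_vw adj (esym e); case: (nh z nSz); exists a.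
  + by have [a fa _] := adj_vw adj e; case: (ng y nSy); exists a.
  + have [e'|[a [_ [fa _ _]]]] := adj_injv adj e; last first.
      by case: (ng y nSy); exists a.
    by have [-> ->] := cw_inj cwB cg ch nSy nSz e'.
- move=> n d; rewrite skDE pskDE => skd nskd.
  have hC c : skC n c -> w c = d -> exists g y,
      [/\ adj_cell g, ~ sphere R n (\val y) & g y = d].
    move=> skc cd; have [|g [y [cg nSy gy]]] := cw_surj cwC skc.
      by move=> pc; apply: nskd; right; exists c.
    by exists (w \o g), y; split=> //=; [left; exists g|rewrite gy].
  case: skd => -[x skx xd]; last exact: hC xd.
  have [[a _ fa]|nfx] := pselect (range f x).
    apply: (hC (u a)); last by rewrite -(adj_comm adj) fa.
    by apply: skA'; rewrite fa.
  have [|g [y [cg nSy gy]]] := cw_surj cwB skx.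
    by move=> px; apply: nskd; left; exists x.
  exists (v \o g), y; split=> //=; last by rewrite gy.
  right; exists g => //; split=> // z nSz fgz; apply: nfx; rewrite -gy.
  exact: fcell cg nSz nSy fgz.
- move=> n K Ksk cKp cK.
  have wKsk : w @^-1` K `<=` skC n.
    by move=> c /Ksk; rewrite /= skDE; apply: adj_memw; exact: skA'.
  have cwK : closed (w @^-1` K).
    apply: (cw_attach cwC wKsk) => [|g cg]; last first.
      by apply: (cK (w \o g)); left; exists g.
    have -> : w @^-1` K `&` pred_skel skC n =
        w @^-1` (K `&` pred_skel skD n) `&` pred_skel skC n.
      apply/seteqP; split=> c [Kc pc]; last by split=> //; case: Kc.
      by split=> //; split=> //; rewrite pskDE; right; exists c.
    apply: closedI; first exact: cts_closed (adj_w adj) cKp.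
    exact: pred_skel_closed cwC _.
  have cfK : closed (f @` (u @^-1` (w @^-1` K))).
    apply: closed_embedding_image; first exact: adj_emb adj.
    exact: cts_closed (adj_u adj) cwK.
  have fK b : range f b -> K (v b) -> (f @` (u @^-1` (w @^-1` K))) b.
    by move=> [a _ <-] Ka; exists a => //=; rewrite -(adj_comm adj).
  have Kf b : (f @` (u @^-1` (w @^-1` K))) b -> K (v b).
    by move=> [a /= Ka <-]; rewrite (adj_comm adj).
  apply: (adj_closed adj) => //.
  have -> : v @^-1` K = (v @^-1` K `&` skB n) `|` f @` (u @^-1` (w @^-1` K)).
    apply/seteqP; split=> [b Kb|b [[]//|/Kf//]].
    have [fb|nfb] := pselect (range f b); first by right; exact: fK.
    by left; split=> //; have := Ksk _ Kb; rewrite skDE => /(adj_memv nfb).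
  apply: closedU => //; apply: (cw_attach cwB (n := n)) => [b []//| |g cg].
    have -> : v @^-1` K `&` skB n `&` pred_skel skB n =
        v @^-1` (K `&` pred_skel skD n) `&` pred_skel skB n.
      apply/seteqP; split=> b [Kb pb]; split=> //; last first.
        by split; [case: Kb|exact: (pred_skel_sub cwB)].
      by case: Kb => Kb _; split=> //; rewrite pskDE; left; exists b.
    apply: closedI; first exact: cts_closed (adj_v adj) cKp.
    exact: pred_skel_closed cwB _.
  have cgc := cw_cts cwB cg.
  have -> : g @^-1` (v @^-1` K `&` skB n) = (v \o g) @^-1` K.
    apply/seteqP; split=> [y []//|y Ky]; split=> //; exact: (cell_skel cwB).
  have [[y0 nSy0 fy0]|nf] := pselect
      (exists2 y, ~ sphere R n (\val y) & range f (g y)); last first.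
    apply: cK; right; exists g => //; split=> // y nSy fy; apply: nf.
    by exists y.
  (* The open cell lies in [A], and its boundary in the previous skeleton. *)
  have -> : (v \o g) @^-1` K = g @^-1` (v @^-1` (K `&` pred_skel skD n) `&`
      pred_skel skB n) `|` g @^-1` (f @` (u @^-1` (w @^-1` K))).
    apply/seteqP; split=> [y Ky|y [[[]]//|/Kf//]].
    have [Sy|nSy] := pselect (sphere R n (\val y)).
      have py := cw_sphere cwB cg Sy.
      left; split=> //; split=> //; rewrite pskDE.
      by left; exists (g y).
    by right; apply: fK => //; exact: fcell cg nSy0 nSy fy0.
  apply: closedU; last exact: cts_closed cgc cfK.
  apply: cts_closed cgc _; apply: closedI.
    exact: cts_closed (adj_v adj) cKp.
  exact: pred_skel_closed cwB _.
- move=> K cK.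
  have vn n : v @^-1` K `&` skB n = v @^-1` (K `&` skD n) `&` skB n.
    apply/seteqP; split=> b [Kb skb]; split=> //; last by case: Kb.
    by split=> //; rewrite skDE; left; exists b.
  have wn n : w @^-1` K `&` skC n = w @^-1` (K `&` skD n) `&` skC n.
    apply/seteqP; split=> c [Kc skc]; split=> //; last by case: Kc.
    by split=> //; rewrite skDE; right; exists c.
  apply: (adj_closed adj).
    apply: (cw_weak cwB) => n; rewrite vn; apply: closedI.
      exact: cts_closed (adj_v adj) (cK n).
    exact: skel_closed cwB _.
  apply: (cw_weak cwC) => n; rewrite wn; apply: closedI.
    exact: cts_closed (adj_w adj) (cK n).
  exact: skel_closed cwC _.
Qed.

End CWAdjunction.

Record coproduct (I : Type) (X : I -> topologicalType) (Y : topologicalType)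
    (e : forall i, X i -> Y) : Prop := Coproduct {
  cop_final : final e;
  cop_inj : forall i, injective (e i);
  cop_index : forall i j x y, e i x = e j y -> i = j }.

Section Coproduct.
Variables (I : Type) (X : I -> topologicalType) (Y : topologicalType).
Variable e : forall i, X i -> Y.
Arguments e : clear implicits.
Hypothesis cope : coproduct e.

Lemma cop_eq (P : forall i, X i -> Prop) i j (x : X i) (y : X j) :
  e i x = e j y -> P i x -> P j y.
Proof.
move=> exy; have ij := cop_index cope exy; subst j.
by rewrite (cop_inj cope exy).
Qed.

Variables (R : realType) (sk : forall i, nat -> set (X i)) (skY : nat -> set Y).
Variable cell : forall i n, set (disk R n -> X i).
Arguments sk : clear implicits.
Arguments cell : clear implicits.
Hypothesis cwX : forall i, cw (sk i) (cell i).
Hypothesis skYE : forall n y, skY n y <-> exists i x, sk i n x /\ e i x = y.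

Definition cop_cell n : set (disk R n -> Y) :=
  [set g | exists i f, cell i n f /\ g = e i \o f].

Let pskYE n y : pred_skel skY n y <->
  exists i x, pred_skel (sk i) n x /\ e i x = y.
Proof. by case: n => [|n] /=; [split=> // -[i [x []]]|exact: skYE]. Qed.

Let skY_e n i x : skY n (e i x) <-> sk i n x.
Proof.
rewrite skYE; split=> [[j [y [skjy yx]]]|]; last by exists i, x.
exact: (cop_eq (P := fun i => sk i n) yx).
Qed.

Let pskY_e n i x : pred_skel skY n (e i x) <-> pred_skel (sk i) n x.
Proof. by case: n => [//|n]; exact: skY_e. Qed.

Lemma cw_cop : cw skY cop_cell.
Proof.
have [ce se te] := cop_final cope.
split.
- move=> n y; rewrite !skYE => -[i [x [skx <-]]]; exists i, x; split=> //.
  exact: (cw_skelS (cwX i)).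
- move=> y; have [i [x <-]] := se y; have [n skx] := cw_skelT (cwX i) x.
  by exists n; apply/skY_e.
- move=> n _ [i [f [cf ->]]]; exact: cts_comp (ce i) (cw_cts (cwX i) cf).
- move=> n _ y [i [f [cf ->]]] Sy; apply/pskY_e; exact: (cw_sphere (cwX i) cf).
- move=> n _ y [i [f [cf ->]]] nSy /=; rewrite skY_e pskY_e.
  exact: (cw_int (cwX i) cf).
- move=> n _ _ y z [i [f [cf ->]]] [j [g [cg ->]]] nSy nSz /= fg.
  have ij := cop_index cope fg; subst j.
  by have [-> ->] := cw_inj (cwX i) cf cg nSy nSz (cop_inj cope fg).
- move=> n y; have [i [x <-]] := se y; rewrite skY_e pskY_e => skx npx.
  have [f [y' [cf nSy fy]]] := cw_surj (cwX i) skx npx.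
  by exists (e i \o f), y'; split=> //=; [exists i, f|rewrite fy].
- move=> n K Ksk cKp cK; apply: te => i; apply: (cw_attach (cwX i) (n := n)).
  + by move=> x /Ksk; rewrite skY_e.
  + have -> : e i @^-1` K `&` pred_skel (sk i) n = e i @^-1` (K `&` pred_skel skY n).
      by apply/seteqP; split=> x [Kx px]; split=> //; apply/pskY_e.
    exact: cts_closed (ce i) cKp.
  + by move=> f cf; apply: (cK (e i \o f)); exists i, f.
- move=> K cK; apply: te => i; apply: (cw_weak (cwX i)) => n.
  have -> : e i @^-1` K `&` sk i n = e i @^-1` (K `&` skY n).
    by apply/seteqP; split=> x [Kx px]; split=> //; apply/skY_e.
  exact: cts_closed (ce i) (cK n).
Qed.

(** The pieces being open, an open subset of the subspace extends piece by piece
    to an open subset of [Y]. *)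
Lemma cop_sub (S : set Y) :
  @coproduct I (fun i => set_type (e i @^-1` S)) S
    (fun i x => SigSub (mem_set (set_mem (valP x) : S (e i (\val x))))).
Proof.
have [ce se te] := cop_final cope.
split.
- split=> [i|y|K cK].
  + by apply: (cts_restrict (f := e i)) => //; exact: ce.
  + have [i [x xy]] := se (\val y).
    have Sx : x \in e i @^-1` S by rewrite inE /= xy; exact: (set_mem (valP y)).
    by exists i, (SigSub Sx); apply: val_inj.
  + rewrite -[K]setCK closedC.
    pose es i (x : set_type (e i @^-1` S)) : S :=
      SigSub (mem_set (set_mem (valP x) : S (e i (\val x)))).
    have oU i : exists V : set (X i), open V /\
        forall x, V (\val x) <-> ~ K (es i x).
      have /closed_openC[V oV VK] := cK i; exists V; split=> // x.
      by have := congr1 (@^~ x) VK => /= <-.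
    pose V i := sval (cid (oU i)).
    have oV i : open (V i) by rewrite /V; case: cid => ? [].
    have VK i x : V i (\val x) <-> ~ K (es i x).
      by rewrite /V; case: cid => ? [].
    pose O : set Y := [set y | exists i x, V i x /\ e i x = y].
    have OE i : e i @^-1` O = V i.
      apply/seteqP; split=> [x [j [y [Vy yx]]]|x Vx]; last by exists i, x.
      exact: (cop_eq (P := V) yx).
    have cO : closed (~` O).
      apply: te => i; suff -> : e i @^-1` (~` O) = ~` V i by rewrite closedC.
      by rewrite -(OE i).
    exists O; first by move: cO; rewrite closedC.
    have esE (y : S) i x : e i x = \val y -> exists x', \val x' = x /\ es i x' = y.
      move=> xy; have Sx : x \in e i @^-1` S.
        by rewrite inE /= xy; exact: (set_mem (valP y)).
      by exists (SigSub Sx); split=> //; apply: val_inj.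
    apply/seteqP; split=> y.
      move=> [i [x [Vx /esE[x' [x'x <-]]]]].
      by apply/VK; rewrite x'x.
    move=> nKy; have [i [x xy]] := se (\val y); exists i, x; split=> //.
    by have [x' [<- x'y]] := esE _ _ _ xy; apply/VK; rewrite x'y.
- by move=> i x y /(congr1 \val) /= /(cop_inj cope) xy; apply: val_inj.
- by move=> i j x y xy; exact: (cop_index cope (congr1 \val xy)).
Qed.

End Coproduct.

(** * Cells and induced spaces as coproducts *)

Section CoproductExamples.

Lemma coproduct_sigT (I : choiceType) (X : I -> topologicalType) :
  @coproduct I X {i & X i} (existT X).
Proof.
split.
- split=> [i|[i x]|K cK]; [exact: existT_continuous|by exists i, x|].
  rewrite -openC; apply/sigT_openP => i.
  by rewrite -closedC -preimage_setC setCK.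
- by move=> i x y /eqP; rewrite eq_Tagged => /eqP.
- by move=> i j x y /(congr1 (@projT1 _ _)).
Qed.

Lemma coproduct_comp (I : Type) (J : I -> Type) (X : forall i, J i -> topologicalType)
    (Y : I -> topologicalType) (Z : topologicalType)
    (e : forall i, Y i -> Z) (d : forall i j, X i j -> Y i) :
  coproduct e -> (forall i, coproduct (d i)) ->
  @coproduct {i & J i} (fun k => X (projT1 k) (projT2 k)) Z
    (fun k x => e (projT1 k) (d (projT1 k) (projT2 k) x)).
Proof.
move=> [[ce se te] je ie] cd; split.
- split=> [[i j]|z|K cK] /=.
  + by have [[cdi _ _] _ _] := cd i; exact: cts_comp (ce i) (cdi j).
  + have [i [y <-]] := se z; have [[_ sd _] _ _] := cd i.
    by have [j [x <-]] := sd y; exists (existT _ i j), x.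
  + apply: te => i; have [[_ _ td] _ _] := cd i; apply: td => j.
    exact: cK (existT _ i j).
- move=> [i j] x y /= /je; have [_ jd _] := cd i; exact: jd.
- move=> [i j] [i' j'] /= x y exy; have ii' := ie _ _ _ _ exy; subst i'.
  have [_ _ id] := cd i; congr existT.
  exact: id (je _ _ _ exy).
Qed.

Lemma coproduct_discrete (J : choiceType) (X : topologicalType) :
  @coproduct J (fun _ => X) (discrete_topology J * X)%type (fun j x => (j, x)).
Proof.
split.
- split=> [j|[j x]|K cK]; [|by exists j, x|].
    by apply: cts_pair; [exact: cts_cst|exact: cts_id].
  rewrite -openC openE => -[j x] nKjx.
  exists ([set j], [set y | ~ K (j, y)]); last by move=> [i y] [/= -> ].
  split; first exact: discrete_set1.
  by apply: open_nbhs_nbhs; split=> //; exact: closed_openC (cK j).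
- by move=> j x y [].
- by move=> i j x y [].
Qed.

End CoproductExamples.

Lemma coproduct_embedding (I : Type) (X X' : I -> topologicalType)
    (Y Y' : topologicalType) (e : forall i, X i -> Y) (e' : forall i, X' i -> Y')
    (f : forall i, X i -> X' i) (F : Y -> Y') :
  coproduct e -> coproduct e' -> (forall i, closed_embedding (f i)) ->
  (forall i x, F (e i x) = e' i (f i x)) -> closed_embedding F.
Proof.
move=> cope cope' ef Fe; have [ce se te] := cop_final cope.
have [ce' se' te'] := cop_final cope'.
split.
- apply: (final_cts (cop_final cope)) => i.
  under eq_fun do rewrite Fe.
  by apply: cts_comp (ce' i) _; have [] := ef i.
- move=> y z; have [i [x <-]] := se y; have [j [x' <-]] := se z.
  rewrite !Fe => exx'; have ij := cop_index cope' exx'; subst j.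
  by have [_ jf _ _] := ef i; rewrite (jf _ _ (cop_inj cope' exx')).
- move=> U oU.
  have oV i : exists V : set (X' i), open V /\ f i @^-1` V = e i @^-1` U.
    have [_ _ + _] := ef i => /(_ _ (cts_open (ce i) oU))[V oV VU].
    by exists V.
  pose V i := sval (cid (oV i)).
  have oVi i : open (V i) by rewrite /V; case: cid => ? [].
  have VU i : f i @^-1` V i = e i @^-1` U by rewrite /V; case: cid => ? [].
  pose O : set Y' := [set y | exists i x, V i x /\ e' i x = y].
  have OE i : e' i @^-1` O = V i.
    apply/seteqP; split=> [x [j [y [Vy yx]]]|x Vx]; last by exists i, x.
    exact: (cop_eq cope' (P := V) yx).
  exists O.
    have : closed (~` O); last by rewrite closedC.
    apply: te' => i; suff -> : e' i @^-1` (~` O) = ~` V i by rewrite closedC.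
    by rewrite -(OE i).
  have OU i x : O (F (e i x)) <-> U (e i x).
    rewrite Fe; have := congr1 (@^~ (f i x)) (OE i) => /= ->.
    by have := congr1 (@^~ x) (VU i) => /= ->.
  by apply/seteqP; split=> y; have [i [x <-]] := se y => /OU.
- apply: te' => i; have -> : e' i @^-1` range F = range (f i).
    apply/seteqP; split=> [x [y _]|_ [x _ <-]].
      have [j [z <-]] := se y; rewrite Fe => ex.
      apply: (cop_eq cope' (P := fun i => range (f i)) ex).
      by exists z.
    by exists (e i x) => //; exact: Fe.
  by have [] := ef i.
Qed.

Section GroupPieces.
Variable G : groupType.
Local Open Scope quotient_scope.
Local Open Scope group_scope.

Definition cells_piece (I : choiceType) (H : I -> subgroup G)
    (A : topologicalType) (k : {i : I & coset (H i)}) (a : A) : gcells H A :=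
  existT (fun i => gsp (coset_times (H i) A)) (projT1 k) (projT2 k, a).

Lemma cells_coproduct (I : choiceType) (H : I -> subgroup G)
    (A : topologicalType) : coproduct (@cells_piece I H A).
Proof.
exact: (coproduct_comp (coproduct_sigT _)
  (fun i => coproduct_discrete (coset (H i)) A)).
Qed.

Lemma coset_reprP (H : subgroup G) (c : coset H) g :
  \pi_(coset H) g = c <-> exists2 h, sg_set H h & repr c = g * h.
Proof.
split=> [<-|[h Hh ce]].
  have /esym/eqmodP/asboolP := reprK (\pi_(coset H) g); move=> h.
  by eexists; [exact: h|rewrite mulVKg].
rewrite -[c]reprK ce; apply/eqmodP/asboolP.
by rewrite mulKg.
Qed.

Definition induce_piece (N : subgroup G) (X : gspace (sg_type N)) (c : coset N)
    (x : X) : ginduce X := ind_pi (repr c) x.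

Lemma induce_coproduct (N : subgroup G) (X : gspace (sg_type N)) :
  coproduct (@induce_piece N X).
Proof.
have cpi g : continuous (fun x : X => ind_pi g x : ginduce X).
  have cg : continuous (fun x : X => (g : discrete_topology G, x)).
    by apply: cts_pair; [exact: cts_cst|exact: cts_id].
  by apply: (cts_comp _ cg) => x; exact: pi_continuous.
split.
- split=> [c|z|K cK]; first exact: cpi.
    elim/ind_piW: z => g x; pose c := \pi_(coset N) g.
    have [h Nh ce] := (coset_reprP c g).1 erefl.
    pose n : sg_type N := SigSub (mem_set Nh).
    exists c, (act n^-1 x); apply/ind_piP; exists n; split=> //.
    by rewrite -actM mulgV act1.
  rewrite -openC; change (open (\pi_(ind_type X) @^-1` (~` K))).
  rewrite -[_ @^-1` _]setCK openC.
  have [_ _ tG] := cop_final (coproduct_discrete G X); apply: tG => g.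
  pose c := \pi_(coset N) g.
  have [h Nh ce] := (coset_reprP c g).1 erefl.
  pose n : sg_type N := SigSub (mem_set Nh).
  have -> : (fun x : X => (g : discrete_topology G, x)) @^-1`
      (~` (\pi_(ind_type X) @^-1` (~` K))) = act n^-1 @^-1` (induce_piece c @^-1` K).
    have e x : induce_piece c (act n^-1 x) = ind_pi g x.
      apply/ind_piP; exists n; split=> //.
      by rewrite -actM mulgV act1.
    apply/seteqP; split=> x /=; rewrite e.
      by move=> /contrapT.
    by move=> Kx; apply.
  by apply: cts_closed (cK c); exact: act_continuous.
- move=> c x y /ind_piP[n [cn ->]].
  have -> : n = 1 by apply: val_inj; apply: (mulgI (repr c)); rewrite -cn mulg1.
  by rewrite act1.
- move=> c c' x y /ind_piP[n [cn _]].
  rewrite -[c]reprK; apply/coset_reprP.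
  exists (\val n^-1); first exact: (set_mem (valP n^-1)).
  by rewrite cn /= mulgK.
Qed.

Variable M : set (subgroup G).
Let fam : Type := forall F : M, fgspace (sg_type (normalizer (sval F))).

Definition norm_piece (X : fam) (k : {F : M & coset (normalizer (sval F))})
    (x : X (projT1 k)) : norm_coprod X :=
  existT (fun F : M => gsp (ginduce (X F))) (projT1 k) (ind_pi (repr (projT2 k)) x).

Lemma norm_coproduct (X : fam) : coproduct (@norm_piece X).
Proof.
exact: (coproduct_comp (coproduct_sigT _)
  (fun F : M => induce_coproduct (X F))).
Qed.

Lemma ginduce_map_pi (N : subgroup G) (X Y : gspace (sg_type N)) (f : X -> Y) g x :
  is_gmap f -> ginduce_map f (ind_pi g x : ginduce X) = ind_pi g (f x).
Proof.
move=> [_ fe]; rewrite /ginduce_map.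
have : ind_pi (repr (ind_pi g x)).1 (repr (ind_pi g x)).2 = ind_pi g x.
  by rewrite /ind_pi -surjective_pairing reprK.
by move=> /ind_piP[n [e1 e2]]; apply/ind_piP; exists n; rewrite -fe -e2.
Qed.

Lemma norm_coprod_map_piece (X Y : fam) (f : forall F : M, X F -> Y F) k x :
  (forall F, is_gmap (f F)) ->
  norm_coprod_map f (@norm_piece X k x) = @norm_piece Y k (f (projT1 k) x).
Proof.
move=> gf; rewrite /norm_coprod_map /gcoprod_map /norm_piece /=; congr existT.
exact: ginduce_map_pi.
Qed.

Lemma norm_coprod_skel (X : fam) n y : skel (norm_coprod X) n y <->
  exists k x, skel (X (projT1 k)) n x /\ @norm_piece X k x = y.
Proof.
split=> [|[k [x [skx <-]]]]; last by exists (repr (projT2 k)), x.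
case: y => F z [/= g [x [skx ->]]]; pose c := \pi_(coset (normalizer (sval F))) g.
have [h Nh ce] := (coset_reprP c g).1 erefl.
pose m : sg_type (normalizer (sval F)) := SigSub (mem_set Nh).
exists (existT _ F c), (act m^-1 x); split; first exact: skel_act.
congr existT; apply/ind_piP; exists m; split=> //.
by rewrite -actM mulgV act1.
Qed.

End GroupPieces.

(** * Pushouts of spaces with a group action *)

(** Two test spaces for the universal property of a pushout. In an indiscrete
    space only the underlying set matters; the other one is [D] with the final
    topology for two maps to it. *)
Definition indiscrete (T : choiceType) : topologicalType :=
  initial_topology (fun _ : T => tt : discrete_topology unit).

Lemma indiscrete_cts (S : topologicalType) (T : choiceType)
  (f : S -> indiscrete T) : continuous f.
Proof.
apply/continuousP => _ [U oU <-].
exact: (cts_open (@cts_cst S (discrete_topology unit) tt) oU).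
Qed.

Definition final_topology (B C D : Type) (v : B -> D) (w : C -> D) : Type := D.

Section FinalTopology.
Variables (B C : topologicalType) (D : choiceType) (v : B -> D) (w : C -> D).

Definition final_open : set (set (final_topology v w)) :=
  [set U | open (v @^-1` U) /\ open (w @^-1` U)].

Lemma final_openT : final_open setT.
Proof. by split; exact: openT. Qed.

Lemma final_openI : setI_closed final_open.
Proof.
by move=> U V [vU wU] [vV wV]; split; rewrite preimage_setI; exact: openI.
Qed.

Lemma final_open_bigU (I : Type) (U : I -> set (final_topology v w)) :
  (forall i, final_open (U i)) -> final_open (\bigcup_i U i).
Proof.
move=> oU; split; rewrite preimage_bigcup; apply: bigcup_open => i _;
by have [] := oU i.
Qed.

HB.instance Definition _ := Choice.on (final_topology v w).
HB.instance Definition _ := isOpenTopological.Build (final_topology v w)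
  final_openT final_openI final_open_bigU.

End FinalTopology.

Section Pushout.
Variable G : groupType.
Local Open Scope group_scope.

Lemma gpushout_sym (A B C D : gspace G) (f : A -> B) (u : A -> C) (v : B -> D)
    (w : C -> D) : is_gpushout f u v w -> is_gpushout u f w v.
Proof.
move=> [[gf gu gv gw e] univ]; split=> // Z b c gb gc bc.
have [d [[gd dv dw] du]] := univ Z c b gc gb (esym bc).
by exists d; split=> // d' [gd' dw' dv']; exact: du.
Qed.

Section Concrete.
Variables (A B C D : gspace G) (f : A -> B) (u : A -> C) (v : B -> D) (w : C -> D).

Lemma gpushout_surj : is_gpushout f u v w ->
  forall d, (exists b, v b = d) \/ (exists c, w c = d).
Proof.
move=> [[gf gu [_ gv] [_ gw] _] univ] d.
pose Z : gspace G := @GSpace G (indiscrete bool) (fun _ x => x)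
  (fun _ => @indiscrete_cts _ _ _) (fun _ => erefl) (fun _ _ _ => erefl).
pose im (d : D) := (exists b, v b = d) \/ (exists c, w c = d).
have imact g x : im (act g x) <-> im x.
  suff h g' y : im y -> im (act g' y).
    split; last exact: h.
    by move=> /(h g^-1); rewrite -actM mulVg act1.
  by case=> -[z <-]; [left|right]; exists (act g' z); rewrite ?gv ?gw.
have [|||d0 [_ du]] := univ Z (fun _ => true) (fun _ => true).
- by split=> //; exact: indiscrete_cts.
- by split=> //; exact: indiscrete_cts.
- by [].
have e1 : d0 = fun _ => true.
  by apply: du; split=> //; split=> //; exact: indiscrete_cts.
have e2 : d0 = fun x => `[< im x >].
  apply: du; split; first split; first exact: indiscrete_cts.
  - by move=> g x; apply/asbool_equiv_eq/imact.
  - by apply/funext => b; apply/asboolP; left; exists b.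
  - by apply/funext => c; apply/asboolP; right; exists c.
have : `[< im d >] by rewrite -[`[< _ >]]/((fun x => `[< im x >]) d) -e2 e1.
by move/asboolP.
Qed.

Lemma gpushout_final : is_gpushout f u v w ->
  forall U, open (v @^-1` U) -> open (w @^-1` U) -> open U.
Proof.
move=> po; have surj := gpushout_surj po.
have [[gf gu [cv gv] [cw_ gw] e] univ] := po => U ovU owU.
have cact g : continuous (act g : final_topology v w -> final_topology v w).
  apply/continuousP => V [oV1 oV2]; split.
    have -> : v @^-1` (act g @^-1` V) = act g @^-1` (v @^-1` V).
      by apply/seteqP; split=> x /=; rewrite gv.
    by apply: cts_open oV1; exact: act_continuous.
  have -> : w @^-1` (act g @^-1` V) = act g @^-1` (w @^-1` V).
    by apply/seteqP; split=> x /=; rewrite gw.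
  by apply: cts_open oV2; exact: act_continuous.
pose Z : gspace G := @GSpace G (final_topology v w) (fun g x => act g x)
  cact (@act1 G D) (@actM G D).
have [||//|d [[[cd gd] dv dw] _]] := univ Z v w.
- by split=> //; apply/continuousP => V [].
- by split=> //; apply/continuousP => V [].
have d_id : d = id.
  apply/funext => x; case: (surj x) => -[y <-].
    exact: (congr1 (@^~ y) dv).
  exact: (congr1 (@^~ y) dw).
have oU : open (U : set Z) by split.
by have := cts_open cd oU; rewrite d_id.
Qed.

Lemma gpushout_rel : is_gpushout f u v w -> injective f ->
  exists b : B -> C + B, [/\ forall x y, v x = v y -> b x = b y,
    forall x c, v x = w c -> b x = inl c,
    forall a, b (f a) = inl (u a),
    forall x, ~ range f x -> b x = inr x & injective w].
Proof.
move=> [[[_ gf] [_ gu] [_ gv] [_ gw] e] univ] jf.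
pose a g (x : C + B) : C + B :=
  match x with inl c => inl (act g c) | inr b => inr (act g b) end.
pose Z : gspace G := @GSpace G (indiscrete (C + B)%type) a
  (fun _ => @indiscrete_cts _ _ _)
  ltac:(by case=> x /=; rewrite act1)
  ltac:(by move=> g h [] x /=; rewrite actM).
pose b (x : B) : C + B :=
  if pselect (exists y, f y = x) is left e then inl (u (sval (cid e)))
  else inr x.
have bf y : b (f y) = inl (u y).
  rewrite /b; case: pselect => [e'|[]]; last by exists y.
  by congr (inl (u _)); apply: jf; case: (cid e').
have bn x : ~ range f x -> b x = inr x.
  move=> nx; rewrite /b; case: pselect => // -[y yx]; case: nx.
  by exists y.
have [|||d [[_ dv dw] _]] := univ Z b inl.
- split=> [|g x]; first exact: indiscrete_cts.
  have [[y _ <-]|nx] := pselect (range f x); first by rewrite -gf !bf gu.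
  rewrite !bn// => -[y _ yx]; apply: nx.
  by exists (act g^-1 y) => //; rewrite gf yx -actM mulVg act1.
- by split=> //; exact: indiscrete_cts.
- by apply/funext => y /=; rewrite bf.
have dv' x : d (v x) = b x by rewrite -dv.
have dw' c : d (w c) = inl c by rewrite -[RHS](congr1 (@^~ c) dw).
exists b; split=> //.
- by move=> x y vxy; rewrite -!dv' vxy.
- by move=> x c vxc; rewrite -dv' vxc dw'.
- by move=> c c' /(congr1 d); rewrite !dw' => -[].
Qed.

(** The universal property is applied to equivariant maps only, so the topology
    of [D] has to be tested on all of its subsets at once: this is done by the
    final topology, which inherits the action. The underlying set is found by
    mapping to an indiscrete space with the expected points. *)
Lemma gpushout_adjunction : closed_embedding f -> is_gpushout f u v w ->
  adjunction f u v w.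
Proof.
move=> ef po; have [_ jf _ _] := ef.
have [[gf [cu gu] [cv gv] [cw_ gw] e] univ] := po.
have [b [bv bw bf bn jw]] := gpushout_rel po jf.
have jB x y : b x = b y ->
    x = y \/ exists a a', [/\ f a = x, f a' = y & u a = u a'].
  have [[a _ <-]|nx] := pselect (range f x);
  have [[a' _ <-]|ny] := pselect (range f y).
  - by rewrite !bf => -[uaa]; right; exists a, a'.
  - by rewrite bf (bn _ ny).
  - by rewrite bf (bn _ nx).
  - by rewrite !bn// => -[->]; left.
split=> //.
- by move=> a; exact: (congr1 (@^~ a) e).
- move=> x c /bw; have [[a _ <-]|nx] := pselect (range f x).
    by rewrite bf => -[uac]; exists a.
  by rewrite bn.
- by move=> x y /bv; exact: jB.
- exact: gpushout_surj po.
- move=> K cvK cwK; rewrite -openC; apply: (gpushout_final po).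
    by rewrite preimage_setC openC.
  by rewrite preimage_setC openC.
Qed.

Lemma adjunction_gpushout (R : realType) : is_gmap f -> is_gmap u -> is_gmap v ->
  is_gmap w -> adjunction f u v w -> is_gpushout f u v w.
Proof.
move=> gf gu gv gw adj; split.
  by split=> //; apply/funext => a; exact: (adj_comm adj).
move=> Z b c [cb gb] [cc gc] bc.
have bc' t a : (fun p : R * B => b p.2) (t, f a) = (fun p : R * C => c p.2) (t, u a).
  exact: (congr1 (@^~ a) bc).
have cb' : continuous (fun p : R * B => b p.2).
  by apply: cts_comp cb _; apply: cts_snd; exact: cts_id.
have cc' : continuous (fun p : R * C => c p.2).
  by apply: cts_comp cc _; apply: cts_snd; exact: cts_id.
have [F [cF Fv Fw]] := adj_homotopy adj cb' cc' bc'.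
exists (fun x => F (0, x)); split.
  split; last by apply/funext => x; rewrite /= Fw.
    split=> [|g x].
      by apply: cts_comp cF _; apply: cts_pair; [exact: cts_cst|exact: cts_id].
    have [_ gv'] := gv; have [_ gw'] := gw.
    case: (adj_surj adj x) => -[y <-].
      by rewrite -gv' !Fv /= gb.
    by rewrite -gw' !Fw /= gc.
  by apply/funext => x; rewrite /= Fv.
move=> d [_ dv dw]; apply/funext => x; case: (adj_surj adj x) => -[y <-].
  by rewrite Fv -dv.
by rewrite Fw -dw.
Qed.

End Concrete.

End Pushout.

(** * Equivariant CW-structures *)

Lemma adj_closed_map (A B C D : topologicalType) (f : A -> B) (u : A -> C)
    (v : B -> D) (w : C -> D) (K : set C) :
  adjunction f u v w -> closed K -> closed (w @` K).
Proof.
move=> adj cK; apply: (adj_closed adj).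
  have -> : v @^-1` (w @` K) = f @` (u @^-1` K).
    apply/seteqP; split=> [b [c Kc /esym/(adj_vw adj)[a <- uac]]|_ [a Ka <-]].
      by exists a => //=; rewrite uac.
    by exists (u a) => //; rewrite (adj_comm adj).
  apply: closed_embedding_image; first exact: adj_emb adj.
  exact: cts_closed (adj_u adj) cK.
have -> // : w @^-1` (w @` K) = K.
apply/seteqP; split=> [c [c' Kc' /(adj_injw adj) <-]//|c Kc].
by exists c.
Qed.

Section GCW.
Variables (R : realType) (G : groupType) (X : fgspace G).
Local Open Scope quotient_scope.

Let sphere_disk n := inclusion (@sphere_sub_disk R n).

Lemma cells_map_embedding n (I : choiceType) (H : I -> subgroup G) :
  closed_embedding (gcells_map (H := H) (@sphere_disk n)).
Proof.
have ei : closed_embedding (@sphere_disk n).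
  split.
  - by apply: (cts_restrict (f := id)) => //; exact: cts_id.
  - by move=> x y /(congr1 \val) /= xy; apply: val_inj.
  - by move=> _ [U oU <-]; exists (\val @^-1` U); first exact: cts_open (@cts_val _ _) oU.
  - have -> : range (@sphere_disk n) = [set y : disk R n | sphere R n (\val y)].
      apply/seteqP; split=> [_ [x _ <-]|y Sy]; first exact: (set_mem (valP x)).
      have Sy' : sphere R n (\val y) by [].
      by exists (SigSub (mem_set Sy')) => //; apply: val_inj.
    exact: closed_sphere.
exact: (coproduct_embedding (cells_coproduct H (sphere R n))
  (cells_coproduct H (disk R n)) (fun _ => ei)).
Qed.

Definition cells_act (cell : forall n, set (disk R n -> X)) :=
  forall n g f, cell n f -> cell n (fun y => act g (f y)).

Lemma skel_incl_gmap n : is_gmap (@skel_incl G X n).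
Proof.
split; last by move=> g x; apply: val_inj.
by apply: (cts_restrict (f := id)) => //; exact: cts_id.
Qed.

Section ToCells.
Hypothesis gcwX : is_gcw R X.

Let cl n (K : set X) := closed ((\val : set_type (skel X n) -> X) @^-1` K).

Let cl_le m n K : (m <= n)%N -> cl n K -> cl m K.
Proof.
move=> mn; suff sub : skel X m `<=` skel X n.
  move=> cK; pose i (x : skel X m) : skel X n := inclusion sub x.
  have ci : continuous i by apply: (cts_restrict (f := id)) => //; exact: cts_id.
  exact: cts_closed ci cK.
move: mn => /subnK <-; elim: (n - m)%N => // k IH x skx.
by rewrite addSn; apply: skelS; exact: IH.
Qed.

Let cl_closed K : (forall n, cl n K) -> closed K.
Proof.
move=> cK; rewrite -openC; have [_ weak _] := gcwX; apply/weak => n.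
by rewrite preimage_setC openC; exact: cK.
Qed.

Let cl_up n K : cl n K -> K `<=` skel X n -> closed K.
Proof.
move=> cK Kn; apply: cl_closed => m.
have [mn|/ltnW nm] := leqP m n; first exact: cl_le cK.
rewrite -(subnK nm); elim: (m - n)%N => // k IH.
have {}Kn : K `<=` skel X (k + n).
  move=> x /Kn; elim: k {IH} => // k IH skx.
  by rewrite addSn; apply: skelS; exact: IH.
rewrite addSn; have [_ _ /(_ (k + n).+1)[I [H [q [Q po]]]]] := gcwX.
have adj := gpushout_adjunction (@cells_map_embedding _ _ H) (gpushout_sym po).
have := adj_closed_map adj IH; congr closed.
apply/seteqP; split=> [_ [x Kx <-]//|x Kx].
by exists (SigSub (mem_set (Kn _ Kx))) => //; apply: val_inj.
Qed.

(** The cells are the translates of the characteristic maps, one for each coset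
    of the isotropy group. The sets closed in one skeleton are seen to be closed
    in the next ones because a pushout along a closed embedding is again a
    closed map. *)
Lemma gcw_cells : exists2 cell, cw (skel X) cell & cells_act cell.
Proof.
have [cover weak att] := gcwX.
have att' n : {I : choiceType & {H : I -> subgroup G &
    {q : gcells H (sphere R n) -> skel_pred_space X n &
    {Q : gcells H (disk R n) -> skel_space X n |
      is_gpushout q (gcells_map (@sphere_disk n)) (@skel_incl G X n) Q}}}}.
  have /cid[I /cid[H /cid[q /cid[Q po]]]] := att n.
  by exists I, H, q, Q.
pose I n := projT1 (att' n); pose H n : I n -> subgroup G := projT1 (projT2 (att' n)).
pose q n : gcells (H n) (sphere R n) -> skel_pred_space X n :=
  projT1 (projT2 (projT2 (att' n))).
pose Q n : gcells (H n) (disk R n) -> skel_space X n :=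
  projT1 (projT2 (projT2 (projT2 (att' n)))).
have po n : is_gpushout (q n) (gcells_map (@sphere_disk n)) (@skel_incl G X n) (Q n).
  exact: projT2 (projT2 (projT2 (projT2 (att' n)))).
have adj n := gpushout_adjunction (@cells_map_embedding _ _ (H n)) (gpushout_sym (po n)).
have copS n := cells_coproduct (H n) (sphere R n).
have copD n := cells_coproduct (H n) (disk R n).
pose chi n (k : {i : I n & coset (H n i)}) (y : disk R n) : X :=
  \val (Q n (cells_piece k y)).
pose cell n : set (disk R n -> X) := range (chi n).
have chiS n k (y : disk R n) : sphere R n (\val y) -> skel_pred X n (chi n k y).
  move=> Sy; rewrite /chi; pose y' : sphere R n := SigSub (mem_set Sy).
  have -> : cells_piece k y = gcells_map (@sphere_disk n) (cells_piece k y').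
    by congr existT; congr (_, _); apply: val_inj.
  by rewrite (adj_comm (adj n)); exact: (set_mem (valP (q n _))).
have chiP n k (y : disk R n) : skel_pred X n (chi n k y) -> sphere R n (\val y).
  move=> py; have : Q n (cells_piece k y) =
      skel_incl (SigSub (mem_set py) : skel_pred_space X n) by apply: val_inj.
  move=> /(adj_vw (adj n))[a ay _]; have [[_ sS _] _ _] := copS n.
  have [k' [z za]] := sS a; move: ay; rewrite -za => e.
  have kk' : k' = k := cop_index (copD n) (e : cells_piece k' (sphere_disk z) = _).
  subst k'; have <- := cop_inj (copD n) (e : cells_piece k (sphere_disk z) = _).
  exact: (set_mem (valP z)).
exists cell; last first.
  move=> n g _ [k _ <-].
  exists (existT _ (projT1 k) (coset_act g (projT2 k))) => //.
  apply/funext => y; rewrite /chi.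
  have [[_ _ _ [_ gQ] _] _] := po n.
  exact: (congr1 \val (gQ g (cells_piece k y))).
split.
- exact: skelS.
- move=> x; have [n _ skx] : (\bigcup_n skel X n) x by rewrite cover.
  by exists n.
- move=> n _ [k _ <-]; apply: cts_comp (@cts_val _ _) _.
  apply: cts_comp; first exact: adj_v (adj n).
  by have [[cc _ _] _ _] := copD n; exact: cc.
- by move=> n _ y [k _ <-]; exact: chiS.
- move=> n _ y [k _ <-] nSy; split; first exact: (set_mem (valP (Q n _))).
  by move=> /chiP.
- move=> n _ _ y z [k _ <-] [l _ <-] nSy nSz /val_inj/(adj_injv (adj n)) [e|].
    have kl := cop_index (copD n) e; subst l.
    by rewrite (cop_inj (copD n) e).
  move=> [a [_ [ay _ _]]]; case: nSy; apply: (@chiP n k).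
  by rewrite /chi -ay (adj_comm (adj n)); exact: (set_mem (valP (q n _))).
- move=> n x skx npx.
  have [[b bx]|[c cx]] := adj_surj (adj n) (SigSub (mem_set skx) : skel_space X n).
    have [[_ sD _] _ _] := copD n; have [k [y yb]] := sD b.
    have xy : chi n k y = x by rewrite /chi yb bx.
    exists (chi n k), y; split=> //; first by exists k.
    by move=> Sy; apply: npx; rewrite -xy; exact: chiS.
  case: npx; have := congr1 \val cx => /= <-.
  exact: (set_mem (valP c)).
- move=> n K Kn cKp cK; apply: (cl_up (n := n)) => //.
  apply: (adj_closed (adj n)).
    have [[_ _ tD] _ _] := copD n; apply: tD => k.
    by apply: (cK (chi n k)); exists k.
  have := cts_closed (@cts_val _ (skel_pred X n)) cKp; congr closed.
  by apply/seteqP; split=> [x []//|x Kx]; split=> //; exact: (set_mem (valP x)).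
- move=> K cK; apply: cl_closed => n.
  have := cts_closed (@cts_val _ (skel X n)) (cK n); congr closed.
  by apply/seteqP; split=> [x []//|x Kx]; split=> //; exact: (set_mem (valP x)).
Qed.

End ToCells.

Section FromCells.
Variable cell : forall n, set (disk R n -> X).
Arguments cell : clear implicits.
Hypotheses (cwX : cw (skel X) cell) (cellG : cells_act cell).

Let orbit n (f : disk R n -> X) : set (disk R n -> X) :=
  [set h | exists g, h = fun y => act g (f y)].

(** One equivariant cell for each orbit of cells, with isotropy group the
    stabilizer of a chosen cell of the orbit. *)
Let orbits n : Type := [set S | exists2 f, cell n f & S = orbit f].

Let rep n (i : orbits n) : disk R n -> X := s2val (cid2 (set_mem (valP i))).

Let repP n (i : orbits n) : cell n (rep i).
Proof. by rewrite /rep; case: cid2. Qed.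

Let repE n (i : orbits n) : \val i = orbit (rep i).
Proof. by rewrite /rep; case: cid2. Qed.

Let stab_closed n (i : orbits n) :
  group_closed (mem [set g | forall y, act g (rep i y) = rep i y]).
Proof.
apply: group_closedP => /= [y|g h sg sh y|g sg y]; first exact: act1.
  by rewrite actM sh sg.
by rewrite -{1}(sg y) -actM mulVg act1.
Qed.

Let stab n (i : orbits n) : subgroup G := Subgroup (@stab_closed n i).

Let act_repr n (i : orbits n) g y :
  act (repr (\pi_(coset (stab i)) g)) (rep i y) = act g (rep i y).
Proof.
have [h Hh ->] := (coset_reprP (\pi_(coset (stab i)) g) g).1 erefl.
by rewrite actM Hh.
Qed.

Let attach_proof n (x : gcells (@stab n) (disk R n)) :
  act (repr (projT2 x).1) (rep (projT1 x) (projT2 x).2) \in skel X n.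
Proof.
by apply/mem_set/skel_act; apply: (cell_skel cwX); exact: repP.
Qed.

Let attach n (x : gcells (@stab n) (disk R n)) : skel_space X n :=
  SigSub (attach_proof x).

Let battach_proof n (x : gcells (@stab n) (sphere R n)) :
  act (repr (projT2 x).1) (rep (projT1 x) (sphere_disk (projT2 x).2))
    \in skel_pred X n.
Proof.
apply/mem_set/skel_pred_act; apply: (cw_sphere cwX (repP _)).
exact: (set_mem (valP (projT2 x).2)).
Qed.

Let battach n (x : gcells (@stab n) (sphere R n)) : skel_pred_space X n :=
  SigSub (battach_proof x).

Lemma cells_attach n : attaches_cells R X n.
Proof.
exists (orbits n : choiceType), (@stab n), (@battach n), (@attach n).
apply: gpushout_sym.
have ce := @cells_map_embedding n _ (@stab n).
have copD := cells_coproduct (@stab n) (disk R n).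
have copS := cells_coproduct (@stab n) (sphere R n).
have crep (i : orbits n) g : continuous (fun y => act g (rep i y)).
  by apply: cts_comp (cw_cts cwX (repP i)); exact: act_continuous.
have gS : is_gmap (gcells_map (H := @stab n) (@sphere_disk n)).
  by split=> //; have [] := ce.
have gb : is_gmap (@battach n).
  split=> [|g [i [c y]]].
    apply: (final_cts (cop_final copS)) => -[i c]; apply: cts_into.
    apply: cts_comp (crep i (repr c)) _.
    by apply: (cts_restrict (f := id)) => //; exact: cts_id.
  by apply: val_inj; rewrite /= act_repr actM.
have ga : is_gmap (@attach n).
  split=> [|g [i [c y]]].
    apply: (final_cts (cop_final copD)) => -[i c]; apply: cts_into.
    exact: (crep i (repr c)).
  by apply: val_inj; rewrite /= act_repr actM.
have gi := skel_incl_gmap n.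
apply: (adjunction_gpushout R) => //.
have intP (i : orbits n) g y : ~ sphere R n (\val y) ->
    ~ skel_pred X n (act g (rep i y)).
  move=> nSy; have cg : cell n (fun y => act g (rep i y)).
    by apply: cellG; exact: repP.
  by have [] := cw_int cwX cg nSy.
have sphE (i : orbits n) c (y : disk R n) (Sy : sphere R n (\val y)) :
    existT _ i (c, y) = gcells_map (H := @stab n) (@sphere_disk n)
      (existT _ i (c, SigSub (mem_set Sy))).
  by congr existT; congr (_, _); apply: val_inj.
split=> //.
- by have [] := gb.
- by have [] := ga.
- by have [] := gi.
- by move=> x; apply: val_inj.
- by move=> x y /(congr1 \val) /= xy; apply: val_inj.
- move=> [i [c y]] x e.
  have [Sy|nSy] := pselect (sphere R n (\val y)); last first.
    case: (intP i (repr c) y nSy).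
    have := congr1 \val e; rewrite /= => ->; exact: (set_mem (valP x)).
  exists (existT _ i (c, SigSub (mem_set Sy))); first by rewrite -sphE.
  apply: val_inj; have := congr1 \val e; rewrite /= => <-.
  by congr (act _ (rep i _)); apply: val_inj.
- move=> [i [c y]] [j [d z]] /(congr1 \val) /= e.
  have [Sy|nSy] := pselect (sphere R n (\val y)); last first.
    have nSz : ~ sphere R n (\val z).
      move=> Sz; case: (intP i (repr c) y nSy); rewrite e.
      by apply: skel_pred_act; exact: (cw_sphere cwX (repP _)).
    have [fE yz] := cw_inj cwX (cellG (repr c) (repP i)) (cellG (repr d) (repP j))
      nSy nSz e.
    left; subst z.
    have ij : i = j.
      apply: val_inj; rewrite !repE; apply/seteqP; split=> _ [g ->].
        exists (g * (repr c)^-1 * repr d)%g; apply/funext => t.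
        rewrite actM -(congr1 (@^~ t) fE) -actM mulgVK.
        by [].
      exists (g * (repr d)^-1 * repr c)%g; apply/funext => t.
      by rewrite actM (congr1 (@^~ t) fE) -actM mulgVK.
    subst j; congr existT; congr (_, _).
    rewrite -[c]reprK; apply/coset_reprP; exists ((repr c)^-1 * repr d)%g.
      move=> t; rewrite actM -(congr1 (@^~ t) fE) -actM mulVg act1.
      by [].
    by rewrite mulVKg.
  right; have Sz : sphere R n (\val z).
    apply: contrapT => nSz; case: (intP j (repr d) z nSz); rewrite -e.
    by apply: skel_pred_act; exact: (cw_sphere cwX (repP _)).
  exists (existT _ i (c, SigSub (mem_set Sy))), (existT _ j (d, SigSub (mem_set Sz))).
  split; [by rewrite -sphE|by rewrite -sphE|apply: val_inj => /=].
  have -> : sphere_disk (SigSub (mem_set Sy)) = y by apply: val_inj.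
  by have -> : sphere_disk (SigSub (mem_set Sz)) = z by apply: val_inj.
- move=> x; have skx := set_mem (valP x).
  have [px|npx] := pselect (skel_pred X n (\val x)).
    by right; exists (SigSub (mem_set px)); apply: val_inj.
  have [f [y [cf nSy fy]]] := cw_surj cwX skx npx.
  have oi : orbit f \in [set S | exists2 f, cell n f & S = orbit f].
    by apply/mem_set; exists f.
  pose i : orbits n := SigSub oi.
  have : orbit (rep i) f.
    by rewrite -repE; exists 1%g; apply/funext => t; rewrite act1.
  move=> [g fg]; left; exists (existT _ i (\pi_(coset (stab i)) g, y)).
  by apply: val_inj; rewrite /= act_repr -fy fg.
- move=> K cDK cpK.
  have cvK : closed (\val @` K).
    apply: (cw_attach cwX (n := n)) => [_ [x _ <-]| |f cf].
    + exact: (set_mem (valP x)).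
    + have := closed_image_val (@pred_skel_closed _ _ _ _ cwX n) cpK; congr closed.
      apply/seteqP; split=> [_ [x Kx <-]|_ [[x Kx <-] px]].
        split; last exact: (set_mem (valP x)).
        by exists (skel_incl x).
      exists (SigSub (mem_set px)) => //=.
      by have -> // : skel_incl (SigSub (mem_set px)) = x by apply: val_inj.
    + have oi : orbit f \in [set S | exists2 f, cell n f & S = orbit f].
        by apply/mem_set; exists f.
      pose i : orbits n := SigSub oi.
      have [g fg] : orbit (rep i) f.
        by rewrite -repE; exists 1%g; apply/funext => t; rewrite act1.
      have ec := (cop_final copD); have [cc _ _] := ec.
      have := cts_closed (cc (existT _ i (\pi_(coset (stab i)) g))) cDK.
      congr closed; apply/seteqP; split=> y.
        by move=> Ky; exists (attach (cells_piece (existT _ i (\pi_(coset (stab i)) g)) y)) => //;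
           rewrite /= act_repr fg.
      move=> [x Kx xy]; rewrite /preimage /=.
      have -> // : attach (cells_piece (existT _ i (\pi_(coset (stab i)) g)) y) = x.
      by apply: val_inj; rewrite /= act_repr xy fg.
  have := cts_closed (@cts_val _ (skel X n)) cvK; congr closed.
  apply/seteqP; split=> [x [y Ky /val_inj <-]//|x Kx].
  by exists x.
Qed.

Lemma cells_gcw : is_gcw R X.
Proof.
split; last exact: cells_attach.
  by apply/seteqP; split=> // x _; have [n skx] := cw_skelT cwX x; exists n.
move=> U; split=> [oU n|oU]; first exact: cts_open (@cts_val _ _) oU.
rewrite -[U]setCK openC; apply: (cw_weak cwX) => n.
have c : closed ((\val : set_type (skel X n) -> X) @^-1` (~` U)).
  by rewrite preimage_setC closedC; exact: oU.
have := closed_image_val (@skel_closed _ _ _ _ cwX n) c; congr closed.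
apply/seteqP; split=> [_ [x nUx <-]|x [nUx skx]].
  by split=> //; exact: (set_mem (valP x)).
by exists (SigSub (mem_set skx)).
Qed.

End FromCells.

End GCW.

(** * Fixed points of pushouts *)

Section FixedPoints.
Variable G : groupType.
Local Open Scope group_scope.

Lemma fix_map_proof (X Y : gspace G) (f : X -> Y) (gf : is_gmap f)
  (H : subgroup G) (x : fixed_points X H) : f (\val x) \in fixed_points Y H.
Proof.
have [_ fe] := gf; apply/mem_set => h Hh; rewrite -fe.
by congr f; exact: (set_mem (valP x)).
Qed.

Definition fix_map (X Y : gspace G) (f : X -> Y) (gf : is_gmap f)
  (H : subgroup G) (x : fixed_points X H) : fixed_points Y H :=
  SigSub (fix_map_proof gf x).

Lemma fixed_inj (X Y : gspace G) (g : X -> Y) (H : subgroup G) x : is_gmap g -> injective g ->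
  fixed_points Y H (g x) -> fixed_points X H x.
Proof. by move=> [_ ge] jg fx h Hh; apply: jg; rewrite ge fx. Qed.

Section Embedding.
Variables (A B : gspace G) (f : A -> B) (gf : is_gmap f) (H : subgroup G).
Hypothesis ef : closed_embedding f.

Lemma fixed_range (b : fixed_points B H) :
  range (fix_map gf (H := H)) b <-> range f (\val b).
Proof.
have [_ jf _ _] := ef.
split=> [[a _ <-]|[a _ ab]]; first by exists (\val a).
have Ha : fixed_points A H a.
  by apply: (fixed_inj gf jf); rewrite ab; exact: (set_mem (valP b)).
by exists (SigSub (mem_set Ha)) => //; apply: val_inj.
Qed.

Lemma fixed_embedding : closed_embedding (fix_map gf (H := H)).
Proof.
have [cf jf of_ rf] := ef; split.
- exact: (cts_restrict (f := f)).
- by move=> x y /(congr1 \val) /= /jf xy; apply: val_inj.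
- move=> _ [U oU <-]; have [V oV VU] := of_ _ oU.
  exists (\val @^-1` V); first exact: cts_open (@cts_val _ _) oV.
  by apply/seteqP; split=> x /=; rewrite -VU.
- have -> : range (fix_map gf (H := H)) = \val @^-1` range f.
    by apply/seteqP; split=> b /fixed_range.
  exact: cts_closed (@cts_val _ _) rf.
Qed.

End Embedding.

Section Adjunction.
Variables (A B C D : gspace G) (f : A -> B) (u : A -> C) (v : B -> D) (w : C -> D).
Hypotheses (gf : is_gmap f) (gu : is_gmap u) (gv : is_gmap v) (gw : is_gmap w).
Hypothesis adj : adjunction f u v w.
Variable H : subgroup G.

Hypotheses (cB : closed (fixed_points B H)) (cC : closed (fixed_points C H)).

(** Off the range of [f] the map [v] is injective and equivariant, and so is [w]
    everywhere: a fixed point of [D] has a fixed preimage. For the topology, a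
    closed set of fixed points is pulled back to [C] first, which settles its
    inverse image in [B] on the range of [f]. *)
Lemma fixed_adjunction : adjunction (fix_map gf (H := H)) (fix_map gu (H := H))
  (fix_map gv (H := H)) (fix_map gw (H := H)).
Proof.
have [cu _] := gu; have [cv gv'] := gv; have [cw_ _] := gw.
have jw := adj_injw adj.
have fixB b : ~ range f b -> fixed_points D H (v b) -> fixed_points B H b.
  move=> nb Hb h Hh; have /(adj_injv adj) : v (act h b) = v b by rewrite gv' Hb.
  by case=> [//|[a [a' [_ fb _]]]]; case: nb; exists a'.
split.
- exact: fixed_embedding _ (adj_emb adj).
- exact: (cts_restrict (f := u)).
- exact: (cts_restrict (f := v)).
- exact: (cts_restrict (f := w)).
- by move=> a; apply: val_inj; rewrite /= (adj_comm adj).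
- by move=> x y /(congr1 \val) /= /jw xy; apply: val_inj.
- move=> b c /(congr1 \val) /= /(adj_vw adj)[a fa ua].
  have [a' _ a'b] : range (fix_map gf (H := H)) b by apply/(fixed_range gf (adj_emb adj)); exists a.
  exists a' => //; apply: val_inj; rewrite /= -ua; congr u.
  have [_ jf _ _] := adj_emb adj; apply: jf.
  by rewrite fa -a'b.
- move=> b b' /(congr1 \val) /= /(adj_injv adj)[e|[a [a' [fa fa' uaa]]]].
    by left; apply: val_inj.
  have [x _ xb] : range (fix_map gf (H := H)) b by apply/(fixed_range gf (adj_emb adj)); exists a.
  have [x' _ xb'] : range (fix_map gf (H := H)) b'.
    by apply/(fixed_range gf (adj_emb adj)); exists a'.
  have [_ jf _ _] := adj_emb adj.
  have ax : \val x = a by apply: jf; rewrite fa -xb.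
  have ax' : \val x' = a' by apply: jf; rewrite fa' -xb'.
  right; exists x, x'; split=> //; apply: val_inj.
  by rewrite /= ax ax'.
- move=> d; have fixC c : w c = \val d -> exists c', fix_map gw (H := H) c' = d.
    move=> cd; have Hc : fixed_points C H c.
      by apply: (fixed_inj gw jw); rewrite cd; exact: (set_mem (valP d)).
    by exists (SigSub (mem_set Hc)); apply: val_inj.
  have [[b bd]|[c /fixC]] := adj_surj adj (\val d); last by right.
  have [[a _ fa]|nb] := pselect (range f b).
    by right; apply: (fixC (u a)); rewrite -(adj_comm adj) fa.
  have Hb : fixed_points B H b.
    by apply: fixB => //; rewrite bd; exact: (set_mem (valP d)).
  by left; exists (SigSub (mem_set Hb)); apply: val_inj.
- move=> K cvK cwK.
  have wK : w @^-1` (\val @` K) = \val @` (fix_map gw (H := H) @^-1` K).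
    apply/seteqP; split=> [c [d Kd dc]|_ [c Kc <-]]; last first.
      by exists (fix_map gw c).
    have Hc : fixed_points C H c.
      by apply: (fixed_inj gw jw); rewrite -dc; exact: (set_mem (valP d)).
    exists (SigSub (mem_set Hc)) => //=.
    by have <- // : d = fix_map gw (SigSub (mem_set Hc)) by apply: val_inj.
  have cwK' : closed (w @^-1` (\val @` K)) by rewrite wK; exact: closed_image_val.
  have vK : v @^-1` (\val @` K) = \val @` (fix_map gv (H := H) @^-1` K) `|`
      f @` (u @^-1` (w @^-1` (\val @` K))).
    apply/seteqP; split=> [b [d Kd db]|b].
      have [[a _ fa]|nb] := pselect (range f b).
        right; exists a => //; exists d => //.
        by rewrite -(adj_comm adj) fa.
      have Hb : fixed_points B H b.
        by apply: fixB => //; rewrite -db; exact: (set_mem (valP d)).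
      left; exists (SigSub (mem_set Hb)) => //=.
      by have <- // : d = fix_map gv (SigSub (mem_set Hb)) by apply: val_inj.
    move=> [[c Kc <-]|[a [d Kd da] <-]]; first by exists (fix_map gv c).
    by exists d => //; rewrite (adj_comm adj).
  have cK : closed (\val @` K).
    apply: (adj_closed adj) => //; rewrite vK; apply: closedU.
      exact: closed_image_val.
    apply: closed_embedding_image; first exact: adj_emb adj.
    exact: cts_closed cu cwK'.
  have := cts_closed (@cts_val _ (fixed_points D H)) cK; congr closed.
  apply/seteqP; split=> [x [y Ky /val_inj <-]//|x Kx].
  by exists x.
Qed.

End Adjunction.

Variable R : realType.

(** A translate of a cell that agrees with it at one interior point is the same
    cell: the isotropy group is constant on an open cell, and fixes its boundary
    too. *)
Lemma fixed_cells (X : fgspace G) (cell : forall n, set (disk R n -> X))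
    (H : subgroup G) n f y z : cw (skel X) cell -> cells_act cell -> cell n f ->
  ~ sphere R n (\val y) -> fixed_points X H (f y) -> fixed_points X H (f z).
Proof.
move=> cwX cX cf nSy Hy h Hh.
have [fE _] := cw_inj cwX (cX n h f cf) cf nSy nSy (Hy h Hh).
exact: (congr1 (@^~ z) fE).
Qed.

Lemma fixed_closed (X : fgspace G) H : is_gcw R X -> closed (fixed_points X H).
Proof.
move=> /gcw_cells[cell cwX cX]; apply: (closed_cellwise cwX) => n f y z cf.
exact: fixed_cells cwX cX cf.
Qed.

(** The interior of a cell is connected, so that it lies in one component of
    the difference of two successive skeleta. *)
Lemma subcomplex_cellwise (X : fgspace G) (cell : forall n, set (disk R n -> X))
  (A : set X) : cw (skel X) cell -> is_subcomplex A -> cellwise cell A.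
Proof.
move=> cwX [_ _ sub] n f y z cf nSy nSz Afy.
have intf t : ~ sphere R n (\val t) -> (skel X n `\` skel_pred X n) (f t).
  by move=> nSt; exact: (cw_int cwX cf nSt).
apply: (sub n _ Afy (intf _ nSy)).
apply: (@connected_component_max _ _ (f @` [set t | ~ sphere R n (\val t)])).
- by exists y.
- by move=> _ [t nSt <-]; exact: intf.
- by apply: connected_interior; exact: (cw_cts cwX cf).
- by exists z.
Qed.

Lemma gcw_inclusion_embedding (X Y : fgspace G) (f : X -> Y) :
  gcw_inclusion f -> closed_embedding f.
Proof. by move=> [[cf _] jf of_ [rf _ _] _]. Qed.

Lemma fixed_cofibration (X Y : fgspace G) (g : X -> Y) (gg : is_gmap g) H :
  is_gcw R Y -> gcw_inclusion g -> cofibration R (fix_map gg (H := H)).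
Proof.
move=> /gcw_cells[cY cwY aY] inc; have [_ jg _ sub _] := inc.
have eg := gcw_inclusion_embedding inc.
apply: (cw_cofibration (cw_sub cwY
  (fun n f y z cf => @fixed_cells _ _ H n f y z cwY aY cf))).
  exact: fixed_embedding _ eg.
move=> n f y z cf nSy nSz; rewrite !(fixed_range gg eg).
exact: (subcomplex_cellwise cwY sub cf nSy nSz).
Qed.

Section Pushout.
Variables (A B C D : fgspace G) (f : A -> B) (u : A -> C) (v : B -> D) (w : C -> D).
Hypotheses (gB : is_gcw R B) (gC : is_gcw R C).
Hypothesis po : cellular_gpushout f u v w.

Lemma pushout_gcw : is_gcw R D.
Proof.
have [cB cwB aB] := gcw_cells gB; have [cC cwC aC] := gcw_cells gC.
have [uni cf cu inc skD] := po.
have [[_ _ [_ gv] [_ gw] _] _] := uni.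
case: inc => inc; have emb := gcw_inclusion_embedding inc;
  have [_ _ _ sub skA] := inc.
- have adj := gpushout_adjunction emb uni.
  have cwD := cw_adj adj cwB cwC (subcomplex_cellwise cwB sub) skA
    (fun n a sa => cu n _ (imageP u sa)) skD.
  apply: (cells_gcw cwD) => n g _ [[h ch <-]|[h [ch nh] <-]].
    left; exists (fun y => act g (h y)); first exact: aC.
    by apply/funext => y /=; rewrite gw.
  right; exists (fun y => act g (h y)); last by apply/funext => y /=; rewrite gv.
  split=> [|y nSy fy]; first exact: aB.
  apply: (nh y nSy); have [_ act_sub _] := sub.
  by rewrite -[h y](@act1 G B) -(mulVg g) actM; exact: act_sub.
- have adj := gpushout_adjunction emb (gpushout_sym uni).
  have skD' n : skel D n = (w @` skel C n) `|` (v @` skel B n).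
    by rewrite skD setUC.
  have cwD := cw_adj adj cwC cwB (subcomplex_cellwise cwC sub) skA
    (fun n a sa => cf n _ (imageP f sa)) skD'.
  apply: (cells_gcw cwD) => n g _ [[h ch <-]|[h [ch nh] <-]].
    left; exists (fun y => act g (h y)); first exact: aB.
    by apply/funext => y /=; rewrite gv.
  right; exists (fun y => act g (h y)); last by apply/funext => y /=; rewrite gw.
  split=> [|y nSy fy]; first exact: aC.
  apply: (nh y nSy); have [_ act_sub _] := sub.
  by rewrite -[h y](@act1 G C) -(mulVg g) actM; exact: act_sub.
Qed.

Lemma fixed_pushout H (gf : is_gmap f) (gu : is_gmap u) (gv : is_gmap v)
    (gw : is_gmap w) :
  (adjunction (fix_map gf (H := H)) (fix_map gu (H := H)) (fix_map gv (H := H))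
    (fix_map gw (H := H)) /\ cofibration R (fix_map gf (H := H))) \/
  (adjunction (fix_map gu (H := H)) (fix_map gf (H := H)) (fix_map gw (H := H))
    (fix_map gv (H := H)) /\ cofibration R (fix_map gu (H := H))).
Proof.
have [uni _ _ inc _] := po.
have fB := @fixed_closed B H gB; have fC := @fixed_closed C H gC.
case: inc => inc; have emb := gcw_inclusion_embedding inc; [left|right].
  split; last exact: fixed_cofibration.
  exact: (fixed_adjunction _ _ _ _ (gpushout_adjunction emb uni) fB fC).
split; last exact: fixed_cofibration.
exact: (fixed_adjunction _ _ _ _ (gpushout_adjunction emb (gpushout_sym uni)) fC fB).
Qed.

End Pushout.
End FixedPoints.

(** * Deformations of coproducts *)

Lemma dependent_choice (I : Type) (T : I -> Type) (P : forall i, T i -> Prop) :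
  (forall i, exists x, P i x) -> exists f : forall i, T i, forall i, P i (f i).
Proof.
move=> h; exists (fun i => sval (cid (h i))) => i.
by case: cid.
Qed.

Section CoproductMaps.
Variables (R : realType) (I : Type) (X : I -> topologicalType).
Variables (Y : topologicalType) (e : forall i, X i -> Y).
Arguments e : clear implicits.
Hypothesis cope : coproduct e.

Lemma cop_homotopy (Z : topologicalType) (h : forall i, R * X i -> Z) :
  (forall i, continuous (h i)) ->
  exists F : R * Y -> Z, continuous F /\ forall t i x, F (t, e i x) = h i (t, x).
Proof.
move=> ch; have [_ se _] := cop_final cope.
have se' y : exists k : {i & X i}, e (projT1 k) (projT2 k) = y.
  by have [i [x xy]] := se y; exists (existT _ i x).
have [idx idxP] := dependent_choice se'.
pose F (p : R * Y) := h (projT1 (idx p.2)) (p.1, projT2 (idx p.2)).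
have FE t i x : F (t, e i x) = h i (t, x).
  rewrite /F /=; case: (idx _) (idxP (e i x)) => j y /= yx.
  exact: (cop_eq cope (P := fun i x => h j (t, y) = h i (t, x)) yx).
exists F; split=> //; apply: (final_homotopy (cop_final cope)) => i.
have -> : (fun p => F (p.1, e i p.2)) = h i; last exact: ch.
by apply/funext => -[t x]; exact: FE.
Qed.

End CoproductMaps.

Section Bijection.
Variable R : realType.

Lemma contractible_bij (S T : topologicalType) (f : S -> T) :
  continuous f -> injective f -> (forall y, exists x, f x = y) ->
  (forall K, closed K -> closed (f @` K)) -> contractible R S -> contractible R T.
Proof.
move=> cf jf sf clf; have [g gK] := dependent_choice sf.
have fK : cancel f g by move=> x; apply: jf; rewrite gK.
apply: (contractible_homeo cf _ fK gK); apply/continuous_closedP => K cK.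
have -> : g @^-1` K = f @` K; last exact: clf.
apply/seteqP; split=> [y Ky|_ [x Kx <-]]; last by rewrite /= fK.
by exists (g y).
Qed.

Lemma closed_empty (T : topologicalType) (K : set T) : (T -> False) -> closed K.
Proof.
move=> T0; suff -> : K = set0 by exact: closed0.
by apply/seteqP; split=> x; have := T0 x.
Qed.

Lemma contractible_adj_r (A B C D : topologicalType) (f : A -> B) (u : A -> C)
    (v : B -> D) (w : C -> D) : adjunction f u v w -> (B -> False) ->
  contractible R C -> contractible R D.
Proof.
move=> adj B0; apply: contractible_bij; first exact: (adj_w adj).
- exact: adj_injw adj.
- by move=> d; have [[b _]|] := adj_surj adj d; first by have := B0 b.
- by move=> K; exact: adj_closed_map adj.
Qed.

Lemma contractible_adj_l (A B C D : topologicalType) (f : A -> B) (u : A -> C)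
    (v : B -> D) (w : C -> D) : adjunction f u v w -> (C -> False) ->
  contractible R B -> contractible R D.
Proof.
move=> adj C0.
have jv : injective v.
  move=> b b' /(adj_injv adj)[//|[a _]].
  by have := C0 (u a).
apply: contractible_bij; [exact: (adj_v adj)|exact: jv| |].
- by move=> d; have [|[c _]] := adj_surj adj d; last by have := C0 c.
- move=> K cK; apply: (adj_closed adj); last exact: closed_empty.
  have -> // : v @^-1` (v @` K) = K.
  by apply/seteqP; split=> [b [b' Kb' /jv <-]//|b Kb]; exists b.
Qed.

Lemma contractible_coproduct1 (I : Type) (X : I -> topologicalType)
    (Y : topologicalType) (e : forall i, X i -> Y) i0 :
  coproduct e -> (forall i, X i -> i = i0) ->
  contractible R (X i0) -> contractible R Y.
Proof.
move=> cope only; have [ce se te] := cop_final cope.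
apply: contractible_bij; first exact: (ce i0).
- exact: (cop_inj cope).
- by move=> y; have [i [x <-]] := se y; have ii := only i x; subst i; exists x.
- move=> K cK; apply: te => i.
  have [ii|ni] := pselect (i = i0); last first.
    by apply: closed_empty => x; exact: ni (only i x).
  subst i; have -> // : e i0 @^-1` (e i0 @` K) = K.
  apply/seteqP; split=> [x [x' Kx' /(cop_inj cope) <-]//|x Kx].
  by exists x.
Qed.

End Bijection.

Section Deformation.
Variables (R : realType) (I : Type) (XA XC : I -> topologicalType).
Variables (A C : topologicalType) (eA : forall i, XA i -> A).
Variables (eC : forall i, XC i -> C) (u : A -> C) (ui : forall i, XA i -> XC i).
Arguments eA : clear implicits.
Arguments eC : clear implicits.
Arguments ui : clear implicits.
Hypotheses (copA : coproduct eA) (copC : coproduct eC).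
Hypothesis uE : forall i x, u (eA i x) = eC i (ui i x).
Hypothesis pieces : forall i, (XC i -> False) \/
  contractible R (XA i) /\ contractible R (XC i).

(** A base point [a] of [XA i] is chosen, the homotopy inverse of [ui i] is
    constant at [a], and [XC i] is contracted to the image of [a]. *)
Lemma piece_deformation i : exists d : (XC i -> XA i) * (R * XA i -> XA i) *
    (R * XC i -> XC i), let: (s, al, ga) := d in
  [/\ [/\ continuous s, continuous al & continuous ga],
    forall x, al (0, x) = x, forall x, al (1, x) = s (ui i x),
    (forall c, ga (0, c) = c) /\ (forall c, ga (1, c) = ui i (s c)) &
    forall c c', s c = s c'].
Proof.
have [C0|[cA cC]] := pieces i.
  exists ((fun c => False_rect _ (C0 c)), (fun p => p.2), (fun p => p.2)); split.
  - split; [by move=> c; have := C0 c| |]; by apply: cts_snd; exact: cts_id.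
  - by [].
  - by move=> x; have := C0 (ui i x).
  - by split=> // c; have := C0 c.
  - by move=> c; have := C0 c.
have /contractibleP[a [al [cal al0 al1]]] := cA.
have [ga [cga ga0 ga1]] := contractible_to (ui i a) cC.
exists ((fun=> a), al, ga); split=> //.
by split=> //; exact: cts_cst.
Qed.

Lemma coproduct_deformation : exists (s : C -> A) (al : R * A -> A)
    (ga : R * C -> C),
  [/\ [/\ continuous s, continuous al & continuous ga],
    (forall a, al (0, a) = a) /\ (forall a, al (1, a) = s (u a)),
    (forall c, ga (0, c) = c) /\ (forall c, ga (1, c) = u (s c)),
    forall t a, s (u (al (t, a))) = s (u a) & forall c, s (u (s c)) = s c].
Proof.
have [d dP] := dependent_choice piece_deformation.
pose si i := (d i).1.1; pose ali i := (d i).1.2; pose gai i := (d i).2.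
have {}dP i : [/\ [/\ continuous (si i), continuous (ali i) & continuous (gai i)],
    forall x, ali i (0, x) = x, forall x, ali i (1, x) = si i (ui i x),
    (forall c, gai i (0, c) = c) /\ (forall c, gai i (1, c) = ui i (si i c)) &
    forall c c', si i c = si i c'].
  by have := dP i; rewrite /si /ali /gai; case: (d i) => -[].
have [cA sA _] := cop_final copA; have [cC sC _] := cop_final copC.
have [S [cS SE]] := cop_homotopy copC (h := fun i (p : R * XC i) => eA i (si i p.2))
  (fun i => cts_comp (cA i) (cts_comp (let: And5 (And3 c _ _) _ _ _ _ := dP i in c)
    (cts_snd (@cts_id _)))).
have [al [cal alE]] := cop_homotopy copA (h := fun i p => eA i (ali i p))
  (fun i => cts_comp (cA i) (let: And5 (And3 _ c _) _ _ _ _ := dP i in c)).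
have [ga [cga gaE]] := cop_homotopy copC (h := fun i p => eC i (gai i p))
  (fun i => cts_comp (cC i) (let: And5 (And3 _ _ c) _ _ _ _ := dP i in c)).
pose s c := S (0, c); have sE i c : s (eC i c) = eA i (si i c) by exact: SE.
exists s, al, ga; split.
- split=> //; apply: cts_comp cS _.
  by apply: cts_pair; [exact: cts_cst|exact: cts_id].
- split=> a; have [i [x <-]] := sA a; have [_ a0 a1 _ _] := dP i.
    by rewrite alE a0.
  by rewrite alE a1 uE sE.
- split=> c; have [i [x <-]] := sC c; have [_ _ _ [g0 g1] _] := dP i.
    by rewrite gaE g0.
  by rewrite gaE g1 sE uE.
- move=> t a; have [i [x <-]] := sA a; have [_ _ _ _ sc] := dP i.
  by rewrite alE !uE !sE (sc _ (ui i x)).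
- move=> c; have [i [x <-]] := sC c; have [_ _ _ _ sc] := dP i.
  by rewrite sE uE sE (sc _ x).
Qed.

End Deformation.

(** * Maximal subgroups and free models *)

Section MaximalSubgroups.
Variable G : groupType.
Local Open Scope quotient_scope.
Local Open Scope group_scope.
Implicit Types (H K L : subgroup G) (F : Defs.family G).

Lemma conj_subgroupM H g h :
  conj_subgroup (conj_subgroup H g) h = conj_subgroup H (g * h).
Proof. by apply: subgroup_ext; rewrite /= conj_setM. Qed.

Lemma conj_subgroup1 H : conj_subgroup H 1 = H.
Proof. by apply: subgroup_ext; exact: conj_set1. Qed.

Lemma conj_subgroupK H g : conj_subgroup (conj_subgroup H g) g^-1 = H.
Proof. by rewrite conj_subgroupM mulgV conj_subgroup1. Qed.

Lemma conj_subgroupKV H g : conj_subgroup (conj_subgroup H g^-1) g = H.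
Proof. by rewrite conj_subgroupM mulVg conj_subgroup1. Qed.

Lemma conj_subset H K g : H `<=` K -> conj_subgroup H g `<=` conj_subgroup K g.
Proof. exact: image_subset. Qed.

Lemma conj_subset_adj H K g : conj_subgroup H g `<=` K <->
  H `<=` conj_subgroup K g^-1.
Proof.
split=> [/(conj_subset (g := g^-1))|/(conj_subset (g := g))].
  by rewrite conj_subgroupK.
by rewrite conj_subgroupKV.
Qed.

Lemma fam_conjE F H g : fam_set F (conj_subgroup H g) <-> fam_set F H.
Proof.
split; last exact: fam_conj.
by move=> /(fam_conj g^-1); rewrite conj_subgroupK.
Qed.

Lemma maximal_conj (F1 F2 : Defs.family G) H g : maximal_in (F2 `\` F1) H ->
  maximal_in (F2 `\` F1) (conj_subgroup H g).
Proof.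
move=> [[F2H F1H] mx]; split; first by split; rewrite /= fam_conjE.
move=> L [F2L F1L] /conj_subset_adj sub.
rewrite -(conj_subgroupKV L g); congr conj_subgroup; apply: mx => //.
by split; rewrite /= fam_conjE.
Qed.

(** Membership in [F2 `\` F1] passes to larger subgroups within [F2]. *)
Lemma maximal_inD (F1 F2 : Defs.family G) H : maximal_in (F2 `\` F1) H <->
  maximal_in F2 H /\ ~ fam_set F1 H.
Proof.
split=> [[[F2H F1H] mx]|[[F2H mx] F1H]].
  split=> //; split=> // L F2L HL; apply: mx => //; split=> // F1L.
  by apply: F1H; exact: fam_sub HL F1L.
by split=> // L [F2L _]; exact: mx.
Qed.

(** A conjugate containing [H] of a subgroup in [M] is maximal, hence equal to
    the maximal subgroup containing [H]. As [M] has one subgroup in each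
    conjugacy class, this determines the subgroup, and the conjugating element
    up to its normalizer. *)
Lemma unique_conjugate (F1 F2 : Defs.family G) (S M : set (subgroup G)) H :
  satisfies_M F1 F2 -> maximal_in (F2 `\` F1) `<=` S -> S `<=` maximal_in F2 ->
  conj_representatives S M -> fam_set F2 H -> ~ fam_set F1 H ->
  exists k0 : {F : M & coset (normalizer (sval F))},
    conj_subgroup H (repr (projT2 k0)) `<=` sval (projT1 k0) /\
    forall k : {F : M & coset (normalizer (sval F))},
      conj_subgroup H (repr (projT2 k)) `<=` sval (projT1 k) -> k = k0.
Proof.
move=> [_ max] leS Sle [MS rep] F2H F1H.
have [Hm [[HHm Hmmax] uniq]] := max H (conj F2H F1H).
have [F [[MF [g Fg]] _]] := rep Hm (leS _ Hmmax).
pose F' : M := SigSub (mem_set MF).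
have incl K c : M K -> conj_subgroup H c `<=` K -> Hm = conj_subgroup K c^-1.
  move=> MK /conj_subset_adj HK; apply: uniq; split=> //.
  apply: maximal_conj; apply/maximal_inD; split; first exact: Sle (MS _ MK).
  by rewrite -(fam_conjE _ _ c^-1) => F1K; apply: F1H; exact: fam_sub HK F1K.
have F'E : sval F' = conj_subgroup Hm g by [].
have normF' r : conj_subgroup (sval F') r^-1 = Hm ->
    conj_subgroup (sval F') (g^-1 * r) = sval F'.
  move=> rE; have e := conj_subgroupKV (sval F') r.
  by rewrite -[RHS]e rE F'E conj_subgroupM mulVKg.
have cosetP (c : coset (normalizer (sval F'))) :
    conj_subgroup (sval F') (repr c)^-1 = Hm -> c = \pi_(coset (normalizer (sval F'))) g.
  move=> cE; apply/esym/coset_reprP; exists (g^-1 * repr c); last by rewrite mulVKg.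
  exact: (congr1 (@sg_set G) (normF' _ cE)).
have g0 : conj_subgroup (sval F') (repr (\pi_(coset (normalizer (sval F'))) g))^-1 = Hm.
  have [n Nn ->] := (coset_reprP (\pi_(coset (normalizer (sval F'))) g) g).1 erefl.
  rewrite invgM -conj_subgroupM.
  have /= Nn' : conj_set (sval F') n^-1 = sval F' := sgV Nn.
  have -> : conj_subgroup (sval F') n^-1 = sval F' by exact: subgroup_ext.
  by rewrite F'E conj_subgroupK.
exists (existT _ F' (\pi_(coset (normalizer (sval F'))) g)); split=> /=.
  by apply/conj_subset_adj; rewrite g0.
move=> [K c] /= HK; have MK : M (sval K) := set_mem (valP K).
have HmK := incl _ _ MK HK.
have KF' : K = F'.
  apply: val_inj; have [L [_ uL]] := rep Hm (leS _ Hmmax).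
  have e1 : L = sval K.
    by apply: uL; split=> //; exists (repr c); rewrite HmK conj_subgroupKV.
  have e2 : L = sval F' by apply: uL; split=> //; exists g.
  by rewrite -[LHS]e1 e2.
by subst K; congr existT; apply: cosetP.
Qed.

End MaximalSubgroups.

Section FreeModels.
Variables (R : realType) (W : groupType).
Local Open Scope group_scope.

Lemma trivial_closed : group_closed (mem [set 1 : W]).
Proof.
by apply: group_closedP => //= [x y -> ->|x ->]; rewrite ?mulg1 ?invg1.
Qed.

Definition trivial_subgroup : subgroup W := Subgroup trivial_closed.

Lemma fixed_trivial (X : gspace W) : fixed_points X trivial_subgroup = setT.
Proof. by apply/seteqP; split=> // x _ h /= ->; rewrite act1. Qed.

Lemma isotropy_closed (X : gspace W) (x : X) :
  group_closed (mem [set g | act g x = x]).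
Proof.
apply: group_closedP => /= [|g h gx hx|g gx]; first exact: act1.
  by rewrite actM hx.
by rewrite -{1}gx -actM mulVg act1.
Qed.

(** The isotropy group of [x] has a fixed point, so it is trivial. *)
Lemma model_free (X : fgspace W) (x : X) g :
  is_model R (triv_fam W) X -> act g x = x -> g = 1.
Proof.
move=> [_ fixP] gx; have [_ empty] := fixP (Subgroup (isotropy_closed x)).
have [tr|ntr] := pselect (fam_set (triv_fam W) (Subgroup (isotropy_closed x))).
  have gS : sg_set (Subgroup (isotropy_closed x)) g by [].
  by move: gS; rewrite (tr : sg_set _ = _).
have : fixed_points X (Subgroup (isotropy_closed x)) x by [].
by rewrite empty.
Qed.

Lemma model_contractible (X : fgspace W) : is_model R (triv_fam W) X ->
  contractible R [set: X].
Proof.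
move=> [_ fixP]; rewrite -fixed_trivial.
by have [+ _] := fixP trivial_subgroup; apply.
Qed.

End FreeModels.

(** * The pushout as a classifying space *)

Section NormalizerCoproducts.
Variables (R : realType) (G : groupType) (M : set (subgroup G)).
Local Open Scope quotient_scope.
Local Open Scope group_scope.
Let fam : Type := forall F : M, fgspace (sg_type (normalizer (sval F))).
Let index : Type := {F : M & coset (normalizer (sval F))}.

Lemma norm_coprod_gcw (Y : fam) :
  (forall F, exists2 cell : forall n, set (disk R n -> Y F),
    cw (skel (Y F)) cell & cells_act cell) ->
  is_gcw R (norm_coprod Y).
Proof.
move=> h; have h' F : exists cell : forall n, set (disk R n -> Y F),
    cw (skel (Y F)) cell /\ cells_act cell by have [c] := h F; exists c.
have [cell cellP] := dependent_choice h'.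
have cwY := cw_cop (norm_coproduct Y) (sk := fun k : index => skel (Y (projT1 k)))
  (cell := fun k : index => cell (projT1 k)) (fun k => (cellP (projT1 k)).1)
  (@norm_coprod_skel _ _ Y).
apply: (cells_gcw cwY) => n g _ [[F c] [f [cf ->]]].
pose d : coset (normalizer (sval F)) := \pi_(_) (g * repr c).
have [m Nm dE] := (coset_reprP d (g * repr c)).1 erefl.
pose m' : sg_type (normalizer (sval F)) := SigSub (mem_set Nm).
exists (existT _ F d), (fun y => act m'^-1 (f y)); split.
  by have [_ cact] := cellP F; exact: cact.
apply/funext => y; congr existT; rewrite /= ind_act_pi; apply/ind_piP.
by exists m'^-1; split=> //=; rewrite dE mulgK.
Qed.

(** An element [h] moves the class of [(g, x)] to that of [(h * g, x)], which is
    the same class if and only if [h ^ g] normalizes and fixes [x]. *)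
Lemma fixed_piece (Y : fam) H (k : index) x :
  fixed_points (norm_coprod Y) H (@norm_piece G M Y k x) <->
  conj_subgroup H (repr (projT2 k)) `<=` normalizer (sval (projT1 k)) /\
  fixed_points (Y (projT1 k)) (sub_in (conj_subgroup H (repr (projT2 k)))
    (normalizer (sval (projT1 k)))) x.
Proof.
case: k x => F c x /=; set g := repr c.
have actE h : act h (@norm_piece G M Y (existT _ F c) x) =
    existT (fun F : M => gsp (ginduce (Y F))) F (ind_pi (h * g) x).
  by congr existT; exact: ind_act_pi.
split=> [fx|[HN fx] h Hh].
  have fixh h : sg_set H h -> exists n : sg_type (normalizer (sval F)),
      \val n = h ^ g /\ x = act n x.
    move=> Hh; have := fx h Hh; rewrite actE => e.
    have /ind_piP[n [hg xn]] : ind_pi (h * g) x = ind_pi g x :> ginduce (Y F).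
      exact: (cop_inj (coproduct_sigT (fun F : M => ginduce (Y F))) e).
    exists n; split=> //.
    by rewrite conjgE hg mulKg.
  split=> [_ [h Hh <-]|n /= [h Hh hn]].
    by have [n [<- _]] := fixh h Hh; exact: (set_mem (valP n)).
  have [m [me xm]] := fixh h Hh.
  have -> : n = m by apply: val_inj; rewrite me; exact/esym.
  by rewrite -xm.
rewrite actE; congr existT; apply/ind_piP.
have Nn : sg_set (normalizer (sval F)) (h ^ g) by apply: HN; exists h.
pose n : sg_type (normalizer (sval F)) := SigSub (mem_set Nn).
exists n; split; first by rewrite /= conjgE mulVKg.
by rewrite fx//=; exists h.
Qed.

End NormalizerCoproducts.

Section Main.
Variables (R : realType) (G : groupType) (F1 F2 : Defs.family G).
Variables (S M : set (subgroup G)) (EG : fgspace G).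
Variable EN : forall F : M, fgspace (sg_type (normalizer (sval F))).
Variable EW : forall F : M, fgspace (weyl (sval F)).
Variable f : forall F : M, EN F -> weyl_restrict (EW F).
Arguments f : clear implicits.
Let EWN (F : M) := weyl_restrict (EW F).
Variables (X : fgspace G) (i : norm_coprod EN -> EG) (j : EG -> X).
Variable k : norm_coprod EWN -> X.
Hypothesis max : satisfies_M F1 F2.
Hypotheses (leS : maximal_in (F2 `\` F1) `<=` S) (Sle : S `<=` maximal_in F2).
Hypothesis repM : conj_representatives S M.
Hypothesis modG : is_model R F1 EG.
Hypothesis modN : forall (F : M) H, fam_set F1 H ->
  contractible R (fixed_points (EN F) (sub_in H (normalizer (sval F)))).
Hypothesis modW : forall F : M, is_model R (triv_fam _) (EW F).
Hypothesis gf : forall F : M, is_gmap (f F).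
Hypothesis po : cellular_gpushout i (norm_coprod_map f) j k.
Local Open Scope quotient_scope.
Local Open Scope group_scope.

Lemma norm_coprod_weyl_gcw : is_gcw R (norm_coprod EWN).
Proof.
apply: norm_coprod_gcw => F; have [gcwW _] := modW F.
have [cell cwW aW] := gcw_cells gcwW; exists cell => // n g h ch.
exact: (aW n (weyl_proj g) h ch).
Qed.

(** The Weyl group acts freely on [EW F], so that an isotropy group of the
    normalizer is contained in [F]. *)
Lemma fixed_weyl (F : M) (K : subgroup G) (y : EWN F) : K `<=` normalizer (sval F) ->
  fixed_points (EWN F) (sub_in K (normalizer (sval F))) y -> K `<=` sval F.
Proof.
move=> KN fy x Kx; pose n : sg_type (normalizer (sval F)) := SigSub (mem_set (KN _ Kx)).
have ny : act (weyl_proj n) (y : EW F) = y by exact: fy.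
have /esym/weyl_projP := model_free (modW F) ny.
by rewrite invg1 mul1g.
Qed.

Lemma weyl_fixed (F : M) (K : subgroup G) (y : EWN F) : K `<=` sval F ->
  fixed_points (EWN F) (sub_in K (normalizer (sval F))) y.
Proof.
move=> KF n /= Kn; change (act (weyl_proj n) (y : EW F) = y).
have -> : weyl_proj n = 1; last exact: act1.
by apply/esym/weyl_projP; rewrite invg1 mul1g; exact: KF.
Qed.

Let index : Type := {F : M & coset (normalizer (sval F))}.
Implicit Types (H : subgroup G) (p : index).
Let fixC H p : set (EWN (projT1 p)) :=
  @norm_piece G M EWN p @^-1` fixed_points (norm_coprod EWN) H.
Let fixA H p : set (EN (projT1 p)) :=
  @norm_piece G M EN p @^-1` fixed_points (norm_coprod EN) H.

Arguments fixC : clear implicits.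
Arguments fixA : clear implicits.

Lemma fixC_sub H p y : fixC H p y ->
  conj_subgroup H (repr (projT2 p)) `<=` sval (projT1 p).
Proof. by move=> /fixed_piece[HN]; exact: fixed_weyl. Qed.

Lemma sub_normalizer (F : subgroup G) : F `<=` normalizer F.
Proof.
move=> x Fx; apply/seteqP; split=> [_ [y Fy <-]|y Fy].
  by rewrite conjgE; apply: sgM; [exact: sgV|exact: sgM].
exists (y ^ x^-1); last by rewrite conjgKV.
by rewrite conjgE invgK; apply: sgM; [exact: Fx|apply: sgM => //; exact: sgV].
Qed.

Lemma fixC_full H p : conj_subgroup H (repr (projT2 p)) `<=` sval (projT1 p) ->
  fixC H p = setT.
Proof.
move=> HF; apply/seteqP; split=> // y _; apply/fixed_piece; split.
  by move=> x /HF; exact: sub_normalizer.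
exact: weyl_fixed.
Qed.

Lemma fixC_contractible H p : conj_subgroup H (repr (projT2 p)) `<=` sval (projT1 p) ->
  contractible R (fixC H p).
Proof. by move=> HF; rewrite fixC_full//; exact: model_contractible (modW _). Qed.

(** If the conjugate of [H] belonging to a coset is in the normalizer, then [EN]
    has a fixed point, whose image under [f] shows that the conjugate is in
    [F]. So the same pieces occur in both coproducts, and all of them are
    contractible. *)
Lemma fixed_F1 H : fam_set F1 H -> contractible R (fixed_points X H).
Proof.
move=> F1H; have [uni _ _ _ _] := po; have [[gi gu gj gk _] _] := uni.
have [gcwG fixG] := modG.
have adj := fixed_pushout gcwG norm_coprod_weyl_gcw po H gi gu gj gk.
have pieces p : (fixC H p -> False) \/
    contractible R (fixA H p) /\ contractible R (fixC H p).
  have [HN|nHN] := pselect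
      (conj_subgroup H (repr (projT2 p)) `<=` normalizer (sval (projT1 p))); last first.
    by left=> y; apply: nHN; have /fixed_piece[] := set_mem (valP y).
  have cA : contractible R (fixA H p).
    have -> : fixA H p = fixed_points (EN (projT1 p))
        (sub_in (conj_subgroup H (repr (projT2 p))) (normalizer (sval (projT1 p)))).
      apply/seteqP; split=> x; first by move=> /fixed_piece[].
      by move=> fx; apply/fixed_piece.
    by apply: modN; exact: fam_conj.
  right; split=> //; apply: fixC_contractible.
  have [x0 _] := cA.
  have /fixed_piece[_ fx0] := set_mem (valP x0).
  apply: (fixed_weyl (y := f _ (\val x0)) HN) => n Kn.
  have [_ fe] := gf (projT1 p).
  by rewrite -fe fx0.
have uP p (x : fixA H p) : f _ (\val x) \in fixC H p.
  apply/mem_set; rewrite /fixC /preimage /mkset -norm_coprod_map_piece//.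
  exact: set_mem (fix_map_proof gu (SigSub (mem_set (set_mem (valP x) :
    fixed_points (norm_coprod EN) H (norm_piece (\val x)))))).
pose u p (x : fixA H p) : fixC H p := SigSub (uP p x).
have uE p x : fix_map gu (H := H) (SigSub (mem_set (set_mem (valP x) :
      fixed_points (norm_coprod EN) H (norm_piece (\val x))))) =
    SigSub (mem_set (set_mem (valP (u p x)) :
      fixed_points (norm_coprod EWN) H (norm_piece (\val (u p x))))).
  by apply: val_inj; rewrite /= norm_coprod_map_piece.
have [s [al [ga [[cs cal cga] [al0 al1] [ga0 ga1] sal sus]]]] :=
  coproduct_deformation (cop_sub (norm_coproduct EN) (fixed_points (norm_coprod EN) H))
    (cop_sub (norm_coproduct EWN) (fixed_points (norm_coprod EWN) H)) uE pieces.
have [cG _] := fixG H.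
exact: (contractible_gluing cs cal cga al0 al1 ga0 ga1 sal sus adj (cG F1H)).
Qed.

Lemma F1_empty H : ~ fam_set F1 H -> fixed_points EG H -> False.
Proof.
move=> F1H x; have [_ fixG] := modG; have [_ /(_ F1H) e] := fixG H.
by have [y /set_mem] := x; rewrite e.
Qed.

Lemma fixed_F2 H : fam_set F2 H -> ~ fam_set F1 H ->
  contractible R (fixed_points X H).
Proof.
move=> F2H F1H; have [uni _ _ _ _] := po; have [[gi gu gj gk _] _] := uni.
have [gcwG _] := modG; have B0 := F1_empty F1H.
have [p0 [p0H p0u]] := unique_conjugate max leS Sle repM F2H F1H.
have cC : contractible R (fixed_points (norm_coprod EWN) H).
  have cop := cop_sub (norm_coproduct EWN) (fixed_points (norm_coprod EWN) H).
  apply: (contractible_coproduct1 (i0 := p0) cop); last exact: fixC_contractible.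
  move=> p y; apply: p0u; apply: fixC_sub; exact: (set_mem (valP y)).
have [[adj _]|[adj _]] := fixed_pushout gcwG norm_coprod_weyl_gcw po H gi gu gj gk.
  exact: contractible_adj_r adj B0 cC.
exact: contractible_adj_l adj B0 cC.
Qed.

Lemma fixed_empty H : ~ fam_set F2 H -> fixed_points X H = set0.
Proof.
move=> F2H; have [uni _ _ _ _] := po; have [[gi gu gj gk _] _] := uni.
have F1H : ~ fam_set F1 H by have [F12 _] := max => /F12.
have [gcwG _] := modG; have B0 := F1_empty F1H.
have C0 : fixed_points (norm_coprod EWN) H -> False.
  move=> z; have [[_ sC _] _ _] := norm_coproduct EWN.
  have [p [y yz]] := sC (\val z); apply: F2H.
  have fy : fixC H p y by rewrite /fixC /preimage /mkset yz; exact: (set_mem (valP z)).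
  have [MS _] := repM; have MF : M (sval (projT1 p)) by exact: (set_mem (valP (projT1 p))).
  have [[F2F _] _] := (Sle (MS _ MF), tt).
  by rewrite -(fam_conjE _ _ (repr (projT2 p))); exact: fam_sub (fixC_sub fy) F2F.
apply/seteqP; split=> // x fx; pose x' : fixed_points X H := SigSub (mem_set fx).
have [[adj _]|[adj _]] := fixed_pushout gcwG norm_coprod_weyl_gcw po H gi gu gj gk.
  by have [[b _]|[c _]] := adj_surj adj x'; [exact: B0 b|exact: C0 c].
by have [[c _]|[b _]] := adj_surj adj x'; [exact: C0 c|exact: B0 b].
Qed.

Theorem pushout_model : is_model R F2 X.
Proof.
split; first by have [gcwG _] := modG; exact: pushout_gcw gcwG norm_coprod_weyl_gcw po.
move=> H; split; last exact: fixed_empty.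
have [F1H _|F1H F2H] := pselect (fam_set F1 H); first exact: fixed_F1.
exact: fixed_F2.
Qed.

End Main.

(** * The two families *)

Section TrivialIntersections.
Variable G : groupType.

Lemma triv_sub_in (H K : subgroup G) :
  fam_set (triv_fam G) H -> fam_set (triv_fam _) (sub_in H K).
Proof.
move=> H1; apply/seteqP; split=> [x /= Hx|_ ->]; last exact: sg1.
by apply: val_inj; move: Hx; rewrite (H1 : sg_set H = _).
Qed.

Lemma fin_sub_in (H K : subgroup G) :
  fam_set (FIN G) H -> fam_set (FIN _) (sub_in H K).
Proof.
by move=> finH; apply: finite_preimage finH => x y _ _; exact: val_inj.
Qed.

End TrivialIntersections.

Theorem corollary2p10 (R : realType) (G : groupType) :
  (satisfies_M (triv_fam G) (FIN G) ->
    forall (M : set (subgroup G))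
      (EG : fgspace G)
      (EN : forall F : set_type M, fgspace (sg_type (normalizer (sval F))))
      (EW : forall F : set_type M, fgspace (weyl (sval F)))
      (f : forall F : set_type M, EN F -> weyl_restrict (EW F))
      (X : fgspace G)
      (i : norm_coprod EN -> EG)
      (j : EG -> X)
      (k : norm_coprod (fun F => weyl_restrict (EW F)) -> X),
      conj_representatives (maximal_in (FIN G)) M ->
      is_model R (triv_fam G) EG ->
      (forall F : set_type M, is_model R (triv_fam _) (EN F)) ->
      (forall F : set_type M, is_model R (triv_fam _) (EW F)) ->
      (forall F : set_type M, is_gmap (f F)) ->
      cellular_gpushout i (norm_coprod_map f) j k ->
      is_model R (FIN G) X)
  /\
  (satisfies_M (FIN G) (VCY G) ->
    forall (M : set (subgroup G))
      (EfinG : fgspace G)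
      (EfinN : forall V : set_type M, fgspace (sg_type (normalizer (sval V))))
      (EW : forall V : set_type M, fgspace (weyl (sval V)))
      (f : forall V : set_type M, EfinN V -> weyl_restrict (EW V))
      (Y : fgspace G)
      (i : norm_coprod EfinN -> EfinG)
      (j : EfinG -> Y)
      (k : norm_coprod (fun V => weyl_restrict (EW V)) -> Y),
      conj_representatives (maximal_in (VCY G `\` FIN G)) M ->
      is_model R (FIN G) EfinG ->
      (forall V : set_type M, is_model R (FIN _) (EfinN V)) ->
      (forall V : set_type M, is_model R (triv_fam _) (EW V)) ->
      (forall V : set_type M, is_gmap (f V)) ->
      cellular_gpushout i (norm_coprod_map f) j k ->
      is_model R (VCY G) Y).
Proof.
split=> maxG M EG EN EW f X i j k repM modG modN modW gf po.
- apply: (pushout_model (F1 := triv_fam G) (S := maximal_in (FIN G))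
    maxG _ _ repM modG _ modW gf po) => //.
  + by move=> F /maximal_inD[].
  + move=> F H H1; have [_ fixN] := modN F.
    by have [+ _] := fixN (sub_in H (normalizer (sval F))); apply; exact: triv_sub_in.
- apply: (pushout_model (F1 := FIN G) (F2 := VCY G)
    (S := maximal_in (VCY G `\` FIN G)) maxG _ _ repM modG _ modW gf po) => //.
  + by move=> F /maximal_inD[].
  + move=> F H finH; have [_ fixN] := modN F.
    by have [+ _] := fixN (sub_in H (normalizer (sval F))); apply; exact: fin_sub_in.
Qed.
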